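(* Consider the stochastic bilevel problem $\min_{\mathbf{x}\in\mathbb{R}^d}F(\mathbf{x})=f(\mathbf{x},\mathbf{y}^*(\mathbf{x}))$, $\mathbf{y}^*(\mathbf{x})=\arg\min_{\mathbf{y}\in\mathbb{R}^{d'}}g(\mathbf{x},\mathbf{y})$, under Assumptions A and B of the context, and run the algorithm SVRB described in the context. Write $\mathcal{L}=L_{gy}^2+L_{fx}^2+L_{fy}^2+L_{gxy}^2+L_{gyy}^2$ and $$C_0=2L_{fx}^2+\frac{6C_{fy}^2L_{gxy}^2}{\lambda^2}+\frac{6C_{fy}^2C_{gxy}^2L_{gyy}^2}{\lambda^4}+\frac{6L_{fy}^2C_{gxy}^2}{\lambda^2},\quad C_1=2,\quad C_2=\frac{6C_{fy}^2}{\lambda^2},\quad C_3=\frac{6C_{fy}^2C_{gxy}^2}{\lambda^4},\quad C_4=\frac{6C_{gxy}^2}{\lambda^2}.$$ Let $c>0$ and suppose that the parameters satisfy $\tau\le \frac{1}{3L_g}$, $\gamma\le\min\left\{\frac{\sqrt{\tau\lambda}}{8\sqrt{C}L_y},\frac{1}{16\mathcal{L}}\right\}$, $C=\max\left\{\frac{4C_0}{\tau\lambda},\frac{4\mathcal{L}}{\gamma}\right\}$, $\eta_t=\tau_t=c/(c_0+t)^{1/3}$, where $$c_0\ge\max\left\{2,\ (4L_Fc)^3,\ \left(\tfrac{c^2\lambda}{16C\gamma\tau}\right)^{3/2},\ \left(\tfrac{2}{7L_Fc}\right)^{3/2},\ \left(2(C_1+C_2+C_3+C_4)\gamma c^2\right)^{3/2}\right\},$$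 and for $t\ge 0$ $$\beta_{gy,t+1}=\left(\tfrac{1}{7L_Fc^3}+\tfrac{8C\gamma\tau_t\tau}{\lambda\eta_t}\right)\eta_t^2,\quad \beta_{fx,t+1}=\left(\tfrac{1}{7L_Fc^3}+C_1\gamma\right)\eta_t^2,\quad \beta_{fy,t+1}=\left(\tfrac{1}{7L_Fc^3}+C_4\gamma\right)\eta_t^2,$$ $$\beta_{gxy,t+1}=\left(\tfrac{1}{7L_Fc^3}+C_2\gamma\right)\eta_t^2,\quad \beta_{gyy,t+1}=\left(\tfrac{1}{7L_Fc^3}+C_3\gamma\right)\eta_t^2 .$$ Then $$\mathbb{E}\left[\frac{1}{T+1}\sum_{t=0}^T\|\nabla F(\mathbf{x}_t)\|^2\right]\le\widetilde O\left(\frac{1}{T^{2/3}}\right),$$ where $\widetilde O$ hides factors logarithmic in $T$ and constants independent of $T$.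
   Context: Norms: $\|\cdot\|$ is the $\ell_2$ norm of a vector or the spectral norm of a matrix, $\|\cdot\|_F$ is the Frobenius norm. Lipschitz continuity and variances are with respect to the Euclidean norm (Frobenius for matrices). Problem: $f(\mathbf{x},\mathbf{y})=\mathbb{E}_\xi[f(\mathbf{x},\mathbf{y};\xi)]$ and $g(\mathbf{x},\mathbf{y})=\mathbb{E}_\zeta[g(\mathbf{x},\mathbf{y};\zeta)]$ on $\mathbb{R}^d\times\mathbb{R}^{d'}$, sufficiently differentiable; stochastic derivatives are unbiased. $\nabla_{xy}^2g(\mathbf{x},\mathbf{y})\in\mathbb{R}^{d\times d'}$ and $\nabla_{yy}^2g(\mathbf{x},\mathbf{y})\in\mathbb{R}^{d'\times d'}$. Assumption A: for every $\mathbf{x}$, $g(\mathbf{x},\cdot)$ is $L_g$-smooth and $\lambda$-strongly convex ($\lambda>0$), i.e. $L_gI\succeq\nabla_{yy}^2g(\mathbf{x},\mathbf{y})\succeq\lambda I$. Assumption B: (i) $\nabla_xf(\mathbf{x},\mathbf{y};\xi)$, $\nabla_yf(\mathbf{x},\mathbf{y};\xi)$, $\nabla_yg(\mathbf{x},\mathbf{y};\zeta)$, $\nabla_{xy}^2g(\mathbf{x},\mathbf{y};\zeta)$, $\nabla_{yy}^2g(\mathbf{x},\mathbf{y};\zeta)$ are Lipschitz continuous in $(\mathbf{x},\mathbf{y})$ with constants $L_{fx},L_{fy},L_{gy},L_{gxy},L_{gyy}$ respectively; (ii) each of these five stochastic quantities has variance bounded by $\sigma^2$; (iii) $\|\nabla_yf(\mathbf{x},\mathbf{y})\|^2\le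 C_{fy}^2$ and $\|\nabla_{xy}^2g(\mathbf{x},\mathbf{y})\|^2\le C_{gxy}^2$; (iv) $F(\mathbf{x}_0)-F(\mathbf{x}_* )\le\Delta$ where $\mathbf{x}_*=\arg\min_{\mathbf{x}}F(\mathbf{x})$. $L_F$ and $L_y$ denote constants such that $\|\nabla F(\mathbf{x})-\nabla F(\mathbf{x}')\|\le L_F\|\mathbf{x}-\mathbf{x}'\|$ and $\|\mathbf{y}^*(\mathbf{x})-\mathbf{y}^*(\mathbf{x}')\|\le L_y\|\mathbf{x}-\mathbf{x}'\|$ for all $\mathbf{x},\mathbf{x}'$ (such constants exist under Assumptions A and B). Projections: $\Pi_C$ is the Euclidean projection onto $\{\mathbf{u}:\|\mathbf{u}\|\le C\}$; $\mathbf{S}^u_C$ is the projection onto the matrices with $\|X\|\le C$; $\mathbf{S}^l_\lambda$ is the projection onto the matrices with $X\succeq\lambda I$. Algorithm SVRB. Parameters $\gamma,\tau>0$, step sizes $\eta_t,\tau_t$, and momentum parameters $\beta_{fx,t},\beta_{fy,t},\beta_{gxy,t},\beta_{gyy,t},\beta_{gy,t}$. Initialize $\mathbf{x}_0,\mathbf{y}_0,\mathbf{u}_0,\mathbf{v}_0,V_0,H_0,\mathbf{w}_0$, with the convention $\mathbf{x}_{-1}=\mathbf{x}_0$, $\mathbf{y}_{-1}=\mathbf{y}_0$ and arbitrary momentum parameters in $(0,1]$ at index $0$. At each iteration $t=0,1,\dots,T$ draw fresh independent samples $\xi_t,\zeta_t$ and set - $\mathbf{u}_{t+1}=(1-\beta_{fx,t})(\mathbf{u}_t-\nabla_xf(\mathbf{x}_{t-1},\mathbf{y}_{t-1};\xi_t))+\nabla_xf(\mathbf{x}_t,\mathbf{y}_t;\xi_t)$,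 - $\mathbf{v}_{t+1}=\Pi_{C_{fy}}[(1-\beta_{fy,t})(\mathbf{v}_t-\nabla_yf(\mathbf{x}_{t-1},\mathbf{y}_{t-1};\xi_t))+\nabla_yf(\mathbf{x}_t,\mathbf{y}_t;\xi_t)]$, - $V_{t+1}=\mathbf{S}^u_{C_{gxy}}[(1-\beta_{gxy,t})(V_t-\nabla_{xy}^2g(\mathbf{x}_{t-1},\mathbf{y}_{t-1};\zeta_t))+\nabla_{xy}^2g(\mathbf{x}_t,\mathbf{y}_t;\zeta_t)]$, - $H_{t+1}=\mathbf{S}^l_\lambda[(1-\beta_{gyy,t})(H_t-\nabla_{yy}^2g(\mathbf{x}_{t-1},\mathbf{y}_{t-1};\zeta_t))+\nabla_{yy}^2g(\mathbf{x}_t,\mathbf{y}_t;\zeta_t)]$, - $\mathbf{w}_{t+1}=(1-\beta_{gy,t})(\mathbf{w}_t-\nabla_yg(\mathbf{x}_{t-1},\mathbf{y}_{t-1};\zeta_t))+\nabla_yg(\mathbf{x}_t,\mathbf{y}_t;\zeta_t)$, - $\mathbf{z}_{t+1}=\mathbf{u}_{t+1}-V_{t+1}[H_{t+1}]^{-1}\mathbf{v}_{t+1}$, - $\mathbf{x}_{t+1}=\mathbf{x}_t-\eta_t\gamma\mathbf{z}_{t+1}$, $\quad\mathbf{y}_{t+1}=\mathbf{y}_t-\tau_t\tau\mathbf{w}_{t+1}$. The expectation is over all randomness of the algorithm. *)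

(* Defs.v *)
From HB Require Import structures.
From mathcomp Require Import all_boot all_order all_algebra.
From mathcomp Require Import all_classical all_reals all_analysis.

Set Implicit Arguments.
Unset Strict Implicit.
Unset Printing Implicit Defensive.

Import Order.TTheory GRing.Theory Num.Theory.
Import numFieldNormedType.Exports.

Local Open Scope classical_set_scope.
Local Open Scope ring_scope.

Section Euclidean.
Context {R : realType}.

(* Frobenius norm; on column vectors it is the l2 norm.  The library norm
   `|A| on matrices is the sup norm, which is not the one used here. *)
Definition frob m n (A : 'M[R]_(m, n)) : R :=
  Num.sqrt (\sum_i \sum_j A i j ^+ 2).

Definition specnorm m n (A : 'M[R]_(m, n)) : R :=
  sup [set frob (A *m v) | v in [set v : 'cV[R]_n | frob v <= 1]].

Definition psd n (A : 'M[R]_n) : Prop :=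
  A^T = A /\ forall v : 'cV[R]_n, 0 <= (v^T *m A *m v) 0 0.

Definition loewner_le n (A B : 'M[R]_n) : Prop := psd (B - A).

(* All the sets projected onto below are nonempty, closed and convex, so the
   nearest point exists and is unique and the default value X is not used. *)
Definition proj m n (S : set 'M[R]_(m, n)) (X : 'M[R]_(m, n)) : 'M[R]_(m, n) :=
  xget X [set Z | S Z /\ forall W, S W -> frob (X - Z) <= frob (X - W)].

Definition proj_ball n (C : R) : 'cV[R]_n -> 'cV[R]_n :=
  proj [set u | frob u <= C].

Definition proj_spec_le m n (C : R) : 'M[R]_(m, n) -> 'M[R]_(m, n) :=
  proj [set X | specnorm X <= C].

Definition proj_loewner_ge n (lambda : R) : 'M[R]_n -> 'M[R]_n :=
  proj [set X | loewner_le lambda%:M X].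

Definition grad n (h : 'cV[R]_n -> R) (x : 'cV[R]_n) : 'cV[R]_n :=
  \col_i 'D_(delta_mx i 0) h x.

Definition is_argmin (T : Type) (h : T -> R) (z : T) : Prop :=
  forall z', h z <= h z'.

Definition lipschitz_grad n (h : 'cV[R]_n -> R) (L : R) : Prop :=
  forall x x', frob (grad h x - grad h x') <= L * frob (x - x').

(* [a T <= O~(b T)]: up to a constant and a power of the logarithm, neither of
   which depends on T; 1 + ln T avoids the zero of ln at T = 1. *)
Definition softO_le (a : nat -> \bar R) (b : nat -> R) : Prop :=
  exists (K : R) (p : nat), forall T : nat, (0 < T)%N ->
    (a T <= (K * (1 + ln T%:R) ^+ p * b T)%:E)%E.

End Euclidean.

Section TwoVariables.
Context {R : realType} {d d' : nat}.

Definition gradx (h : 'cV[R]_d -> 'cV[R]_d' -> R) x y : 'cV[R]_d :=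
  grad (fun x' => h x' y) x.

Definition grady (h : 'cV[R]_d -> 'cV[R]_d' -> R) x y : 'cV[R]_d' :=
  grad (h x) y.

Definition hessxy (h : 'cV[R]_d -> 'cV[R]_d' -> R) x y : 'M[R]_(d, d') :=
  \matrix_(i, j) 'D_(delta_mx i 0) (fun x' => grady h x' y j 0) x.

Definition hessyy (h : 'cV[R]_d -> 'cV[R]_d' -> R) x y : 'M[R]_d' :=
  \matrix_(i, j) 'D_(delta_mx i 0) (fun y' => grady h x y' j 0) y.

Definition differentiable_xy (h : 'cV[R]_d -> 'cV[R]_d' -> R) : Prop :=
  forall p : 'cV[R]_d * 'cV[R]_d',
    differentiable (fun q : 'cV[R]_d * 'cV[R]_d' => h q.1 q.2) p.

Definition differentiable_xy_with_grady (h : 'cV[R]_d -> 'cV[R]_d' -> R) : Prop :=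
  differentiable_xy h /\
  forall p : 'cV[R]_d * 'cV[R]_d',
    differentiable (fun q : 'cV[R]_d * 'cV[R]_d' => grady h q.1 q.2) p.

(* Lipschitz in (x, y) for the Euclidean norm of R^(d + d'). *)
Definition lipschitz_xy m n (h : 'cV[R]_d -> 'cV[R]_d' -> 'M[R]_(m, n))
    (L : R) : Prop :=
  forall x y x' y', frob (h x y - h x' y') <=
    L * Num.sqrt (frob (x - x') ^+ 2 + frob (y - y') ^+ 2).

End TwoVariables.

Section Stochastic.
Context {R : realType} {dS : measure_display} {S : measurableType dS}.
Variable P : probability S R.

Definition mx_integrable m n (X : S -> 'M[R]_(m, n)) : Prop :=
  forall i j, P.-integrable setT (EFin \o (fun s => X s i j)).

Definition mx_expectation m n (X : S -> 'M[R]_(m, n)) : 'M[R]_(m, n) :=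
  \matrix_(i, j) \int[P]_s X s i j.

Definition mx_variance m n (X : S -> 'M[R]_(m, n)) : \bar R :=
  ('E_P[fun s => (frob (X s - mx_expectation X) ^+ 2)%R])%E.

Context {d d' : nat}.

Definition mean_of (h : 'cV[R]_d -> 'cV[R]_d' -> R)
    (hs : 'cV[R]_d -> 'cV[R]_d' -> S -> R) : Prop :=
  forall x y, P.-integrable setT (EFin \o hs x y) /\
    h x y = \int[P]_s hs x y s.

Definition unbiased m n (H : 'cV[R]_d -> 'cV[R]_d' -> 'M[R]_(m, n))
    (Hs : S -> 'cV[R]_d -> 'cV[R]_d' -> 'M[R]_(m, n)) : Prop :=
  forall x y, mx_integrable (fun s => Hs s x y) /\
    mx_expectation (fun s => Hs s x y) = H x y.

Definition variance_bounded m n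
    (Hs : S -> 'cV[R]_d -> 'cV[R]_d' -> 'M[R]_(m, n)) (sigma : R) : Prop :=
  forall x y, (mx_variance (fun s => Hs s x y) <= (sigma ^+ 2)%:E)%E.

Definition mutually_independent (I : eqType) (F : I -> set (set S)) : Prop :=
  forall (s : seq I) (E : I -> set S), uniq s ->
    (forall i, i \in s -> F i (E i)) ->
    P (\big[setI/setT]_(i <- s) E i) = (\prod_(i <- s) P (E i))%E.

End Stochastic.

Section Problem.
Context {R : realType} {d d' : nat}
  {dX dZ : measure_display} {Xi : measurableType dX} {Zeta : measurableType dZ}.
Variables (PXi : probability Xi R) (PZeta : probability Zeta R).
Variables (f : 'cV[R]_d -> 'cV[R]_d' -> R) (g : 'cV[R]_d -> 'cV[R]_d' -> R).
Variables (fs : 'cV[R]_d -> 'cV[R]_d' -> Xi -> R)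
          (gs : 'cV[R]_d -> 'cV[R]_d' -> Zeta -> R).

Definition at_sample (S : Type) (hs : 'cV[R]_d -> 'cV[R]_d' -> S -> R) (s : S) :
  'cV[R]_d -> 'cV[R]_d' -> R := fun x y => hs x y s.

Record stochastic_problem : Prop := {
  sp_f_mean : mean_of PXi f fs;
  sp_g_mean : mean_of PZeta g gs;
  sp_f_diff : differentiable_xy f;
  sp_fs_diff : forall xi, differentiable_xy (at_sample fs xi);
  sp_g_diff : differentiable_xy_with_grady g;
  sp_gs_diff : forall zeta, differentiable_xy_with_grady (at_sample gs zeta);
  sp_unbiased_fx :
    unbiased PXi (gradx f) (fun xi => gradx (at_sample fs xi));
  sp_unbiased_fy :
    unbiased PXi (grady f) (fun xi => grady (at_sample fs xi));
  sp_unbiased_gy :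
    unbiased PZeta (grady g) (fun zeta => grady (at_sample gs zeta));
  sp_unbiased_gxy :
    unbiased PZeta (hessxy g) (fun zeta => hessxy (at_sample gs zeta));
  sp_unbiased_gyy :
    unbiased PZeta (hessyy g) (fun zeta => hessyy (at_sample gs zeta))
}.

Definition assumption_A (Lg lambda : R) : Prop :=
  0 < lambda /\
  forall x y, loewner_le (hessyy g x y) Lg%:M /\
              loewner_le lambda%:M (hessyy g x y).

Record assumption_B (Lfx Lfy Lgy Lgxy Lgyy sigma Cfy Cgxy Delta : R)
    (F : 'cV[R]_d -> R) (x0 xstar : 'cV[R]_d) : Prop := {
  aB_lip_fx : forall xi, lipschitz_xy (gradx (at_sample fs xi)) Lfx;
  aB_lip_fy : forall xi, lipschitz_xy (grady (at_sample fs xi)) Lfy;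
  aB_lip_gy : forall zeta, lipschitz_xy (grady (at_sample gs zeta)) Lgy;
  aB_lip_gxy : forall zeta, lipschitz_xy (hessxy (at_sample gs zeta)) Lgxy;
  aB_lip_gyy : forall zeta, lipschitz_xy (hessyy (at_sample gs zeta)) Lgyy;
  aB_var_fx :
    variance_bounded PXi (fun xi => gradx (at_sample fs xi)) sigma;
  aB_var_fy :
    variance_bounded PXi (fun xi => grady (at_sample fs xi)) sigma;
  aB_var_gy :
    variance_bounded PZeta (fun zeta => grady (at_sample gs zeta)) sigma;
  aB_var_gxy :
    variance_bounded PZeta (fun zeta => hessxy (at_sample gs zeta)) sigma;
  aB_var_gyy :
    variance_bounded PZeta (fun zeta => hessyy (at_sample gs zeta)) sigma;
  aB_Cfy_ge0 : 0 <= Cfy;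
  aB_Cgxy_ge0 : 0 <= Cgxy;
  aB_bound_fy : forall x y, frob (grady f x y) ^+ 2 <= Cfy ^+ 2;
  aB_bound_gxy : forall x y, specnorm (hessxy g x y) ^+ 2 <= Cgxy ^+ 2;
  aB_argmin : is_argmin F xstar;
  aB_gap : F x0 - F xstar <= Delta
}.

Context {dO : measure_display} {Omega : measurableType dO}.
Variable P : probability Omega R.
Variables (xi : nat -> {mfun Omega >-> Xi}) (zeta : nat -> {mfun Omega >-> Zeta}).

Definition sample_events (k : nat + nat) : set (set Omega) :=
  match k with
  | inl t => preimage_set_system setT (xi t) measurable
  | inr t => preimage_set_system setT (zeta t) measurable
  end.

Definition fresh_samples : Prop :=
  [/\ forall t A, measurable A -> distribution P (xi t) A = PXi A,
      forall t A, measurable A -> distribution P (zeta t) A = PZeta A &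
      mutually_independent P sample_events].

(* Since 0.-1 = 0, the index t.-1 realizes the convention x_(-1) = x_0,
   y_(-1) = y_0. *)
Record svrb (Cfy Cgxy lambda gamma tau : R) (eta taus : nat -> R)
    (bfx bfy bgxy bgyy bgy : nat -> R)
    (x0 : 'cV[R]_d) (y0 : 'cV[R]_d') (u0 : 'cV[R]_d) (v0 : 'cV[R]_d')
    (V0 : 'M[R]_(d, d')) (H0 : 'M[R]_d') (w0 : 'cV[R]_d')
    (x : nat -> Omega -> 'cV[R]_d) (y : nat -> Omega -> 'cV[R]_d')
    (u : nat -> Omega -> 'cV[R]_d) (v : nat -> Omega -> 'cV[R]_d')
    (V : nat -> Omega -> 'M[R]_(d, d')) (H : nat -> Omega -> 'M[R]_d')
    (w : nat -> Omega -> 'cV[R]_d') (z : nat -> Omega -> 'cV[R]_d) : Prop := {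
  svrb_x0 : forall o, x 0%N o = x0;
  svrb_y0 : forall o, y 0%N o = y0;
  svrb_u0 : forall o, u 0%N o = u0;
  svrb_v0 : forall o, v 0%N o = v0;
  svrb_V0 : forall o, V 0%N o = V0;
  svrb_H0 : forall o, H 0%N o = H0;
  svrb_w0 : forall o, w 0%N o = w0;
  svrb_u : forall t o, let Gfx := gradx (at_sample fs (xi t o)) in
    u t.+1 o = (1 - bfx t) *: (u t o - Gfx (x t.-1 o) (y t.-1 o))
               + Gfx (x t o) (y t o);
  svrb_v : forall t o, let Gfy := grady (at_sample fs (xi t o)) in
    v t.+1 o = proj_ball Cfy
      ((1 - bfy t) *: (v t o - Gfy (x t.-1 o) (y t.-1 o))
       + Gfy (x t o) (y t o));
  svrb_V : forall t o, let Gxy := hessxy (at_sample gs (zeta t o)) in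
    V t.+1 o = proj_spec_le Cgxy
      ((1 - bgxy t) *: (V t o - Gxy (x t.-1 o) (y t.-1 o))
       + Gxy (x t o) (y t o));
  svrb_H : forall t o, let Gyy := hessyy (at_sample gs (zeta t o)) in
    H t.+1 o = proj_loewner_ge lambda
      ((1 - bgyy t) *: (H t o - Gyy (x t.-1 o) (y t.-1 o))
       + Gyy (x t o) (y t o));
  svrb_w : forall t o, let Ggy := grady (at_sample gs (zeta t o)) in
    w t.+1 o = (1 - bgy t) *: (w t o - Ggy (x t.-1 o) (y t.-1 o))
               + Ggy (x t o) (y t o);
  svrb_z : forall t o,
    z t.+1 o = u t.+1 o - V t.+1 o *m invmx (H t.+1 o) *m v t.+1 o;
  svrb_x : forall t o, x t.+1 o = x t o - (eta t * gamma) *: z t.+1 o;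
  svrb_y : forall t o, y t.+1 o = y t o - (taus t * tau) *: w t.+1 o
}.

End Problem.

(* Main.v *)
Require Import Defs.
From HB Require Import structures.
From mathcomp Require Import all_boot all_order all_algebra.
From mathcomp Require Import all_classical all_reals all_analysis.
From mathcomp Require Import measurable_realfun.
From mathcomp Require Import ring lra.
Import Order.TTheory GRing.Theory Num.Theory.
Import numFieldNormedType.Exports.
Local Open Scope ring_scope.

(** The proof is a Lyapunov argument in the style of STORM. Write [D_t] for
[|y_t - ystar x_t|^2] and [e_t] for the squared Frobenius errors of the five running
estimates [u], [v], [V], [H], [w] of the derivatives. The potential is
[F x_t - F xstar + C gamma D_t + (1 / eta_(t-1)) * (sum of the five errors)].

For a fixed outcome, three inequalities compare consecutive terms. Implicit
differentiation of [grady g x (ystar x) = 0] gives the gradient of [F]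
([hypergradient]), and the error of [z] as an estimate of it is bounded by [D_t] and by
the errors of the estimates, with the constants [C0] to [C4] ([hypergradient_error]).
Smoothness of [F] then gives the descent of [F] along [z] ([F_descent]). Strong convexity
and smoothness of [g] in [y] make one inexact gradient step contract [D_t]
([tracking_step]). The constants are chosen so that, in the sum, the [x]-steps, the
[y]-steps and [D_t] are all absorbed ([potential_decrease]).

The errors decrease in the mean only. Given the past, the fresh sample contributes a
noise of mean zero, so the old error is multiplied by [(1 - b)^2] and only the second
moment of the noise is added; the part of the noise not multiplied by the momentum [b]
is a difference of one sample function at two consecutive points, which the Lipschitz
assumption bounds by the motion of the iterates ([storm_step]). Projecting onto a closed
convex set that contains the target does not increase an error ([frob_proj_le]). To pass
to the expectation over the whole run, the fresh sample is integrated out with the past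
frozen ([integral_fresh]); the past is the sigma-algebra generated by the earlier
samples, and the iterates are measurable for it because a function measurable in the
sample and continuous in the state is jointly measurable ([caratheodory]). All integrands
are nonnegative, so extended-real integrals suffice.

The decrease of the potential needs several upper bounds on the step size. As [eta]
tends to zero they hold from some time [t0] on ([potential_descent_eventually]). Before
[t0] the potential grows by at most a constant factor and a constant per step
([next_potential_dominated]), hence stays integrable; this changes the constant of the
rate only. From [t0] on, summing the decrease bounds the [eta]-weighted sum of the
squared gradients by a constant plus the sum of the [eta_t^3], which is harmonic, hence
logarithmic; dividing by the last and smallest weight, of order [T^(-1/3)], gives the
rate ([rate_of_potential]). *)

Set Implicit Arguments.
Unset Strict Implicit.
Unset Printing Implicit Defensive.

(** * The Frobenius inner product *)

Section FrobeniusProduct.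
Context {R : realType}.

Definition fdot m n (A B : 'M[R]_(m, n)) : R := \sum_i \sum_j A i j * B i j.

Lemma fdotC m n (A B : 'M[R]_(m, n)) : fdot A B = fdot B A.
Proof. by apply: eq_bigr => i _; apply: eq_bigr => j _; rewrite mulrC. Qed.

Lemma fdotDl m n (A B D : 'M[R]_(m, n)) : fdot (A + B) D = fdot A D + fdot B D.
Proof.
rewrite -big_split; apply: eq_bigr => i _; rewrite -big_split.
by apply: eq_bigr => j _; rewrite mxE mulrDl.
Qed.

Lemma fdotZl m n a (A B : 'M[R]_(m, n)) : fdot (a *: A) B = a * fdot A B.
Proof.
rewrite mulr_sumr; apply: eq_bigr => i _; rewrite mulr_sumr.
by apply: eq_bigr => j _; rewrite mxE mulrA.
Qed.

Lemma fdotNl m n (A B : 'M[R]_(m, n)) : fdot (- A) B = - fdot A B.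
Proof. by rewrite -scaleN1r fdotZl mulN1r. Qed.

Lemma fdotBl m n (A B D : 'M[R]_(m, n)) : fdot (A - B) D = fdot A D - fdot B D.
Proof. by rewrite fdotDl fdotNl. Qed.

Lemma fdotDr m n (A B D : 'M[R]_(m, n)) : fdot D (A + B) = fdot D A + fdot D B.
Proof. by rewrite fdotC fdotDl !(fdotC D). Qed.

Lemma fdotZr m n a (A B : 'M[R]_(m, n)) : fdot A (a *: B) = a * fdot A B.
Proof. by rewrite fdotC fdotZl fdotC. Qed.

Lemma fdotNr m n (A B : 'M[R]_(m, n)) : fdot A (- B) = - fdot A B.
Proof. by rewrite fdotC fdotNl fdotC. Qed.

Lemma fdotBr m n (A B D : 'M[R]_(m, n)) : fdot D (A - B) = fdot D A - fdot D B.
Proof. by rewrite fdotDr fdotNr. Qed.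

Lemma fdot0l m n (A : 'M[R]_(m, n)) : fdot 0 A = 0.
Proof. by rewrite -(scale0r A) fdotZl mul0r. Qed.

Lemma fdot0r m n (A : 'M[R]_(m, n)) : fdot A 0 = 0.
Proof. by rewrite fdotC fdot0l. Qed.

Lemma fdotAA_ge0 m n (A : 'M[R]_(m, n)) : 0 <= fdot A A.
Proof. by do 2!(apply: sumr_ge0 => ? _); rewrite -expr2 sqr_ge0. Qed.

Lemma sqr_frob m n (A : 'M[R]_(m, n)) : frob A ^+ 2 = fdot A A.
Proof.
have E : \sum_i \sum_j A i j ^+ 2 = fdot A A.
  by apply: eq_bigr => i _; apply: eq_bigr => j _; rewrite expr2.
by rewrite /frob E sqr_sqrtr// fdotAA_ge0.
Qed.

Lemma frob_ge0 m n (A : 'M[R]_(m, n)) : 0 <= frob A.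
Proof. exact: sqrtr_ge0. Qed.

Lemma frob0 m n : frob (0 : 'M[R]_(m, n)) = 0.
Proof. by apply/eqP; rewrite -sqrf_eq0 sqr_frob fdot0l. Qed.

Lemma frob_le m n (A : 'M[R]_(m, n)) r : 0 <= r -> (frob A <= r) = (fdot A A <= r ^+ 2).
Proof. by move=> r0; rewrite -sqr_frob ler_sqr ?nnegrE// frob_ge0. Qed.

Lemma frobZ m n a (A : 'M[R]_(m, n)) : frob (a *: A) = `|a| * frob A.
Proof.
apply/eqP; rewrite -(eqrXn2 (n := 2))// ?mulr_ge0 ?frob_ge0//.
by rewrite exprMn !sqr_frob fdotZl fdotZr mulrA -expr2 real_normK ?num_real.
Qed.

Lemma frobN m n (A : 'M[R]_(m, n)) : frob (- A) = frob A.
Proof. by rewrite -scaleN1r frobZ normrN1 mul1r. Qed.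

Lemma frobBC m n (A B : 'M[R]_(m, n)) : frob (A - B) = frob (B - A).
Proof. by rewrite -frobN opprB. Qed.

Lemma sqr_entry_le m n (A : 'M[R]_(m, n)) i j : A i j ^+ 2 <= fdot A A.
Proof.
rewrite /fdot (bigD1 i)//= (bigD1 j)//= -expr2 -addrA lerDl addr_ge0//.
  by apply: sumr_ge0 => k _; rewrite -expr2 sqr_ge0.
by do 2!(apply: sumr_ge0 => ? _); rewrite -expr2 sqr_ge0.
Qed.

Lemma entry_le m n (A : 'M[R]_(m, n)) i j : `|A i j| <= frob A.
Proof.
rewrite -ler_sqr ?nnegrE ?frob_ge0// sqr_frob real_normK ?num_real//.
exact: sqr_entry_le.
Qed.

Lemma frob_eq0 m n (A : 'M[R]_(m, n)) : frob A = 0 -> A = 0.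
Proof.
move=> A0; apply/matrixP => i j; rewrite mxE; apply/eqP.
by rewrite -normr_le0 -A0 entry_le.
Qed.

Lemma CauchySchwarz m n (A B : 'M[R]_(m, n)) : fdot A B <= frob A * frob B.
Proof.
have [B0|Bn0] := eqVneq (frob B) 0.
  by rewrite B0 (frob_eq0 B0) fdot0r mulr0.
have := fdotAA_ge0 (frob B ^+ 2 *: A - fdot A B *: B).
rewrite !(fdotBl, fdotBr, fdotZl, fdotZr) (fdotC B A) -!sqr_frob => h.
have Bp : 0 < frob B by rewrite lt0r Bn0 frob_ge0.
have {h} : 0 <= frob B ^+ 2 * ((frob A * frob B) ^+ 2 - fdot A B ^+ 2).
  by apply: le_trans h _; rewrite le_eqVlt; apply/orP; left; apply/eqP; ring.
rewrite pmulr_rge0 ?exprn_gt0// subr_ge0 => h.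
have [h0|h0] := leP (fdot A B) 0.
  by rewrite (le_trans h0)// mulr_ge0 ?frob_ge0.
by rewrite -ler_sqr ?nnegrE ?mulr_ge0 ?frob_ge0// ltW.
Qed.

Lemma normr_fdot_le m n (A B : 'M[R]_(m, n)) : `|fdot A B| <= frob A * frob B.
Proof.
rewrite ler_norml CauchySchwarz andbT lerNl -fdotNl.
by rewrite (le_trans (CauchySchwarz _ _))// frobN.
Qed.

Lemma sqr_fdot_le m n (A B : 'M[R]_(m, n)) : fdot A B ^+ 2 <= fdot A A * fdot B B.
Proof.
rewrite -!sqr_frob -exprMn -real_normK ?num_real// ler_sqr ?nnegrE//.
  exact: normr_fdot_le.
by rewrite mulr_ge0 ?frob_ge0.
Qed.

Lemma frobD m n (A B : 'M[R]_(m, n)) : frob (A + B) <= frob A + frob B.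
Proof.
rewrite frob_le ?addr_ge0 ?frob_ge0// !(fdotDl, fdotDr) (fdotC B A) -!sqr_frob.
by have := CauchySchwarz A B; lra.
Qed.

Lemma frob_triangle m n (A B D : 'M[R]_(m, n)) :
  frob (A - D) <= frob (A - B) + frob (B - D).
Proof. by rewrite (le_trans _ (frobD _ _))// addrA subrK. Qed.

(** Young's inequality, from [0 <= |p A - B|^2]. *)
Lemma fdotAAD_le m n p (A B : 'M[R]_(m, n)) : 0 < p ->
  fdot (A + B) (A + B) <= (1 + p) * fdot A A + (1 + p^-1) * fdot B B.
Proof.
move=> p0; rewrite -subr_ge0.
have := fdotAA_ge0 (p *: A - B); rewrite !(fdotBl, fdotBr, fdotZl, fdotZr) (fdotC B A).
rewrite -(pmulr_rge0 _ p0) !(fdotDl, fdotDr) (fdotC B A) => h.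
apply: le_trans h _; rewrite le_eqVlt; apply/orP; left; apply/eqP; field.
by rewrite gt_eqF.
Qed.

Lemma sqr_frobD_le m n (A B : 'M[R]_(m, n)) :
  frob (A + B) ^+ 2 <= 2 * frob A ^+ 2 + 2 * frob B ^+ 2.
Proof. by rewrite !sqr_frob; have := @fdotAAD_le m n 1 A B ltr01; rewrite invr1. Qed.

Lemma sqr_frobD3_le m n (A B D : 'M[R]_(m, n)) :
  frob (A + B + D) ^+ 2 <= 3 * frob A ^+ 2 + 3 * frob B ^+ 2 + 3 * frob D ^+ 2.
Proof.
rewrite !sqr_frob -subr_ge0.
have := fdotAA_ge0 (A - B); have := fdotAA_ge0 (A - D); have := fdotAA_ge0 (B - D).
rewrite !(fdotBl, fdotBr, fdotDl, fdotDr) (fdotC B A) (fdotC D A) (fdotC D B).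
lra.
Qed.

Lemma fdot_mulmx m n p (A : 'M[R]_(m, n)) (B : 'M[R]_(n, p)) (D : 'M[R]_(m, p)) :
  fdot (A *m B) D = fdot B (A^T *m D).
Proof.
transitivity (\sum_i \sum_j \sum_k A i k * B k j * D i j).
  apply: eq_bigr => i _; apply: eq_bigr => j _.
  by rewrite mxE mulr_suml.
under eq_bigr => i _ do rewrite exchange_big.
rewrite exchange_big; apply: eq_bigr => k _; rewrite exchange_big.
apply: eq_bigr => j _; rewrite mxE mulr_sumr; apply: eq_bigr => i _.
by rewrite mxE; ring.
Qed.

Lemma fdot_cV n (A B : 'cV[R]_n) : fdot A B = \sum_i A i 0 * B i 0.
Proof. by apply: eq_bigr => i _; rewrite big_ord1. Qed.

Lemma fdot_quad n (A : 'M[R]_n) (v : 'cV[R]_n) : (v^T *m A *m v) 0 0 = fdot v (A *m v).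
Proof. by rewrite fdot_cV -mulmxA mxE; apply: eq_bigr => i _; rewrite mxE. Qed.

Lemma frob_mulmx m n (A : 'M[R]_(m, n)) (v : 'cV[R]_n) : frob (A *m v) <= frob A * frob v.
Proof.
rewrite frob_le ?mulr_ge0 ?frob_ge0// exprMn !sqr_frob mulr_suml fdot_cV.
apply: ler_sum => i _; rewrite mxE -expr2.
have := sqr_fdot_le ((row i A)^T) v; rewrite !fdot_cV => h.
have E : \sum_j A i j * v j 0 = \sum_i0 (row i A)^T i0 0 * v i0 0.
  by apply: eq_bigr => j _; rewrite !mxE.
rewrite E (le_trans h)// le_eqVlt; apply/orP; left; apply/eqP; congr (_ * _).
by apply: eq_bigr => j _; rewrite !mxE.
Qed.

End FrobeniusProduct.

(** * The spectral norm and the Loewner order *)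

Section SpectralNorm.
Context {R : realType}.
Local Open Scope classical_set_scope.

Lemma has_sup_specnorm m n (A : 'M[R]_(m, n)) :
  has_sup [set frob (A *m v) | v in [set v : 'cV[R]_n | frob v <= 1]].
Proof.
split; first by exists (frob (A *m (0 : 'cV_n))); exists 0 => //=; rewrite frob0 ler01.
exists (frob A) => _ [v /= v1 <-]; rewrite (le_trans (frob_mulmx _ _))//.
by rewrite -[leRHS]mulr1 ler_wpM2l// frob_ge0.
Qed.

Lemma specnorm_ge0 m n (A : 'M[R]_(m, n)) : 0 <= specnorm A.
Proof.
have [_ ub] := has_sup_specnorm A.
by apply: (ub_le_sup ub); exists 0 => /=; rewrite ?mulmx0 frob0 ?ler01.
Qed.

Lemma frob_mulmx_specnorm m n (A : 'M[R]_(m, n)) (v : 'cV[R]_n) :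
  frob (A *m v) <= specnorm A * frob v.
Proof.
have [v0|vn0] := eqVneq (frob v) 0.
  by rewrite v0 (frob_eq0 v0) mulmx0 frob0 mulr0.
have vp : 0 < frob v by rewrite lt0r vn0 frob_ge0.
have [_ ub] := has_sup_specnorm A.
rewrite -ler_pdivrMr// -[_ / _]mulrC -[(frob v)^-1]ger0_norm ?invr_ge0 ?frob_ge0//.
rewrite -frobZ; apply: (ub_le_sup ub); exists ((frob v)^-1 *: v) => /=.
  by rewrite frobZ ger0_norm ?invr_ge0 ?frob_ge0// mulVf.
by rewrite scalemxAr.
Qed.

Lemma specnorm_le m n (A : 'M[R]_(m, n)) r :
  0 <= r -> (forall v : 'cV[R]_n, frob (A *m v) <= r * frob v) -> specnorm A <= r.
Proof.
move=> r0 Ar; have [ne _] := has_sup_specnorm A.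
apply: ge_sup => // _ [v /= v1 <-]; apply: (le_trans (Ar v)).
by rewrite -[leRHS]mulr1 ler_wpM2l.
Qed.

End SpectralNorm.

Section LoewnerOrder.
Context {R : realType} {n : nat}.
Implicit Types (A H K : 'M[R]_n) (v : 'cV[R]_n) (a : R).

Lemma fdot_scalar_mx a v : fdot v (a%:M *m v) = a * fdot v v.
Proof. by rewrite mul_scalar_mx fdotZr. Qed.

Lemma loewner_ge_quad a H v : loewner_le a%:M H -> a * fdot v v <= fdot v (H *m v).
Proof.
by move=> [_ /(_ v)]; rewrite fdot_quad mulmxBl fdotBr fdot_scalar_mx subr_ge0.
Qed.

Lemma loewner_le_quad a H v : loewner_le H a%:M -> fdot v (H *m v) <= a * fdot v v.
Proof.
by move=> [_ /(_ v)]; rewrite fdot_quad mulmxBl fdotBr fdot_scalar_mx subr_ge0.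
Qed.

Lemma loewner_ge_sym a H : loewner_le a%:M H -> H^T = H.
Proof. by move=> [+ _]; rewrite linearB/= tr_scalar_mx => /addIr. Qed.

Lemma loewner_geP a H :
  H^T = H -> (forall v, a * fdot v v <= fdot v (H *m v)) -> loewner_le a%:M H.
Proof.
move=> HT Hq; split; first by rewrite linearB/= tr_scalar_mx HT.
by move=> v; rewrite fdot_quad mulmxBl fdotBr fdot_scalar_mx subr_ge0.
Qed.

Variable lambda : R.
Hypothesis lambda_gt0 : 0 < lambda.

Lemma loewner_ge_frob H v : loewner_le lambda%:M H -> lambda * frob v <= frob (H *m v).
Proof.
move=> Hl; have [->|vn0] := eqVneq (frob v) 0; first by rewrite mulr0 frob_ge0.
have vp : 0 < frob v by rewrite lt0r vn0 frob_ge0.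
rewrite -(ler_pM2l vp) mulrCA -expr2 sqr_frob.
exact: le_trans (loewner_ge_quad v Hl) (CauchySchwarz _ _).
Qed.

Lemma loewner_ge_unitmx H : loewner_le lambda%:M H -> H \in unitmx.
Proof.
move=> Hl; rewrite -unitmx_tr -row_free_unit -kermx_eq0; apply/rowV0P => u /sub_kermxP uH.
have : H *m u^T = 0 by rewrite -[H]trmxK -trmx_mul uH trmx0.
move=> Hu; have := loewner_ge_frob u^T Hl; rewrite Hu frob0 pmulr_rle0// => u0.
have /frob_eq0 uT0 : frob u^T = 0 by apply/eqP; rewrite eq_le u0 frob_ge0.
by rewrite -[u]trmxK uT0 trmx0.
Qed.

Lemma frob_invmx_mul H v :
  loewner_le lambda%:M H -> frob (invmx H *m v) <= lambda^-1 * frob v.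
Proof.
move=> Hl; have := loewner_ge_frob (invmx H *m v) Hl.
rewrite mulmxA mulmxV ?loewner_ge_unitmx// mul1mx => h.
by rewrite mulrC ler_pdivlMr// mulrC.
Qed.

(** The resolvent identity [H^-1 - K^-1 = H^-1 (K - H) K^-1]. *)
Lemma frob_invmxB_mul H K v : loewner_le lambda%:M H -> loewner_le lambda%:M K ->
  frob ((invmx H - invmx K) *m v) <= lambda^-1 ^+ 2 * frob (H - K) * frob v.
Proof.
move=> Hl Kl.
have -> : invmx H - invmx K = invmx H *m (K - H) *m invmx K.
  rewrite mulmxBr mulmxBl mulVmx ?loewner_ge_unitmx// mul1mx -mulmxA mulmxV ?mulmx1//.
  exact: loewner_ge_unitmx.
have l0 : 0 <= lambda^-1 by rewrite invr_ge0 ltW.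
rewrite -!mulmxA (le_trans (frob_invmx_mul _ Hl))// expr2 -!mulrA ler_wpM2l//.
rewrite (le_trans (frob_mulmx _ _))// mulrCA frobBC ler_wpM2l ?frob_ge0//.
exact: frob_invmx_mul.
Qed.

(** Change one factor of [V H^-1 v] at a time. Only the norms of [v] and [V'] enter,
which is why these two estimates are kept bounded by projection, and [H] by
[loewner_le] only. The constants are half of the theorem's [C2], [C3], [C4]. *)
Lemma hypergradient_stable d (V V' : 'M[R]_(d, n)) H H' v v' Cf Cg :
  loewner_le lambda%:M H -> loewner_le lambda%:M H' ->
  frob v <= Cf -> 0 <= Cg -> specnorm V' <= Cg ->
  frob (V *m invmx H *m v - V' *m invmx H' *m v') ^+ 2 <=
    3 * (Cf ^+ 2 / lambda ^+ 2) * frob (V - V') ^+ 2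
    + 3 * (Cf ^+ 2 * Cg ^+ 2 / lambda ^+ 4) * frob (H - H') ^+ 2
    + 3 * (Cg ^+ 2 / lambda ^+ 2) * frob (v - v') ^+ 2.
Proof.
move=> Hl Hl' vC Cg0 VC.
have l0 : 0 <= lambda^-1 by rewrite invr_ge0 ltW.
have Cf0 : 0 <= Cf by apply: le_trans vC; rewrite frob_ge0.
have -> : V *m invmx H *m v - V' *m invmx H' *m v' =
    (V - V') *m (invmx H *m v) + V' *m ((invmx H - invmx H') *m v)
    + V' *m (invmx H' *m (v - v')).
  by rewrite mulmxBl mulmxBl !mulmxBr !mulmxA !addrA !subrK.
apply: (le_trans (sqr_frobD3_le _ _ _)).
have b1 : frob ((V - V') *m (invmx H *m v)) <= Cf * lambda^-1 * frob (V - V').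
  rewrite (le_trans (frob_mulmx _ _))// mulrC ler_wpM2r ?frob_ge0//.
  rewrite (le_trans (frob_invmx_mul _ Hl))// mulrC ler_wpM2r//.
have b2 : frob (V' *m ((invmx H - invmx H') *m v)) <=
    Cf * Cg * lambda^-1 ^+ 2 * frob (H - H').
  apply: (le_trans (frob_mulmx_specnorm _ _)).
  have -> : Cf * Cg * lambda^-1 ^+ 2 * frob (H - H') =
    Cg * (lambda^-1 ^+ 2 * frob (H - H') * Cf) by ring.
  apply: ler_pM => //; rewrite ?specnorm_ge0 ?frob_ge0//.
  rewrite (le_trans (frob_invmxB_mul _ Hl Hl'))// ler_wpM2l//.
  by rewrite mulr_ge0 ?exprn_ge0 ?frob_ge0.
have b3 : frob (V' *m (invmx H' *m (v - v'))) <= Cg * lambda^-1 * frob (v - v').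
  rewrite (le_trans (frob_mulmx_specnorm _ _))// -mulrA ler_pM ?specnorm_ge0 ?frob_ge0//.
  exact: frob_invmx_mul.
have sq a b : 0 <= a -> a <= b -> a ^+ 2 <= b ^+ 2.
  by move=> a0 ab; rewrite ler_sqr ?nnegrE// (le_trans a0).
have {}b1 := sq _ _ (frob_ge0 _) b1.
have {}b2 := sq _ _ (frob_ge0 _) b2.
have {}b3 := sq _ _ (frob_ge0 _) b3.
have E1 : 3 * (Cf ^+ 2 / lambda ^+ 2) * frob (V - V') ^+ 2 =
  3 * (Cf * lambda^-1 * frob (V - V')) ^+ 2 by rewrite -exprVn; ring.
have E2 : 3 * (Cf ^+ 2 * Cg ^+ 2 / lambda ^+ 4) * frob (H - H') ^+ 2 =
  3 * (Cf * Cg * lambda^-1 ^+ 2 * frob (H - H')) ^+ 2 by rewrite -exprVn; ring.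
have E3 : 3 * (Cg ^+ 2 / lambda ^+ 2) * frob (v - v') ^+ 2 =
  3 * (Cg * lambda^-1 * frob (v - v')) ^+ 2 by rewrite -exprVn; ring.
rewrite E1 E2 E3; lra.
Qed.

End LoewnerOrder.

(** * Projections onto closed convex sets of matrices *)

Section NormEquivalence.
Context {R : realType}.

Lemma norm_le_frob m n (A : 'M[R]_(m, n)) : `|A| <= frob A.
Proof.
rewrite [leLHS]/Num.norm /= mx_normrE; apply/bigmax_leP; split; first exact: frob_ge0.
by move=> ij _; exact: entry_le.
Qed.

Lemma entry_le_norm m n (A : 'M[R]_(m, n)) i j : `|A i j| <= `|A|.
Proof.
rewrite [leRHS]/Num.norm /= mx_normrE.
by apply: (le_bigmax _ (fun ij : 'I_m * 'I_n => `|A ij.1 ij.2|) (i, j)).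
Qed.

Lemma frob_le_norm m n (A : 'M[R]_(m, n)) : frob A <= (m * n).+1%:R * `|A|.
Proof.
have sumc k (f : 'I_k -> R) c : (forall i, f i <= c) -> \sum_i f i <= k%:R * c.
  move=> fc; rewrite mulr_natl -[k in leRHS]card_ord -sumr_const.
  exact: ler_sum.
rewrite frob_le ?mulr_ge0// exprMn (@le_trans _ _ ((m * n)%:R * `|A| ^+ 2))//.
  rewrite natrM -mulrA; apply: (sumc) => i; apply: (sumc) => j.
  rewrite -expr2 -[A i j ^+ 2]real_normK ?num_real//.
  by rewrite ler_sqr ?nnegrE// entry_le_norm.
by rewrite ler_wpM2r ?sqr_ge0// -natrX ler_nat expnS expn1 -[leqLHS]mul1n leq_mul.
Qed.

End NormEquivalence.

Lemma natSinv_small (R : realType) (e : R) : 0 < e ->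
  exists N, forall k, (N <= k)%N -> k.+1%:R^-1 <= e.
Proof.
move=> e0; have [N _ hN] := near_infty_natSinv_lt (PosNum e0).
by exists N => k Nk; apply/ltW/hN.
Qed.

Section NearestPoint.
Context {R : realType} {m n : nat}.
Implicit Types (S : set 'M[R]_(m, n)) (X Y Z W : 'M[R]_(m, n)).
Local Open Scope classical_set_scope.

Definition convex_mx S := forall Z W t,
  S Z -> S W -> 0 <= t <= 1 -> S ((1 - t) *: Z + t *: W).

(** Sequential closedness without sequences; norm bounds and semidefinite bounds pass to
such limits by letting [e] tend to zero. *)
Definition closed_mx S := forall Z,
  (forall e, 0 < e -> exists2 W, S W & frob (Z - W) <= e) -> S Z.

Lemma frob_cauchy_cvg (W : nat -> 'M[R]_(m, n)) :
  (forall e, 0 < e -> exists N, forall i j, (N <= i)%N -> (N <= j)%N ->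
     frob (W i - W j) <= e) ->
  exists Z, forall e, 0 < e -> exists N, forall i, (N <= i)%N -> frob (Z - W i) <= e.
Proof.
move=> Wc.
have cW : cvg (W @ \oo).
  apply/cauchy_cvgP/cauchyP => e e0.
  have [N hN] := Wc (e / 2) ltac:(by rewrite divr_gt0).
  exists (W N), N => // i /= Ni; rewrite -ball_normE /=.
  apply: le_lt_trans (norm_le_frob _) _; apply: le_lt_trans (hN _ _ _ Ni) _ => //.
  by rewrite ltr_pdivrMr// mulr_natr mulr2n ltrDl.
exists (lim (W @ \oo)) => e e0.
have K0 : 0 < (m * n).+1%:R :> R by rewrite ltr0n.
have eK : 0 < e / (m * n).+1%:R by rewrite divr_gt0.
have /cvgrPdist_le/(_ _ eK)[N _ hN] : W @ \oo --> lim (W @ \oo) by exact: cW.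
exists N => i Ni; apply: le_trans (frob_le_norm _) _.
by rewrite mulrC -ler_pdivlMr//; exact: hN.
Qed.

(** A minimizing sequence is Cauchy by the parallelogram law, because the midpoint
of two points of a convex set is again in the set. *)
Lemma nearest_exists S X : convex_mx S -> closed_mx S -> S !=set0 ->
  exists Z, S Z /\ forall W, S W -> frob (X - Z) <= frob (X - W).
Proof.
move=> Scvx Scl [W0 SW0].
pose q W := frob (X - W) ^+ 2.
have inf_q : has_inf [set q W | W in S].
  split; first by exists (q W0); exists W0.
  by exists 0 => _ [W _ <-]; exact: sqr_ge0.
pose dd := inf [set q W | W in S].
have dd_le W : S W -> dd <= q W.
  by move=> SW; apply: ge_inf; [case: inf_q | exists W].
have /choice[W hW] : forall i : nat, exists W, S W /\ q W < dd + i.+1%:R^-1.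
  move=> i; have i0 : 0 < i.+1%:R^-1 :> R by rewrite invr_gt0 ltr0n.
  have [_ [W SW <-] lt] := inf_adherent i0 inf_q.
  by exists W.
have par i j : frob (W i - W j) ^+ 2 <= 2 * i.+1%:R^-1 + 2 * j.+1%:R^-1.
  have [Si qi] := hW i; have [Sj qj] := hW j.
  have h2 : 0 <= (2^-1 : R) <= 1 by rewrite invr_ge0 ler0n invf_le1// ler1n.
  have := dd_le _ (Scvx _ _ _ Si Sj h2).
  have -> : 1 - 2^-1 = 2^-1 :> R by field.
  move: qi qj; rewrite /q !sqr_frob.
  have E : X - (2^-1 *: W i + 2^-1 *: W j) = 2^-1 *: ((X - W i) + (X - W j)).
    by apply/matrixP => k l; rewrite !mxE; field.
  have E' : W i - W j = (X - W j) - (X - W i) by apply/matrixP => k l; rewrite !mxE; ring.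
  rewrite E E' fdotZl fdotZr.
  move: (X - W i) (X - W j) => a b.
  rewrite !(fdotDl, fdotDr, fdotNl, fdotNr) (fdotC b a).
  clear dd_le; move: (i.+1%:R^-1) (j.+1%:R^-1) (fdot a a) (fdot a b) (fdot b b) dd hW => *; lra.
have [Z hZ] : exists Z, forall e, 0 < e -> exists N, forall i, (N <= i)%N -> frob (Z - W i) <= e.
  apply: frob_cauchy_cvg => e e0.
  have [N hN] := natSinv_small (ltac:(by rewrite divr_gt0// exprn_gt0) : 0 < e ^+ 2 / 4).
  exists N => i j Ni Nj; rewrite -ler_sqr ?nnegrE ?frob_ge0 ?(ltW e0)//.
  apply: le_trans (par i j) _.
  by move: (hN _ Ni) (hN _ Nj); move: (i.+1%:R^-1) (j.+1%:R^-1) => a b; lra.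
have SZ : S Z.
  apply: Scl => e e0; have [N hN] := hZ _ e0.
  by exists (W N); [case: (hW N) | exact: hN].
exists Z; split=> // V SV.
apply/ler_addgt0Pr => e e0.
have e20 : 0 < e / 2 by rewrite divr_gt0.
have [N hN] := hZ _ e20.
have [N' hN'] := natSinv_small (ltac:(by rewrite exprn_gt0) : 0 < (e / 2) ^+ 2).
have := hN _ (leq_maxl N N'); have := hN' _ (leq_maxr N N').
move: (maxn N N') => i iN' iN.
have XW : frob (X - W i) <= frob (X - V) + e / 2.
  rewrite -ler_sqr ?nnegrE ?addr_ge0 ?frob_ge0 ?(ltW e20)// sqrrD.
  have [_ qi] := hW i; have qV := dd_le _ SV; rewrite /q in qi qV.
  have : 0 <= frob (X - V) * (e / 2) *+ 2 by rewrite mulrn_wge0// mulr_ge0 ?frob_ge0// ltW.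
  move: qi qV iN'; clearbody dd; move: (i.+1%:R^-1) ((e / 2) ^+ 2) (frob (X - W i) ^+ 2) (frob (X - V) ^+ 2) (frob (X - V) * _ *+ 2) => a b c f h; lra.
by have := frob_triangle X (W i) Z; rewrite (frobBC (W i) Z); lra.
Qed.

Variables (S : set 'M[R]_(m, n)).
Hypotheses (Scvx : convex_mx S) (Scl : closed_mx S) (Sne : S !=set0).

Lemma projP X : S (Defs.proj S X) /\ forall W, S W -> frob (X - Defs.proj S X) <= frob (X - W).
Proof.
rewrite /Defs.proj; case: xgetP => [W _ //|none].
by have [Z hZ] := nearest_exists X Scvx Scl Sne; case: (none Z).
Qed.

(** The obtuse angle criterion: moving from the nearest point towards another
point of the convex set does not decrease the distance to first order. *)
Lemma proj_angle X W : S W -> fdot (X - Defs.proj S X) (W - Defs.proj S X) <= 0.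
Proof.
move=> SW; have [SP Pmin] := projP X.
set Z := Defs.proj S X in SP Pmin *; rewrite leNgt; apply/negP => p0.
have WZ0 : 0 < fdot (W - Z) (W - Z).
  rewrite lt_neqAle fdotAA_ge0 andbT eq_sym -sqr_frob sqrf_eq0; apply/eqP => /frob_eq0 E.
  by rewrite E fdot0r ltxx in p0.
set a := fdot (X - Z) (W - Z) in p0; set b := fdot (W - Z) (W - Z) in WZ0.
pose t := Num.min 1 (a / b).
have t0 : 0 < t by rewrite lt_min ltr01 divr_gt0.
have t1 : t <= 1 by rewrite ge_min lexx.
have tb : t * b <= a by rewrite -ler_pdivlMr// ge_min lexx orbT.
have tt : 0 <= t <= 1 by rewrite t1 ltW.
have := Pmin _ (Scvx SP SW tt).
rewrite -ler_sqr ?nnegrE ?frob_ge0// !sqr_frob.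
have -> : X - ((1 - t) *: Z + t *: W) = (X - Z) - t *: (W - Z).
  by rewrite scalerBl scale1r scalerBr; apply/matrixP => i j; rewrite !mxE; ring.
have -> : fdot (X - Z - t *: (W - Z)) (X - Z - t *: (W - Z)) =
    fdot (X - Z) (X - Z) - 2 * (t * a) + t * (t * b).
  rewrite /a /b; move: (X - Z) (W - Z) => p q.
  by rewrite !(fdotBl, fdotBr, fdotZl, fdotZr) (fdotC q p); ring.
move=> h.
have : 0 < t * a by rewrite mulr_gt0.
have : t * (t * b) <= t * a by rewrite ler_pM2l.
lra.
Qed.

(** An obtuse angle at the projection makes it closer than [X] to every point of the
set, so projecting an estimate does not increase its error. *)
Lemma frob_proj_le X W : S W -> frob (Defs.proj S X - W) <= frob (X - W).
Proof.
move=> SW; rewrite -ler_sqr ?nnegrE ?frob_ge0// !sqr_frob.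
have := proj_angle X SW; have := fdotAA_ge0 (X - Defs.proj S X).
have -> : X - W = (X - Defs.proj S X) - (W - Defs.proj S X) by apply/matrixP => i j; rewrite !mxE; ring.
have -> : Defs.proj S X - W = - (W - Defs.proj S X) by rewrite opprB.
move: (X - _) (W - _) => a b.
rewrite !(fdotBl, fdotBr, fdotNl, fdotNr) (fdotC b a); lra.
Qed.

(** Add the obtuse angle criteria at both projections. This continuity makes the
projected iterates measurable. *)
Lemma frob_proj_proj X Y : frob (Defs.proj S X - Defs.proj S Y) <= frob (X - Y).
Proof.
have [SX _] := projP X; have [SY _] := projP Y.
have := proj_angle X SY; have := proj_angle Y SX.
have E : X - Y = (X - Defs.proj S X) + (Defs.proj S X - Defs.proj S Y) - (Y - Defs.proj S Y).
  by apply/matrixP => i j; rewrite !mxE; ring.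
have -> : Defs.proj S Y - Defs.proj S X = - (Defs.proj S X - Defs.proj S Y) by rewrite opprB.
have [->|] := eqVneq (frob (Defs.proj S X - Defs.proj S Y)) 0; first by rewrite frob_ge0.
move=> ne0 h1 h2; have p0 : 0 < frob (Defs.proj S X - Defs.proj S Y) by rewrite lt0r ne0 frob_ge0.
rewrite -(ler_pM2l p0); apply: le_trans (CauchySchwarz _ _).
rewrite E -expr2 sqr_frob; move: h1 h2 => /=.
move: (X - _) (Y - _) (Defs.proj S X - _) => a b c.
rewrite !(fdotDr, fdotBr, fdotNr) (fdotC a) (fdotC b); lra.
Qed.

End NearestPoint.

Section ProjectionSets.
Context {R : realType}.
Local Open Scope classical_set_scope.

Lemma le_eps_trans (a b : R) : (forall e, 0 < e -> a <= b + e) -> a <= b.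
Proof. by move=> h; apply/ler_addgt0Pr. Qed.

Lemma convex_comb_le (a b r t : R) : 0 <= t <= 1 -> a <= r -> b <= r ->
  (1 - t) * a + t * b <= r.
Proof.
move=> /andP[t0 t1] ar br; have : (1 - t) * a <= (1 - t) * r by rewrite ler_wpM2l// subr_ge0.
have : t * b <= t * r by rewrite ler_wpM2l.
lra.
Qed.

Lemma frob_convex_comb m n (Z W : 'M[R]_(m, n)) (t : R) : 0 <= t <= 1 ->
  frob ((1 - t) *: Z + t *: W) <= (1 - t) * frob Z + t * frob W.
Proof.
move=> /andP[t0 t1]; apply: (le_trans (frobD _ _)).
by rewrite !frobZ !ger0_norm ?subr_ge0.
Qed.

Lemma convex_frob_ball n (r : R) : convex_mx [set u : 'cV[R]_n | frob u <= r].
Proof.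
move=> Z W t /= Zr Wr t01; apply: (le_trans (frob_convex_comb _ _ t01)).
exact: convex_comb_le.
Qed.

Lemma closed_frob_ball n (r : R) : closed_mx [set u : 'cV[R]_n | frob u <= r].
Proof.
move=> Z h /=; apply: le_eps_trans => e /h[W /= Wr ZW].
by have := frobD (Z - W) W; rewrite subrK; lra.
Qed.

Lemma convex_spec m n (r : R) : 0 <= r -> convex_mx [set X : 'M[R]_(m, n) | specnorm X <= r].
Proof.
move=> r0 Z W t /= Zr Wr t01; apply: specnorm_le => // v.
rewrite mulmxDl -!scalemxAl; apply: (le_trans (frob_convex_comb _ _ t01)).
by apply: convex_comb_le => //; apply: (le_trans (frob_mulmx_specnorm _ _));
  rewrite ler_wpM2r ?frob_ge0.
Qed.

Lemma closed_spec m n (r : R) : 0 <= r -> closed_mx [set X : 'M[R]_(m, n) | specnorm X <= r].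
Proof.
move=> r0 Z h /=; apply: le_eps_trans => e e0; have [W /= Wr ZW] := h _ e0.
apply: specnorm_le => [|v]; first by rewrite addr_ge0// ltW.
rewrite -[Z](subrK W) mulmxDl addrC mulrDl (le_trans (frobD _ _))// lerD//.
  by rewrite (le_trans (frob_mulmx_specnorm _ _))// ler_wpM2r ?frob_ge0.
by rewrite (le_trans (frob_mulmx _ _))// ler_wpM2r ?frob_ge0.
Qed.

Lemma convex_loewner_ge n (a : R) : convex_mx [set X : 'M[R]_n | loewner_le a%:M X].
Proof.
move=> Z W t /= Zr Wr t01; apply: loewner_geP => [|v].
  by rewrite linearD/= !linearZ/= (loewner_ge_sym Zr) (loewner_ge_sym Wr).
rewrite mulmxDl -!scalemxAl fdotDr !fdotZr -lerN2 opprD.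
rewrite -(mulrN (1 - t)) -(mulrN t); apply: convex_comb_le => //; rewrite lerN2.
  exact: loewner_ge_quad.
exact: loewner_ge_quad.
Qed.

Lemma frob_trmx m n (A : 'M[R]_(m, n)) : frob A^T = frob A.
Proof.
rewrite /frob exchange_big; congr Num.sqrt.
by apply: eq_bigr => i _; apply: eq_bigr => j _; rewrite mxE.
Qed.

Lemma closed_loewner_ge n (a : R) : closed_mx [set X : 'M[R]_n | loewner_le a%:M X].
Proof.
move=> Z h /=; apply: loewner_geP => [|v].
  apply/eqP; rewrite -subr_eq0; apply/eqP/frob_eq0/eqP.
  rewrite eq_le frob_ge0 andbT; apply: le_eps_trans => e e0.
  have [W /= /loewner_ge_sym Wr ZW] := h _ (ltac:(by rewrite divr_gt0) : 0 < e / 2).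
  have := frob_triangle Z^T W Z; rewrite -{1}Wr -linearB/= frob_trmx (frobBC W Z); lra.
apply: le_eps_trans => e e0.
have vp : 0 < fdot v v + 1 by rewrite ltr_wpDl// fdotAA_ge0.
have [W /= Wr ZW] := h _ (ltac:(by rewrite divr_gt0) : 0 < e / (fdot v v + 1)).
apply: (le_trans (loewner_ge_quad v Wr)); rewrite -lerBlDl -fdotBr -mulmxBl.
apply: (le_trans (CauchySchwarz _ _)).
apply: (@le_trans _ _ (frob v * (e / (fdot v v + 1) * frob v))).
  rewrite ler_wpM2l ?frob_ge0// (le_trans (frob_mulmx _ _))// frobBC.
  by rewrite ler_wpM2r ?frob_ge0.
rewrite mulrCA -expr2 sqr_frob mulrAC ler_pdivrMr// ler_pM2l//.
by rewrite lerDl.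
Qed.

End ProjectionSets.

(** * First-order expansions and gradients *)

Section Gradients.
Context {R : realType}.
Local Open Scope classical_set_scope.

Lemma is_derive_eps (V : normedModType R) (h : V -> R) (a v : V) (c : R) :
  (forall e, 0 < e -> exists r, 0 < r /\
     forall s, `|s| < r -> `|h (a + s *: v) - h a - s * c| <= e * `|s|) ->
  is_derive a v h c.
Proof.
move=> H.
have C : (fun s : R => s^-1 *: ((h \o shift a) (s *: v) - h a)) @ 0^' --> c.
  apply/cvgrPdist_le => e e0; have [r [r0 hr]] := H _ e0.
  near=> s.
  have s0 : s != 0 by near: s; exact: nbhs_dnbhs_neq.
  have sr : `|s| < r by near: s; exact: dnbhs0_lt.
  have -> : c - s^-1 *: ((h \o shift a) (s *: v) - h a) =
      - (s^-1 * (h (a + s *: v) - h a - s * c)).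
    by rewrite /= [s *: v + a]addrC -[s^-1 *: _]/(s^-1 * _); field.
  by rewrite normrN normrM normfV ler_pdivrMl ?normr_gt0// (mulrC `|s|) hr.
by split; [apply/cvg_ex; exists c | exact: cvg_lim].
Unshelve. all: by end_near. Qed.

(** Frechet differentiability with gradient [G], in epsilon-delta form: it combines
directly with the Lipschitz bound on [ystar], whose differentiability is not known
beforehand. *)
Definition has_grad n (h : 'cV[R]_n -> R) (x G : 'cV[R]_n) :=
  forall e, 0 < e -> exists r, 0 < r /\
    forall k, frob k < r -> `|h (x + k) - h x - fdot G k| <= e * frob k.

Lemma has_grad_is_derive n (h : 'cV[R]_n -> R) x G v :
  has_grad h x G -> is_derive x v h (fdot G v).
Proof.
move=> hg; apply: is_derive_eps => e e0.
have v1 : 0 < frob v + 1 by rewrite ltr_wpDl// frob_ge0.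
have [r [r0 hr]] := hg _ (ltac:(by rewrite divr_gt0) : 0 < e / (frob v + 1)).
exists (r / (frob v + 1)); split; first by rewrite divr_gt0.
move=> s; rewrite ltr_pdivlMr// => sr.
have skr : frob (s *: v) <= `|s| * (frob v + 1).
  by rewrite frobZ ler_wpM2l// lerDl.
rewrite -fdotZr (le_trans (hr _ (le_lt_trans skr sr)))//.
rewrite mulrAC ler_pdivrMr// -mulrA ler_wpM2l ?(ltW e0)//.
Qed.

Lemma fdot_delta n (G : 'cV[R]_n) i : fdot G (delta_mx i 0) = G i 0.
Proof.
rewrite fdot_cV (bigD1 i)//= big1 ?addr0 => [|j ji]; first by rewrite mxE !eqxx mulr1.
by rewrite mxE (negbTE ji) mulr0.
Qed.

Lemma has_grad_grad n (h : 'cV[R]_n -> R) x G : has_grad h x G -> grad h x = G.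
Proof.
move=> hg; apply/matrixP => i j; rewrite ord1 !mxE.
by have [_ ->] := has_grad_is_derive (delta_mx i 0) hg; rewrite fdot_delta.
Qed.

Lemma has_grad_line n (h : 'cV[R]_n -> R) x q t G :
  has_grad h (x + t *: q) G -> is_derive t 1 (fun s => h (x + s *: q)) (fdot G q).
Proof.
move=> hg.
apply: is_derive_eps => e e0.
have [r [r0 hr]] := hg _ (ltac:(by rewrite divr_gt0// ltr_wpDl// frob_ge0) : 0 < e / (frob q + 1)).
have q1 : 0 < frob q + 1 by rewrite ltr_wpDl// frob_ge0.
exists (r / (frob q + 1)); split; first by rewrite divr_gt0.
move=> s; rewrite ltr_pdivlMr// => sr.
have skr : frob (s *: q) <= `|s| * (frob q + 1).
  by rewrite frobZ ler_wpM2l// lerDl.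
have -> : x + (t + s *: 1) *: q = x + t *: q + s *: q.
  by rewrite [s *: 1]mulr1 scalerDl addrA.
rewrite -fdotZr (le_trans (hr _ (le_lt_trans skr sr)))//.
rewrite mulrAC ler_pdivrMr// -mulrA ler_wpM2l ?(ltW e0)//.
Qed.

Section TwoBlocks.
Context {d d' : nat}.
Implicit Types (x k : 'cV[R]_d) (y l : 'cV[R]_d').

Lemma differentiable_expansion (W : normedModType R)
    (h : 'cV[R]_d -> 'cV[R]_d' -> W) x y :
  differentiable (fun q : 'cV[R]_d * 'cV[R]_d' => h q.1 q.2) (x, y) ->
  forall e, 0 < e -> exists r, 0 < r /\ forall k l, frob k < r -> frob l < r ->
    `|h (x + k) (y + l) - h x y
      - 'd (fun q : 'cV[R]_d * 'cV[R]_d' => h q.1 q.2) (x, y) (k, l)|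
    <= e * (frob k + frob l).
Proof.
move=> dh e e0.
have /eqaddoP/(_ _ e0) := diff_locally dh.
move=> /nbhs_normP[r /= r0 hr]; exists r; split => // k l kr lr.
have kl : `|(k, l)| < r.
  by rewrite prod_normE/= gt_max !(le_lt_trans (norm_le_frob _)).
have /hr : ball_ Num.norm 0 r (k, l) by rewrite /= sub0r normrN.
move=> h1; apply: le_trans (le_trans h1 _).
  rewrite -[X in _ <= `|X|]/(h (k + x) (l + y) - (h x y + 'd _ (x, y) (k, l))).
  by rewrite opprD addrA (addrC k) (addrC l).
rewrite ler_wpM2l ?(ltW e0)// prod_normE/= ge_max.
by rewrite ler_wpDr ?ler_wpDl ?norm_le_frob ?frob_ge0.
Qed.

Lemma sum_delta n (k : 'cV[R]_n) : k = \sum_i k i 0 *: delta_mx i 0.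
Proof.
rewrite [LHS]matrix_sum_delta; apply: eq_bigr => i _.
by rewrite big_ord1.
Qed.

(** The differential is linear, so it is determined by its values on the coordinate
directions, which are the partial derivatives. *)
Lemma diff_gradxy (h : 'cV[R]_d -> 'cV[R]_d' -> R) x y k l :
  differentiable (fun q : 'cV[R]_d * 'cV[R]_d' => h q.1 q.2) (x, y) ->
  'd (fun q : 'cV[R]_d * 'cV[R]_d' => h q.1 q.2) (x, y) (k, l) =
  fdot (gradx h x y) k + fdot (grady h x y) l.
Proof.
move=> dh; set D := 'd _ _.
have Dx i : D (delta_mx i 0, 0) = gradx h x y i 0.
  rewrite -[LHS]deriveE// /gradx /grad mxE /derive.
  rewrite (_ : (fun s : R => s^-1 *: (_ - h (x, y).1 (x, y).2)) =
    (fun s : R => s^-1 *: ((h^~ y \o shift x) (s *: delta_mx i 0) - h x y)))//.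
  by apply/funext => s /=; rewrite scaler0 add0r.
have Dy i : D (0, delta_mx i 0) = grady h x y i 0.
  rewrite -[LHS]deriveE// /grady /grad mxE /derive.
  rewrite (_ : (fun s : R => s^-1 *: (_ - h (x, y).1 (x, y).2)) =
    (fun s : R => s^-1 *: ((h x \o shift y) (s *: delta_mx i 0) - h x y)))//.
  by apply/funext => s /=; rewrite scaler0 add0r.
have kE : (k, 0 : 'cV[R]_d') = \sum_i k i 0 *: (delta_mx i 0, 0).
  rewrite {1}(sum_delta k); elim/big_rec2: _ => // i a b _ <-.
  by rewrite -[RHS]/(k i 0 *: delta_mx i 0 + b, k i 0 *: 0 + 0) scaler0 addr0.
have lE : (0 : 'cV[R]_d, l) = \sum_i l i 0 *: (0, delta_mx i 0).
  rewrite {1}(sum_delta l); elim/big_rec2: _ => // i a b _ <-.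
  by rewrite -[RHS]/(l i 0 *: 0 + 0, l i 0 *: delta_mx i 0 + b) scaler0 addr0.
have -> : (k, l) = \sum_i k i 0 *: (delta_mx i 0, 0) + \sum_i l i 0 *: (0, delta_mx i 0).
  by rewrite -kE -lE -[RHS]/(k + 0, 0 + l) addr0 add0r.
rewrite linearD !linear_sum/= !fdot_cV; congr (_ + _); apply: eq_bigr => i _.
  by rewrite linearZ/= Dx mulrC.
by rewrite linearZ/= Dy mulrC.
Qed.

Lemma differentiable_coord_comp (h : 'cV[R]_d -> 'cV[R]_d' -> 'cV[R]_d') x y j :
  differentiable (fun q : 'cV[R]_d * 'cV[R]_d' => h q.1 q.2) (x, y) ->
  differentiable (fun q : 'cV[R]_d * 'cV[R]_d' => h q.1 q.2 j 0 : R) (x, y) /\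
  forall k l, 'd (fun q : 'cV[R]_d * 'cV[R]_d' => h q.1 q.2) (x, y) (k, l) j 0 =
    'd (fun q : 'cV[R]_d * 'cV[R]_d' => h q.1 q.2 j 0 : R) (x, y) (k, l).
Proof.
move=> dh.
have dc := differentiable_coord (h x y) j 0.
split; first exact: (@differentiable_comp _ _ _ _ _ (fun N : 'cV[R]_d' => N j 0 : R) (x, y) dh dc).
move=> k l.
rewrite (_ : (fun q => h q.1 q.2 j 0 : R) =
  (fun N : 'cV[R]_d' => N j 0 : R) \o (fun q : 'cV[R]_d * 'cV[R]_d' => h q.1 q.2))//.
rewrite diff_comp//=.
have @c : {linear 'cV[R]_d' -> R}.
  by exists (fun N : 'cV[R]_d' => N j 0); do 2![eexists]; do ?[constructor];
     rewrite ?mxE// => ? *; rewrite ?mxE//; move=> ?; rewrite !mxE.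
by rewrite (_ : (fun N : 'cV[R]_d' => N j 0 : R) = c)// diff_lin//; exact: coord_continuous.
Qed.

End TwoBlocks.

End Gradients.

Section Expansions.
Context {R : realType} {d d' : nat}.
Implicit Types (x k : 'cV[R]_d) (y l : 'cV[R]_d').

Lemma differentiable_xy_expansion (h : 'cV[R]_d -> 'cV[R]_d' -> R) x y :
  differentiable_xy h -> forall e, 0 < e -> exists r, 0 < r /\
    forall k l, frob k < r -> frob l < r ->
    `|h (x + k) (y + l) - h x y - (fdot (gradx h x y) k + fdot (grady h x y) l)|
      <= e * (frob k + frob l).
Proof.
move=> dh e e0; have [r [r0 hr]] := differentiable_expansion (dh (x, y)) e0.
by exists r; split=> // k l kr lr; rewrite -diff_gradxy; [exact: hr | exact: dh].
Qed.

(** [hessxy] and [hessyy] have the index of differentiation as row, hence the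
transposes. *)
Lemma differentiable_grady_expansion (h : 'cV[R]_d -> 'cV[R]_d' -> R) x y :
  (forall p : 'cV[R]_d * 'cV[R]_d',
    differentiable (fun q : 'cV[R]_d * 'cV[R]_d' => grady h q.1 q.2) p) ->
  forall e, 0 < e -> exists r, 0 < r /\
    forall k l, frob k < r -> frob l < r ->
    frob (grady h (x + k) (y + l) - grady h x y
          - ((hessxy h x y)^T *m k + (hessyy h x y)^T *m l))
      <= e * (frob k + frob l).
Proof.
move=> dh e e0.
have K0 : 0 < (d' * 1).+1%:R :> R by rewrite ltr0n.
have [r [r0 hr]] := differentiable_expansion (dh (x, y)) (divr_gt0 e0 K0).
exists r; split=> // k l kr lr; apply: (le_trans (frob_le_norm _)).
rewrite mulrC -ler_pdivlMr// mulrAC.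
suff -> : (hessxy h x y)^T *m k + (hessyy h x y)^T *m l =
    'd (fun q : 'cV[R]_d * 'cV[R]_d' => grady h q.1 q.2) (x, y) (k, l) by exact: hr.
apply/matrixP => j j0; rewrite ord1.
have [dj ->] := differentiable_coord_comp j (dh (x, y)).
rewrite (diff_gradxy (h := fun x y => grady h x y j 0))// !fdot_cV !mxE.
by congr (_ + _); apply: eq_bigr => i _; rewrite !mxE.
Qed.

Lemma differentiable_xy_has_grad (h : 'cV[R]_d -> 'cV[R]_d' -> R) x y :
  differentiable_xy h -> has_grad (h x) y (grady h x y).
Proof.
move=> dh e e0; have [r [r0 hr]] := differentiable_xy_expansion x y dh e0.
exists r; split=> // l lr; have := hr 0 l.
by rewrite frob0 fdot0r !add0r addr0; exact.
Qed.

Lemma differentiable_grady_has_grad (h : 'cV[R]_d -> 'cV[R]_d' -> R) x y (p : 'cV[R]_d') :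
  (forall p : 'cV[R]_d * 'cV[R]_d',
    differentiable (fun q : 'cV[R]_d * 'cV[R]_d' => grady h q.1 q.2) p) ->
  has_grad (fun y => fdot (grady h x y) p) y (hessyy h x y *m p).
Proof.
move=> dh e e0; have p1 : 0 < frob p + 1 by rewrite ltr_wpDl// frob_ge0.
have [r [r0 hr]] := differentiable_grady_expansion x y dh (divr_gt0 e0 p1).
exists r; split=> // l lr; have := hr 0 l.
rewrite frob0 addr0 mulmx0 !add0r => /(_ r0 lr) hl.
rewrite fdot_mulmx (fdotC p) -!fdotBl (le_trans (normr_fdot_le _ _))//.
apply: (le_trans (ler_wpM2r (frob_ge0 _) hl)).
have -> : e / (frob p + 1) * frob l * frob p = e * frob l * frob p / (frob p + 1) by ring.
rewrite ler_pdivrMr// ler_wpM2l ?mulr_ge0 ?frob_ge0 ?(ltW e0)//.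
by rewrite lerDl.
Qed.

End Expansions.

Section Taylor.
Context {R : realType}.
Local Open Scope classical_set_scope.

Lemma derive_ge0_le (h dh : R -> R) :
  (forall t : R, is_derive t 1 h (dh t)) -> (forall t, 0 <= t <= 1 -> 0 <= dh t) ->
  forall t, 0 <= t <= 1 -> h 0 <= h t.
Proof.
move=> hd dh0 t /andP[t0 t1].
have hc : {within `[0, t], continuous h}.
  apply: continuous_subspaceT => s; apply/differentiable_continuous/derivable1_diffP.
  by have [] := hd s.
have [s st E] := MVT_segment t0 (fun s _ => hd s) hc.
move: st; rewrite in_itv/= => /andP[s0 st].
rewrite -subr_ge0 E subr0 mulr_ge0// dh0// s0 (le_trans st)//.
Qed.

(** Compare [h] with its second-order Taylor polynomial by integrating the bound on
the derivative. *)
Lemma taylor_ub (h dh : R -> R) M : (forall t : R, is_derive t 1 h (dh t)) ->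
  (forall t, 0 <= t <= 1 -> dh t <= dh 0 + M * t) -> h 1 <= h 0 + dh 0 + M / 2.
Proof.
move=> hd dhM.
pose k t := h 0 + t * dh 0 + M / 2 * t ^+ 2 - h t.
pose dk t := dh 0 + M * t - dh t.
have kd (t : R) : is_derive t 1 k (dk t).
  have dht := hd t.
  rewrite /k /dk; apply: is_derive_eq.
  by rewrite /GRing.scale /=; field.
have : k 0 <= k 1.
  apply: derive_ge0_le kd _ _ _; last by rewrite lexx ler01.
  by move=> t t01; rewrite /dk subr_ge0 dhM.
by rewrite /k; lra.
Qed.

Lemma taylor_lb (h dh : R -> R) M : (forall t : R, is_derive t 1 h (dh t)) ->
  (forall t, 0 <= t <= 1 -> dh 0 + M * t <= dh t) -> h 0 + dh 0 + M / 2 <= h 1.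
Proof.
move=> hd dhM.
have nd (t : R) : is_derive t 1 (fun t => - h t) (- dh t) by have := hd t; exact: is_deriveN.
have := @taylor_ub (fun t => - h t) (fun t => - dh t) (- M) nd.
have H t : 0 <= t <= 1 -> - dh t <= - dh 0 + - M * t by move/dhM; lra.
move=> /(_ H); lra.
Qed.

End Taylor.

(** * Smoothness, strong convexity and the hypergradient *)

Section FirstOrder.
Context {R : realType} {n : nat}.
Implicit Types (h : 'cV[R]_n -> R) (x y z q G : 'cV[R]_n).

(** Moving from a minimizer against its gradient would decrease the function. *)
Lemma argmin_grad_eq0 h z G : has_grad h z G -> is_argmin h z -> G = 0.
Proof.
move=> hg hz; apply/frob_eq0/eqP; rewrite eq_le frob_ge0 andbT.
apply: le_eps_trans => e e0; rewrite add0r.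
have [->|Gn0] := eqVneq (frob G) 0; first exact: ltW.
have G0 : 0 < frob G by rewrite lt0r Gn0 frob_ge0.
have [r [r0 hr]] := hg _ e0.
pose s := r / 2 / frob G; have s0 : 0 < s by rewrite !divr_gt0.
have sG : frob (- (s *: G)) = r / 2.
  by rewrite frobN frobZ ger0_norm ?(ltW s0)// /s mulfVK.
have /hr : frob (- (s *: G)) < r by rewrite sG ltr_pdivrMr// mulr_natr mulr2n ltrDl.
rewrite ler_norml => /andP[_]; rewrite fdotNr fdotZr -sqr_frob frobN frobZ.
rewrite (ger0_norm (ltW s0)) => h1.
have := hz (z - s *: G) => h2.
have : s * (frob G * frob G) <= s * (e * frob G) by lra.
by rewrite ler_pM2l// ler_pM2r.
Qed.

(** Along the segment the derivative grows at most at rate [L |q|^2]. *)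
Lemma smooth_descent h L : (forall x, has_grad h x (grad h x)) ->
  lipschitz_grad h L ->
  forall x q, h (x + q) <= h x + fdot (grad h x) q + L / 2 * fdot q q.
Proof.
move=> hg hL x q.
pose k t := h (x + t *: q); pose dk t := fdot (grad h (x + t *: q)) q.
have kd (t : R) : is_derive t 1 k (dk t) by apply: has_grad_line; exact: hg.
have := @taylor_ub R k dk (L * fdot q q) kd.
rewrite /k /dk scale1r scale0r addr0 mulrAC; apply => t /andP[t0 t1].
rewrite -lerBlDl -fdotBl (le_trans (CauchySchwarz _ _))//.
have := hL (x + t *: q) x; rewrite (addrC x) addrK frobZ ger0_norm// => hh.
apply: (le_trans (ler_wpM2r (frob_ge0 q) hh)).
by rewrite le_eqVlt -sqr_frob; apply/orP; left; apply/eqP; ring.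
Qed.

(** A gradient step of length [1 / L] decreases [h] by [|grad h|^2 / (2 L)]. *)
Lemma sqr_grad_le h L m : (forall x, has_grad h x (grad h x)) ->
  0 < L -> lipschitz_grad h L -> (forall x, m <= h x) ->
  forall x, frob (grad h x) ^+ 2 <= 2 * L * (h x - m).
Proof.
move=> hg L0 hL hm x.
have := smooth_descent hg hL x (- (L^-1 *: grad h x)).
rewrite !(fdotNr, fdotNl, fdotZl, fdotZr) opprK -sqr_frob.
have := hm (x - L^-1 *: grad h x).
move: (frob _ ^+ 2) (h (_ - _)) => a b h1 h2.
have {h2}h2 : b <= h x - a / (2 * L).
  apply: (le_trans h2); rewrite le_eqVlt; apply/orP; left; apply/eqP; field.
  by rewrite gt_eqF.
have L2 : 0 < 2 * L by rewrite mulr_gt0.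
have : a / (2 * L) <= h x - m by lra.
by rewrite ler_pdivrMr// mulrC.
Qed.

Section StronglyConvex.
Variables (h : 'cV[R]_n -> R) (Hs : 'cV[R]_n -> 'M[R]_n) (lambda L : R).
Hypotheses (hg : forall y, has_grad h y (grad h y))
  (hgg : forall y p, has_grad (fun y => fdot (grad h y) p) y (Hs y *m p))
  (h_lb : forall y, loewner_le lambda%:M (Hs y))
  (h_ub : forall y, loewner_le (Hs y) L%:M).

Lemma strongly_convex_lb y q :
  h y + fdot (grad h y) q + lambda / 2 * fdot q q <= h (y + q).
Proof.
pose k t := h (y + t *: q); pose dk t := fdot (grad h (y + t *: q)) q.
have kd (t : R) : is_derive t 1 k (dk t) by apply: has_grad_line; exact: hg.
have := @taylor_lb R k dk (lambda * fdot q q) kd.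
rewrite /k /dk scale1r scale0r addr0 mulrAC; apply => t t01.
pose ddk s := fdot (Hs (y + s *: q) *m q) q.
have dkd (s : R) : is_derive s 1 dk (ddk s).
  by apply: (has_grad_line (h := fun y => fdot (grad h y) q)).
pose m s := dk s - lambda * fdot q q * s.
have md (s : R) : is_derive s 1 m (ddk s - lambda * fdot q q).
  by have := dkd s => ?; apply: is_derive_eq; rewrite /GRing.scale/=; ring.
have := derive_ge0_le md _ t01; rewrite /m /dk scale0r addr0.
suff H s : 0 <= s <= 1 -> 0 <= ddk s - lambda * fdot q q by move=> /(_ H); lra.
by move=> _; rewrite subr_ge0 /ddk fdotC loewner_ge_quad.
Qed.

Lemma smooth_ub y q :
  h (y + q) <= h y + fdot (grad h y) q + L / 2 * fdot q q.
Proof.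
pose k t := h (y + t *: q); pose dk t := fdot (grad h (y + t *: q)) q.
have kd (t : R) : is_derive t 1 k (dk t) by apply: has_grad_line; exact: hg.
have := @taylor_ub R k dk (L * fdot q q) kd.
rewrite /k /dk scale1r scale0r addr0 mulrAC; apply => t t01.
pose ddk s := fdot (Hs (y + s *: q) *m q) q.
have dkd (s : R) : is_derive s 1 dk (ddk s).
  by apply: (has_grad_line (h := fun y => fdot (grad h y) q)).
pose m s := L * fdot q q * s - dk s.
have md (s : R) : is_derive s 1 m (L * fdot q q - ddk s).
  by have := dkd s => ?; apply: is_derive_eq; rewrite /GRing.scale/=; ring.
have := derive_ge0_le md _ t01; rewrite /m /dk scale0r addr0.
suff H s : 0 <= s <= 1 -> 0 <= L * fdot q q - ddk s by move=> /(_ H); lra.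
by move=> _; rewrite subr_ge0 /ddk fdotC loewner_le_quad.
Qed.

(** Strong convexity bounds [h z] from below at distance [y - z], while a gradient
step from [y] bounds it from above, since [z] is optimal. *)
Lemma strongly_convex_grad_ineq z y : 0 < L -> is_argmin h z ->
  lambda / 2 * fdot (y - z) (y - z) + fdot (grad h y) (grad h y) / (2 * L)
    <= fdot (grad h y) (y - z).
Proof.
move=> L0 hz.
have := strongly_convex_lb y (z - y); rewrite (addrC y) subrK.
have := smooth_ub y (- (L^-1 *: grad h y)).
have := hz (y - L^-1 *: grad h y).
have -> : z - y = - (y - z) by rewrite opprB.
rewrite !(fdotNr, fdotNl, fdotZl, fdotZr) !opprK.
move: (h (_ - _)) (h z) (fdot (y - z) _) (fdot _ (y - z)) (fdot (grad _ _) _) => a b p q r.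
have -> : L / 2 * (L^-1 * (L^-1 * r)) = r / (2 * L) by field; rewrite gt_eqF.
have -> : L^-1 * r = 2 * (r / (2 * L)) by field; rewrite gt_eqF.
lra.
Qed.

End StronglyConvex.

End FirstOrder.

Section ImplicitGradient.
Context {R : realType} {d d' : nat}.
Variables (f g : 'cV[R]_d -> 'cV[R]_d' -> R) (ystar : 'cV[R]_d -> 'cV[R]_d').
Variables (lambda Ly : R).
Hypotheses (lambda_gt0 : 0 < lambda) (Ly_gt0 : 0 < Ly)
  (f_diff : differentiable_xy f) (g_diff : differentiable_xy_with_grady g)
  (ystar_argmin : forall x, is_argmin (g x) (ystar x))
  (ystar_lip : forall x x', frob (ystar x - ystar x') <= Ly * frob (x - x'))
  (g_convex : forall x y, loewner_le lambda%:M (hessyy g x y)).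

Lemma grady_ystar x : grady g x (ystar x) = 0.
Proof. by apply: argmin_grad_eq0 (ystar_argmin x); apply: differentiable_xy_has_grad; case: g_diff. Qed.

(** Differentiating the optimality condition [grady g x (ystar x) = 0] along [k];
the Lipschitz bound on [ystar] controls the remainder. *)
Lemma ystar_expansion x e : 0 < e -> exists r, 0 < r /\ forall k, frob k < r ->
  frob (ystar (x + k) - ystar x
        + invmx (hessyy g x (ystar x)) *m ((hessxy g x (ystar x))^T *m k))
    <= e * frob k.
Proof.
move=> e0; have [_ gd] := g_diff.
have L1 : 0 < 1 + Ly by rewrite addr_gt0.
have [r [r0 hr]] := differentiable_grady_expansion x (ystar x) gd
  (divr_gt0 (mulr_gt0 e0 lambda_gt0) L1).
exists (r / (1 + Ly)); split; first by rewrite divr_gt0.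
move=> k; rewrite ltr_pdivlMr// => kr.
have H := g_convex x (ystar x).
have lk : frob (ystar (x + k) - ystar x) <= Ly * frob k.
  by apply: (le_trans (ystar_lip _ _)); rewrite (addrC x) addrK.
have kr1 : frob k < r.
  apply: le_lt_trans kr; rewrite ler_peMr ?frob_ge0// lerDl ltW//.
have lr : frob (ystar (x + k) - ystar x) < r.
  apply: (le_lt_trans lk); apply: le_lt_trans kr; rewrite mulrC ler_wpM2l ?frob_ge0//.
  by rewrite lerDr.
have := hr _ _ kr1 lr; rewrite [ystar x + _]addrC subrK !grady_ystar subr0 sub0r frobN.
rewrite (loewner_ge_sym H); move: (ystar _ - _) lk {lr} => l lk hl.
have -> : l + invmx (hessyy g x (ystar x)) *m ((hessxy g x (ystar x))^T *m k) =
    invmx (hessyy g x (ystar x)) *m ((hessxy g x (ystar x))^T *m k + hessyy g x (ystar x) *m l).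
  by rewrite mulmxDr [in RHS]mulmxA [in X in _ = _ + X]mulmxA mulVmx ?mul1mx 1?addrC ?(loewner_ge_unitmx lambda_gt0)// mulmxA.
apply: (le_trans (frob_invmx_mul lambda_gt0 _ H)).
rewrite mulrC ler_pdivrMr// (le_trans hl)//.
rewrite (_ : e * lambda / (1 + Ly) * _ = e * lambda * ((frob k + frob l) / (1 + Ly))); last by ring.
rewrite (mulrAC e (frob k)) ler_wpM2l ?mulr_ge0 ?(ltW e0) ?(ltW lambda_gt0)//.
by rewrite ler_pdivrMr// mulrDr mulr1 lerD2l mulrC.
Qed.

Lemma invmx_sym n (A : 'M[R]_n) : A^T = A -> (invmx A)^T = invmx A.
Proof. by move=> AT; rewrite trmx_inv AT. Qed.

(** The chain rule through [ystar]; the symmetric inverse Hessian moves from the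
increment of [ystar] to [grady f]. *)
Lemma hypergradient x : has_grad (fun x => f x (ystar x)) x
  (gradx f x (ystar x) - hessxy g x (ystar x) *m invmx (hessyy g x (ystar x))
                         *m grady f x (ystar x)).
Proof.
move=> e e0; set fx := gradx _ _ _; set fy := grady _ _ _.
set A := hessxy _ _ _; set B := hessyy _ _ _.
have BT : (invmx B)^T = invmx B by apply/invmx_sym/(loewner_ge_sym (g_convex _ _)).
have L1 : 0 < 1 + Ly by rewrite addr_gt0.
have f1 : 0 < frob fy + 1 by rewrite ltr_wpDl// frob_ge0.
have e2 : 0 < e / 2 by rewrite divr_gt0.
have [r [r0 hr]] := differentiable_xy_expansion x (ystar x) f_diff (divr_gt0 e2 L1).
have [r' [r'0 hr']] := ystar_expansion x (divr_gt0 e2 f1).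
exists (Num.min r' (r / (1 + Ly))); split; first by rewrite lt_min r'0 divr_gt0.
move=> k; rewrite lt_min => /andP[kr']; rewrite ltr_pdivlMr// => kr.
have lk : frob (ystar (x + k) - ystar x) <= Ly * frob k.
  by apply: (le_trans (ystar_lip _ _)); rewrite (addrC x) addrK.
have kr1 : frob k < r.
  apply: le_lt_trans kr; rewrite ler_peMr ?frob_ge0// lerDl ltW//.
have lr : frob (ystar (x + k) - ystar x) < r.
  apply: (le_lt_trans lk); apply: le_lt_trans kr; rewrite mulrC ler_wpM2l ?frob_ge0//.
  by rewrite lerDr.
have := hr' _ kr'; have := hr _ _ kr1 lr.
rewrite [ystar x + _]addrC subrK -/fx -/fy -/A -/B.
move: (ystar _ - _) lk {lr} => l lk h1 h2.
have -> : f (x + k) (ystar (x + k)) - f x (ystar x) - fdot (fx - A *m invmx B *m fy) k =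
   (f (x + k) (ystar (x + k)) - f x (ystar x) - (fdot fx k + fdot fy l))
   + fdot fy (l + invmx B *m (A^T *m k)).
  rewrite fdotBl fdotDr; have -> : fdot (A *m invmx B *m fy) k = fdot fy (invmx B *m (A^T *m k)).
    by rewrite fdot_mulmx trmx_mul BT mulmxA.
  ring.
apply: (le_trans (ler_normD _ _)); rewrite (_ : e * _ = e / 2 * frob k + e / 2 * frob k); last by field.
apply: lerD.
  apply: (le_trans h1).
  rewrite (_ : e / 2 / (1 + Ly) * _ = e / 2 * ((frob k + frob l) / (1 + Ly))); last by ring.
  rewrite ler_wpM2l ?(ltW e2)// ler_pdivrMr// mulrDr mulr1.
  by rewrite lerD2l mulrC.
apply: (le_trans (normr_fdot_le _ _)).
apply: (le_trans (ler_wpM2l (frob_ge0 _) h2)).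
have -> : frob fy * (e / 2 / (frob fy + 1) * frob k) = (e / 2 * frob k) * (frob fy / (frob fy + 1)) by ring.
rewrite -[leRHS]mulr1 ler_wpM2l ?mulr_ge0 ?frob_ge0 ?(ltW e0)// ler_pdivrMr// mul1r.
by rewrite lerDl.
Qed.

End ImplicitGradient.

(** * One query of a stochastic oracle *)

Section MatrixMeasurable.
Context {R : realType} {dT : measure_display} {T : measurableType dT}.
Local Open Scope classical_set_scope.

Definition mx_measurable m n (X : T -> 'M[R]_(m, n)) : Prop :=
  forall i j, measurable_fun setT (fun t => X t i j).

Lemma mx_measurable_cst m n (A : 'M[R]_(m, n)) : mx_measurable (fun=> A).
Proof. by move=> i j; exact: measurable_cst. Qed.

Lemma mx_measurableD m n (X Y : T -> 'M[R]_(m, n)) :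
  mx_measurable X -> mx_measurable Y -> mx_measurable (fun t => X t + Y t).
Proof.
move=> mX mY i j; under eq_fun do rewrite mxE.
exact: measurable_funD (mX i j) (mY i j).
Qed.

Lemma mx_measurableZ m n a (X : T -> 'M[R]_(m, n)) :
  mx_measurable X -> mx_measurable (fun t => a *: X t).
Proof.
move=> mX i j; under eq_fun do rewrite mxE.
exact: measurable_funM (measurable_cst _) (mX i j).
Qed.

Lemma mx_measurableB m n (X Y : T -> 'M[R]_(m, n)) :
  mx_measurable X -> mx_measurable Y -> mx_measurable (fun t => X t - Y t).
Proof.
move=> mX mY i j; under eq_fun do rewrite !mxE.
exact: measurable_funB (mX i j) (mY i j).
Qed.

Lemma mx_measurableM m n p (X : T -> 'M[R]_(m, n)) (Y : T -> 'M[R]_(n, p)) :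
  mx_measurable X -> mx_measurable Y -> mx_measurable (fun t => X t *m Y t).
Proof.
move=> mX mY i j; under eq_fun do rewrite mxE.
by apply: measurable_sum => k; exact: measurable_funM (mX i k) (mY k j).
Qed.

Lemma measurable_fdot m n (X Y : T -> 'M[R]_(m, n)) :
  mx_measurable X -> mx_measurable Y -> measurable_fun setT (fun t => fdot (X t) (Y t)).
Proof.
move=> mX mY; apply: measurable_sum => i; apply: measurable_sum => j.
exact: measurable_funM (mX i j) (mY i j).
Qed.

Lemma measurable_sqr_frob m n (X : T -> 'M[R]_(m, n)) :
  mx_measurable X -> measurable_fun setT (fun t => frob (X t) ^+ 2).
Proof.
by move=> mX; under eq_fun do rewrite sqr_frob; exact: measurable_fdot.
Qed.

End MatrixMeasurable.

Section Integrals.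
Context {R : realType} {dS : measure_display} {S : measurableType dS}.
Variable P : probability S R.
Local Open Scope classical_set_scope.

(** Integrability and the value of the integral together, so that both propagate
through sums and scalings at once. *)
Definition has_int (h : S -> R) (c : R) : Prop :=
  P.-integrable setT (EFin \o h) /\ (\int[P]_s (h s)%:E = c%:E)%E.

Lemma has_int_cst c : has_int (fun=> c) c.
Proof.
split; first exact: finite_measure_integrable_cst.
transitivity (c%:E * P setT)%E; first exact: integral_cst.
by rewrite probability_setT mule1.
Qed.

Lemma has_intD h k a b : has_int h a -> has_int k b ->
  has_int (fun s => h s + k s) (a + b).
Proof.
move=> [ih Eh] [ik Ek]; split; first exact: (integrableD _ ih ik).
rewrite EFinD -Eh -Ek -integralD//.
Qed.

Lemma has_intZ h a c : has_int h a -> has_int (fun s => c * h s) (c * a).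
Proof.
move=> [ih Eh]; split; first exact: (integrableZl _ _ ih).
by rewrite EFinM -Eh -integralZl.
Qed.

Lemma has_int_sum n (h : 'I_n -> S -> R) (a : 'I_n -> R) :
  (forall i, has_int (h i) (a i)) -> has_int (fun s => \sum_i h i s) (\sum_i a i).
Proof.
move=> hi; rewrite -fct_sumE.
elim/big_rec2: _ => [|i c k _ hk]; first exact: has_int_cst.
exact: has_intD.
Qed.

Lemma has_int_le h a M : has_int h a -> (forall s, h s <= M) -> a <= M.
Proof.
move=> [ih Eh] hM; rewrite -lee_fin -Eh; have [iM EM] := has_int_cst M.
by rewrite -EM le_integral// => s _; rewrite lee_fin.
Qed.

Lemma has_int_ge0 (h : S -> R) (M : R) : measurable_fun setT h -> (forall s, 0 <= h s) ->
  (\int[P]_s (h s)%:E <= M%:E)%E -> exists2 a, has_int h a & a <= M.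
Proof.
move=> mh h0 hM.
have I0 : (0 <= \int[P]_s (h s)%:E)%E by apply: integral_ge0 => s _; rewrite lee_fin.
have fin : (\int[P]_s (h s)%:E)%E \is a fin_num.
  by rewrite ge0_fin_numE// (le_lt_trans hM)// ltry.
exists (fine (\int[P]_s (h s)%:E)%E); last by rewrite -lee_fin fineK.
split; last by rewrite fineK.
apply/integrableP; split; first exact/measurable_EFinP.
under eq_integral do rewrite /= ger0_norm//.
by rewrite (le_lt_trans hM)// ltry.
Qed.

Lemma has_int_entry m n (X : S -> 'M[R]_(m, n)) i j :
  mx_integrable P X -> has_int (fun s => X s i j) (mx_expectation P X i j).
Proof.
move=> iX; split; first exact: iX.
by rewrite mxE fineK//; apply: integrable_fin_num; last exact: iX.
Qed.

Lemma has_int_fdot m n (X : S -> 'M[R]_(m, n)) B :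
  mx_integrable P X -> has_int (fun s => fdot B (X s - mx_expectation P X)) 0.
Proof.
move=> iX.
have -> : (0 : R) = \sum_(i < m) \sum_(j < n) B i j * 0.
  by rewrite big1// => i _; rewrite big1// => j _; rewrite mulr0.
apply: has_int_sum => i; apply: has_int_sum => j; apply: has_intZ.
rewrite -(subrr (mx_expectation P X i j)).
rewrite (_ : (fun s => _) = (fun s => X s i j + - mx_expectation P X i j)); last first.
  by apply/funext => s; rewrite !mxE.
by apply: has_intD; [exact: has_int_entry | exact: has_int_cst].
Qed.

Lemma mx_integrable_measurable m n (X : S -> 'M[R]_(m, n)) :
  mx_integrable P X -> mx_measurable X.
Proof.
by move=> iX i j; have /integrableP[/measurable_EFinP] := iX i j.
Qed.

End Integrals.

Section StochasticOracle.
Context {R : realType} {d d' m n : nat} {dS : measure_display} {S : measurableType dS}.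
Variable P : probability S R.
Variables (H : 'cV[R]_d -> 'cV[R]_d' -> 'M[R]_(m, n))
  (Hs : S -> 'cV[R]_d -> 'cV[R]_d' -> 'M[R]_(m, n)) (L sigma : R).
Hypotheses (H_mean : unbiased P H Hs) (Hs_lip : forall s, lipschitz_xy (Hs s) L)
  (Hs_var : variance_bounded P Hs sigma).
Implicit Types (x : 'cV[R]_d) (y : 'cV[R]_d').

Lemma sqr_lipschitz_xy (h : 'cV[R]_d -> 'cV[R]_d' -> 'M[R]_(m, n)) :
  lipschitz_xy h L -> forall x y x' y', frob (h x y - h x' y') ^+ 2 <=
    L ^+ 2 * (frob (x - x') ^+ 2 + frob (y - y') ^+ 2).
Proof.
move=> hL x y x' y'; have := hL x y x' y'.
have r0 : 0 <= frob (x - x') ^+ 2 + frob (y - y') ^+ 2 by rewrite addr_ge0 ?sqr_ge0.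
move=> h1; rewrite -(sqr_sqrtr r0) -exprMn ler_sqr ?nnegrE ?frob_ge0//.
by rewrite (le_trans _ h1) ?frob_ge0.
Qed.

Lemma has_int_oracle x y B : has_int P (fun s => fdot B (Hs s x y - H x y)) 0.
Proof. by have [iH <-] := H_mean x y; exact: has_int_fdot. Qed.

(** Jensen's inequality for the squared norm, by testing the mean difference [D]
against itself. *)
Lemma mean_sqr_lipschitz x y x' y' : frob (H x y - H x' y') ^+ 2 <=
  L ^+ 2 * (frob (x - x') ^+ 2 + frob (y - y') ^+ 2).
Proof.
set D := H x y - H x' y'; set r := L ^+ 2 * _.
have h1 := has_int_oracle x y D; have h2 := has_intZ (-1) (has_int_oracle x' y' D).
have h3 := has_intD (has_intD h1 h2) (has_int_cst P (fdot D D)).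
rewrite mulr0 !add0r -sqr_frob in h3.
have {h3} := @has_int_le _ _ _ P _ _ ((frob D ^+ 2 + r) / 2) h3.
suff Hb s : fdot D (Hs s x y - H x y) + -1 * fdot D (Hs s x' y' - H x' y') + frob D ^+ 2
  <= (frob D ^+ 2 + r) / 2 by move=> /(_ Hb); lra.
rewrite sqr_frob mulN1r -fdotBr -fdotDr.
have -> : Hs s x y - H x y - (Hs s x' y' - H x' y') + D = Hs s x y - Hs s x' y'.
  by rewrite /D; apply/matrixP => i j; rewrite !mxE; ring.
have := sqr_lipschitz_xy (Hs_lip s) x y x' y'; rewrite -/r.
have := fdotAA_ge0 (D - (Hs s x y - Hs s x' y')).
clearbody D r; move: (Hs s x y - _) => E; rewrite !sqr_frob !(fdotBl, fdotBr) (fdotC E D); lra.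
Qed.

(** Expand [u1 - H x y] around the old error [u - H x' y']: the fresh noise has
mean zero, so only its second moment is added.  The part of the noise that is
weighted by [1 - b] is a difference of the same sample at two points, hence
small with the displacement; this is the variance reduction. *)
Lemma storm_step x y x' y' u b :
  (\int[P]_s (frob ((1 - b) *: (u - Hs s x' y') + Hs s x y - H x y) ^+ 2)%:E <=
   ((1 - b) ^+ 2 * frob (u - H x' y') ^+ 2
    + 2 * (1 - b) ^+ 2 * (L ^+ 2 * (frob (x - x') ^+ 2 + frob (y - y') ^+ 2))
    + 2 * b ^+ 2 * sigma ^+ 2)%:E)%E.
Proof.
have mH x1 y1 : mx_measurable (fun s => Hs s x1 y1).
  by have [/mx_integrable_measurable] := H_mean x1 y1.
have mHB x1 y1 : mx_measurable (fun s => Hs s x1 y1 - H x1 y1).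
  by apply: mx_measurableB; [exact: mH | exact: mx_measurable_cst].
have [q qi qs] : exists2 q, has_int P (fun s => frob (Hs s x y - H x y) ^+ 2) q &
    q <= sigma ^+ 2.
  apply: has_int_ge0 => [|s|]; first exact: measurable_sqr_frob.
    exact: sqr_ge0.
  have := Hs_var x y; rewrite /mx_variance unlock.
  by have [_ ->] := H_mean x y.
set A := u - H x' y'; set r := L ^+ 2 * _.
set D := H x y - H x' y'.
(* [B1] and [B2] collect the terms linear in the noise, which integrate to zero. *)
pose c0 := (1 - b) ^+ 2 * frob A ^+ 2 + 2 * (1 - b) ^+ 2 * r.
pose B1 := (2 * (1 - b)) *: A - (4 * (1 - b) ^+ 2) *: D.
pose B2 := (4 * (1 - b) ^+ 2) *: D - (2 * (1 - b) ^+ 2) *: A.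
have [i1 E1] := has_intD (has_intD (has_int_cst P c0)
   (has_intD (has_int_oracle x y B1) (has_int_oracle x' y' B2)))
   (has_intZ (2 * b ^+ 2) qi).
rewrite !addr0 in E1.
have le1 : c0 + 2 * b ^+ 2 * q <= c0 + 2 * b ^+ 2 * sigma ^+ 2.
  by rewrite lerD2l ler_wpM2l// mulr_ge0 ?sqr_ge0.
rewrite -/c0; apply: (@le_trans _ _ (c0 + 2 * b ^+ 2 * q)%:E); last by rewrite lee_fin.
rewrite -E1; apply: ge0_le_integral => //.
- by move=> s _; rewrite lee_fin sqr_ge0.
- apply/measurable_EFinP/measurable_sqr_frob/mx_measurableB; last exact: mx_measurable_cst.
  apply: mx_measurableD => //; apply: mx_measurableZ.
  by apply: mx_measurableB => //; exact: mx_measurable_cst.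
- by have /integrableP[] := i1.
- move=> s _; rewrite lee_fin.
  have := sqr_lipschitz_xy (Hs_lip s) x y x' y'; rewrite -/r.
  set p := Hs s x y - H x y; set p' := Hs s x' y' - H x' y'.
  have -> : Hs s x y - Hs s x' y' = p - p' + D.
    by rewrite /p /p' /D; apply/matrixP => i j; rewrite !mxE; ring.
  have -> : (1 - b) *: (u - Hs s x' y') + Hs s x y - H x y =
      ((1 - b) *: (p - p') + b *: p) + (1 - b) *: A.
    by rewrite /p /p' /A; apply/matrixP => i j; rewrite !mxE; ring.
  have := fdotAA_ge0 ((1 - b) *: (p - p') - b *: p).
  rewrite /c0 /B1 /B2 !sqr_frob; clearbody D p p' A r.
  rewrite !(fdotDl, fdotDr, fdotBl, fdotBr, fdotZl, fdotZr, fdotNl, fdotNr).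
  rewrite (fdotC p' p) (fdotC D p) (fdotC D p') (fdotC A p) (fdotC A p').
  have := fdotAA_ge0 D; move: (fdot p p) (fdot p p') (fdot p' p') (fdot p D) (fdot p' D) (fdot D D) => pp pq qq pD qD DD.
  move: (fdot p A) (fdot p' A) (fdot A A) => pA qA AA DD0 h1 h2.
  have : 0 <= (1 - b) ^+ 2 * (r - (pp - pq - (pq - qq) + (pD - qD) + (pD - qD + DD))).
    by rewrite mulr_ge0 ?sqr_ge0// subr_ge0; lra.
  have : 0 <= (1 - b) ^+ 2 * DD by rewrite mulr_ge0 ?sqr_ge0.
  move: h1.
  lra.
Qed.

End StochasticOracle.

(** * Fresh samples and joint measurability *)

Section FreshSample.
Context {R : realType} {dO dS : measure_display}
  {Omega : measurableType dO} {S : measurableType dS}.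
Variables (P : probability Omega R) (PS : probability S R) (X : {mfun Omega >-> S}).
Variable G : set (set Omega).
Local Open Scope classical_set_scope.
Hypotheses (G_meas : G `<=` measurable) (G_setI : setI_closed G) (G_setT : G setT)
  (X_indep : forall A B, G A -> measurable B ->
     P (A `&` X @^-1` B) = (P A * PS B)%E).

Let past := g_sigma_algebraType G.

Lemma past_measurable (A : set Omega) : <<s G >> A -> measurable A.
Proof. exact: (smallest_sub (@sigma_algebra_measurable _ _)). Qed.

Lemma measurable_id_past : measurable_fun setT (idfun : Omega -> past).
Proof. by move=> _ A mA; rewrite setTI preimage_id; exact: past_measurable. Qed.

(** An event of the past is independent of the fresh sample: by uniqueness of
measures it suffices to check this on the generating pi-system [G]. *)
Lemma past_indep A B : <<s G >> A -> measurable B ->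
  P (A `&` X @^-1` B) = (P A * PS B)%E.
Proof.
move=> sA mB.
have mXB : measurable (X @^-1` B) by rewrite -[X in measurable X]setTI; exact: measurable_funP.
have PB0 : (0 <= fine (PS B))%R by rewrite fine_ge0.
have PBE : ((NngNum PB0)%:num%:E = PS B)%E by rewrite /= fineK// fin_num_measure.
transitivity (mrestr P mXB A); first by [].
rewrite muleC -PBE -[RHS]/(mscale (NngNum PB0) P A).
apply: (g_sigma_algebra_measure_unique G G_meas (fun=> setT)) => //.
- by rewrite bigcup_const.
- by move=> C GC; rewrite /= /mrestr /mscale X_indep// muleC; congr (_ * _)%E.
- move=> k; rewrite /= /mrestr setTI; apply: (le_lt_trans (probability_le1 P mXB)).
  by rewrite ltry.
Qed.

(** Freezing: integrate out the fresh sample while the past is kept fixed. *)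
Lemma integral_fresh (phi : past * S -> R) : measurable_fun setT phi ->
  (forall z, 0 <= phi z) ->
  (\int[P]_o (phi (o, X o))%:E = \int[P]_o \int[PS]_s (phi (o, s))%:E)%E.
Proof.
move=> mphi phi0.
have mpair : measurable_fun setT (fun o : Omega => (o : past, X o)).
  apply: measurable_fun_pair; first exact: measurable_id_past.
  exact: measurable_funP.
pose pr : {mfun Omega >-> (past * S)%type} := mfun_Sub (mem_set mpair).
pose i : {mfun Omega >-> past} := mfun_Sub (mem_set measurable_id_past).
have mEphi : measurable_fun setT (EFin \o phi) by exact/measurable_EFinP.
transitivity (\int[distribution P pr]_z (phi z)%:E)%E.
  by rewrite ge0_integral_distribution// => z; rewrite lee_fin.
transitivity (\int[distribution P i \x PS]_z (phi z)%:E)%E.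
  apply: eq_measure_integral => A mA _; apply/esym; apply: product_measure_unique => //.
  move=> B C mB mC; exact: past_indep.
rewrite fubini_tonelli1//.
rewrite ge0_integral_distribution//.
  by apply: measurable_fun_fubini_tonelli_F => // z; rewrite lee_fin.
by move=> z; apply: integral_ge0 => s _; rewrite lee_fin.
Qed.

End FreshSample.

Section Caratheodory.
Context {R : realType} {dT dS : measure_display}
  {T : measurableType dT} {S : measurableType dS}.
Local Open Scope classical_set_scope.

Definition continuous_eps m n (h : 'M[R]_(m, n) -> R) : Prop := forall p e, 0 < e ->
  exists r, 0 < r /\ forall q, frob (q - p) < r -> `|h q - h p| <= e.

Definition grid_index m n k (p : 'M[R]_(m, n)) : 'M[int]_(m, n) :=
  map_mx (fun r => Num.floor (k.+1%:R * r)) p.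

Definition grid_point m n k (q : 'M[int]_(m, n)) : 'M[R]_(m, n) :=
  map_mx (fun i => i%:~R / k.+1%:R) q.

Lemma frob_grid m n k (p : 'M[R]_(m, n)) :
  frob (grid_point k (grid_index k p) - p) <= (m * n).+1%:R / k.+1%:R.
Proof.
apply: (le_trans (frob_le_norm _)); rewrite ler_wpM2l//.
have k0 : 0 < k.+1%:R :> R by rewrite ltr0n.
rewrite [leLHS]/Num.norm /= mx_normrE; apply/bigmax_leP; split.
  by rewrite invr_ge0 ltW.
move=> [i j] _ /=; rewrite !mxE distrC.
have -> : p i j - (Num.floor (k.+1%:R * p i j))%:~R / k.+1%:R =
   (k.+1%:R * p i j - (Num.floor (k.+1%:R * p i j))%:~R) / k.+1%:R.
  by field; rewrite gt_eqF.
move: (k.+1%:R * p i j) => r.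
rewrite normrM normfV (ger0_norm (ltW k0)) -[leRHS]mul1r ler_wpM2r ?invr_ge0 ?(ltW k0)//.
have := floor_itv r => /andP[h1 h2].
rewrite ger0_norm ?subr_ge0// lerBlDl; apply: ltW; apply: (lt_le_trans h2).
by rewrite intrD1.
Qed.

(** Joint measurability of a function that is measurable in the sample and
continuous in the state: approximate the state by points of a finer and finer
grid, that is, by countably many values. *)
Lemma caratheodory m n (X : T -> 'M[R]_(m, n)) (h : S -> 'M[R]_(m, n) -> R) :
  mx_measurable X -> (forall p, measurable_fun setT (fun s => h s p)) ->
  (forall s, continuous_eps (h s)) ->
  measurable_fun setT (fun z : T * S => h z.2 (X z.1)).
Proof.
move=> mX mh ch.
apply: (@measurable_fun_cvg _ _ _ _
  (fun k z => h z.2 (grid_point k (grid_index k (X z.1))))) => [k|[t s] _]; last first.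
  apply/cvgrPdist_le => e e0 /=; have [r [r0 hr]] := ch s (X t) _ e0.
  have C0 : 0 < (m * n).+1%:R :> R by rewrite ltr0n.
  have [N hN] := natSinv_small (ltac:(by rewrite !divr_gt0) : 0 < r / 2 / (m * n).+1%:R).
  exists N => // k /= Nk; rewrite distrC; apply: hr.
  apply: (le_lt_trans (frob_grid _ _)).
  have := hN _ Nk; rewrite ler_pdivlMr// mulrC => /le_lt_trans; apply.
  by rewrite ltr_pdivrMr// mulr_natr mulr2n ltrDl.
move=> _ B mB; rewrite setTI.
have mfib (q : 'M[int]_(m, n)) : measurable [set t | grid_index k (X t) = q].
  have -> : [set t | grid_index k (X t) = q] =
      \bigcap_(i : 'I_m * 'I_n) [set t | Num.floor (k.+1%:R * X t i.1 i.2) = q i.1 i.2].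
    apply/seteqP; split=> t /=.
      by move=> <- i _ /=; rewrite mxE.
    by move=> H; apply/matrixP => i j; rewrite mxE (H (i, j)).
  apply: fin_bigcap_measurable; first exact: finite_finset.
  move=> i _.
  have mk : measurable_fun setT (fun t => k.+1%:R * X t i.1 i.2).
    exact: measurable_funM (measurable_cst _) (mX i.1 i.2).
  have := mk measurableT _ (@measurable_itv R `[(q i.1 i.2)%:~R, (q i.1 i.2 + 1)%:~R[%R).
  rewrite setTI (_ : _ @^-1` _ = [set t | Num.floor (k.+1%:R * X t i.1 i.2) = q i.1 i.2])//.
  apply/seteqP; split=> t /=.
    by rewrite in_itv/= => /floor_def.
  by move=> <-; rewrite in_itv/= floor_itv.
have -> : (fun z : T * S => h z.2 (grid_point k (grid_index k (X z.1)))) @^-1` B =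
    \bigcup_q ([set t | grid_index k (X t) = q] `*` ((fun s => h s (grid_point k q)) @^-1` B)).
  apply/seteqP; split=> [[t s] /= Bh|[t s] [q _ /= [<-]]]//.
  by exists (grid_index k (X t)).
apply: countable_bigcupT_measurable => [|q]; first exact: countableP.
apply: measurableX; first exact: mfib.
by rewrite -[X in measurable X]setTI; exact: mh.
Qed.

End Caratheodory.

Lemma measurable_continuous_comp {R : realType} {dT : measure_display}
    {T : measurableType dT} m n (X : T -> 'M[R]_(m, n)) (h : 'M[R]_(m, n) -> R) :
  mx_measurable X -> continuous_eps h -> measurable_fun setT (fun t => h (X t)).
Proof.
move=> mX ch.
have mh : measurable_fun setT (fun z : T * T => h (X z.1)).
  by apply: (caratheodory (h := fun=> h)) => // p; exact: measurable_cst.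
have mp : measurable_fun setT (fun t : T => (t, t)) by exact: measurable_fun_pair.
exact: (measurableT_comp mh mp).
Qed.

Section OracleMeasurable.
Context {R : realType} {d d' m n : nat} {dS : measure_display} {S : measurableType dS}.
Variable PS : probability S R.
Variables (H : 'cV[R]_d -> 'cV[R]_d' -> 'M[R]_(m, n))
  (Hs : S -> 'cV[R]_d -> 'cV[R]_d' -> 'M[R]_(m, n)) (L sigma : R).
Hypotheses (H_mean : unbiased PS H Hs) (Hs_lip : forall s, lipschitz_xy (Hs s) L).

Lemma sqr_frob_col_mx (p : 'cV[R]_(d + d')) :
  frob (usubmx p) ^+ 2 + frob (dsubmx p) ^+ 2 = frob p ^+ 2.
Proof.
rewrite !sqr_frob !fdot_cV big_split_ord/=; congr (_ + _);
by apply: eq_bigr => i _; rewrite !mxE.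
Qed.

(** Stacking the two blocks into one column makes joint Lipschitz continuity an instance
of continuity in one matrix variable. *)
Lemma lipschitz_xy_continuous (h : 'cV[R]_d -> 'cV[R]_d' -> 'M[R]_(m, n)) i j :
  lipschitz_xy h L ->
  continuous_eps (fun p : 'cV[R]_(d + d') => h (usubmx p) (dsubmx p) i j).
Proof.
move=> hL p e e0.
have L1 : 0 < `|L| + 1 by rewrite ltr_wpDl.
exists (e / (`|L| + 1)); split; first by rewrite divr_gt0.
move=> q; rewrite ltr_pdivlMr// => qp.
have := entry_le (h (usubmx q) (dsubmx q) - h (usubmx p) (dsubmx p)) i j.
rewrite !mxE => /le_trans; apply; apply: (le_trans (hL _ _ _ _)).
rewrite -!linearB/= sqr_frob_col_mx sqrtr_sqr (ger0_norm (frob_ge0 _)).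
apply: le_trans (ltW qp); rewrite mulrC ler_wpM2l ?frob_ge0//.
by rewrite (le_trans (ler_norm _))// lerDl.
Qed.

Lemma mx_measurable_col_mx {dT : measure_display} {T : measurableType dT}
    (x : T -> 'cV[R]_d) (y : T -> 'cV[R]_d') :
  mx_measurable x -> mx_measurable y -> mx_measurable (fun t => col_mx (x t) (y t)).
Proof.
move=> mx my i j; case: (split_ordP i) => k ->.
  by under eq_fun do rewrite col_mxEu; exact: mx.
by under eq_fun do rewrite col_mxEd; exact: my.
Qed.

Lemma mx_measurable_lipschitz {dT : measure_display} {T : measurableType dT}
    (h : 'cV[R]_d -> 'cV[R]_d' -> 'M[R]_(m, n)) (x : T -> 'cV[R]_d) (y : T -> 'cV[R]_d') :
  lipschitz_xy h L -> mx_measurable x -> mx_measurable y ->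
  mx_measurable (fun t => h (x t) (y t)).
Proof.
move=> hL mx my i j.
have := measurable_continuous_comp (mx_measurable_col_mx mx my)
  (lipschitz_xy_continuous i j hL).
by congr measurable_fun; apply/funext => t; rewrite col_mxKu col_mxKd.
Qed.

Lemma mx_measurable_oracle {dT : measure_display} {T : measurableType dT}
    (x : T -> 'cV[R]_d) (y : T -> 'cV[R]_d') :
  mx_measurable x -> mx_measurable y ->
  mx_measurable (fun z : T * S => Hs z.2 (x z.1) (y z.1)).
Proof.
move=> mx my i j.
have mh (p : 'cV[R]_(d + d')) : measurable_fun setT (fun s => Hs s (usubmx p) (dsubmx p) i j).
  have [/mx_integrable_measurable mH _] := H_mean (usubmx p) (dsubmx p); exact: mH.
have := caratheodory (mx_measurable_col_mx mx my) mh
  (fun s => lipschitz_xy_continuous i j (Hs_lip s)).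
by congr measurable_fun; apply/funext => z; rewrite col_mxKu col_mxKd.
Qed.

Lemma mean_lipschitz_xy : lipschitz_xy H `|L|.
Proof.
move=> x y x' y'.
have r0 : 0 <= frob (x - x') ^+ 2 + frob (y - y') ^+ 2 by rewrite addr_ge0 ?sqr_ge0.
rewrite -ler_sqr ?nnegrE ?mulr_ge0 ?frob_ge0 ?sqrtr_ge0//.
rewrite exprMn (sqr_sqrtr r0) real_normK ?num_real//.
exact: (mean_sqr_lipschitz H_mean Hs_lip).
Qed.

End OracleMeasurable.

Section StormInExpectation.
Context {R : realType} {d d' m n : nat} {dO dS : measure_display}
  {Omega : measurableType dO} {S : measurableType dS}.
Variables (P : probability Omega R) (PS : probability S R) (X : {mfun Omega >-> S}).
Variable G : set (set Omega).
Local Open Scope classical_set_scope.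
Hypotheses (G_meas : G `<=` measurable) (G_setI : setI_closed G) (G_setT : G setT)
  (X_indep : forall A B, G A -> measurable B ->
     P (A `&` X @^-1` B) = (P A * PS B)%E).
Variables (H : 'cV[R]_d -> 'cV[R]_d' -> 'M[R]_(m, n))
  (Hs : S -> 'cV[R]_d -> 'cV[R]_d' -> 'M[R]_(m, n)) (L sigma : R).
Hypotheses (H_mean : unbiased PS H Hs) (Hs_lip : forall s, lipschitz_xy (Hs s) L)
  (Hs_var : variance_bounded PS Hs sigma).

Let past := g_sigma_algebraType G.

Lemma measurable_fun_past (h : past -> R) :
  measurable_fun setT h -> measurable_fun setT (h : Omega -> R).
Proof. by move=> mh; apply: (measurableT_comp mh); exact: measurable_id_past. Qed.

(** Freeze the past and apply [storm_step] to the fresh sample, outcome by outcome. *)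
Lemma storm_expectation (x x' : past -> 'cV[R]_d) (y y' : past -> 'cV[R]_d')
    (U : past -> 'M[R]_(m, n)) b :
  mx_measurable x -> mx_measurable y -> mx_measurable x' -> mx_measurable y' ->
  mx_measurable U ->
  (\int[P]_o (frob ((1 - b) *: (U o - Hs (X o) (x' o) (y' o)) + Hs (X o) (x o) (y o)
                   - H (x o) (y o)) ^+ 2)%:E <=
  \int[P]_o ((1 - b) ^+ 2 * frob (U o - H (x' o) (y' o)) ^+ 2
     + 2 * (1 - b) ^+ 2 * (L ^+ 2 * (frob (x o - x' o) ^+ 2 + frob (y o - y' o) ^+ 2))
     + 2 * b ^+ 2 * sigma ^+ 2)%:E)%E.
Proof.
move=> mx my mx' my' mU.
pose phi (z : past * S) := frob ((1 - b) *: (U z.1 - Hs z.2 (x' z.1) (y' z.1))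
  + Hs z.2 (x z.1) (y z.1) - H (x z.1) (y z.1)) ^+ 2.
have mH (x1 : past -> 'cV[R]_d) (y1 : past -> 'cV[R]_d') : mx_measurable x1 ->
    mx_measurable y1 -> mx_measurable (fun t => H (x1 t) (y1 t)).
  by move=> *; apply: (mx_measurable_lipschitz (mean_lipschitz_xy H_mean Hs_lip)).
have mfst k l (Y : past -> 'M[R]_(k, l)) : mx_measurable Y ->
    mx_measurable (fun z : past * S => Y z.1).
  by move=> mY i j; apply: (measurableT_comp (mY i j)); exact: measurable_fst.
have mphi : measurable_fun setT phi.
  apply: measurable_sqr_frob; apply: mx_measurableB; last exact: (mfst _ _ (fun t => H (x t) (y t)) (mH _ _ mx my)).
  apply: mx_measurableD; last exact: (mx_measurable_oracle H_mean Hs_lip).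
  apply: mx_measurableZ; apply: mx_measurableB; first exact: mfst.
  exact: (mx_measurable_oracle H_mean Hs_lip).
have phi0 z : 0 <= phi z by exact: sqr_ge0.
have mEphi : measurable_fun setT (EFin \o phi) by exact/measurable_EFinP.
have -> : (\int[P]_o (frob ((1 - b) *: (U o - Hs (X o) (x' o) (y' o)) + Hs (X o) (x o) (y o)
                   - H (x o) (y o)) ^+ 2)%:E = \int[P]_o (phi (o : past, X o))%:E)%E by [].
rewrite (integral_fresh G_meas G_setI G_setT X_indep mphi phi0).
apply: ge0_le_integral => //.
- by move=> o _; apply: integral_ge0 => s _; rewrite lee_fin.
- have mF : measurable_fun setT (fubini_F PS (EFin \o phi)).
    by apply: measurable_fun_fubini_tonelli_F => // z; rewrite lee_fin.
  exact: (measurableT_comp mF (measurable_id_past G_meas)).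
- have m1 := measurable_sqr_frob (mx_measurableB mU (mH _ _ mx' my')).
  have m2 := measurable_sqr_frob (mx_measurableB mx mx').
  have m3 := measurable_sqr_frob (mx_measurableB my my').
  have m4 := measurable_funM (measurable_cst ((1 - b) ^+ 2)) m1.
  have m23 := measurable_funD m2 m3.
  have m5' : measurable_fun setT (cst (L ^+ 2) : past -> R) by exact: measurable_cst.
  have m5'' : measurable_fun setT (cst (2 * (1 - b) ^+ 2) : past -> R) by exact: measurable_cst.
  have m5a := measurable_funM m5' m23.
  have m5 := measurable_funM m5'' m5a.
  have m6 := measurable_funD (measurable_funD m4 m5)
    (measurable_cst (2 * b ^+ 2 * sigma ^+ 2)).
  apply/measurable_EFinP. Timeout 30 exact: (measurable_fun_past m6).
- move=> o _.
  exact: (storm_step H_mean Hs_lip Hs_var (x o) (y o) (x' o) (y' o) (U o) b).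
Qed.

End StormInExpectation.

(** * The filtration of the samples *)

Section Filtration.
Context {R : realType} {dX dZ dO : measure_display} {Xi : measurableType dX}
  {Zeta : measurableType dZ} {Omega : measurableType dO}.
Variables (PXi : probability Xi R) (PZeta : probability Zeta R) (P : probability Omega R).
Variables (xi : nat -> {mfun Omega >-> Xi}) (zeta : nat -> {mfun Omega >-> Zeta}).
Local Open Scope classical_set_scope.

Definition sample_time (k : nat + nat) : nat := match k with inl t | inr t => t end.

(** Intersections of sample events before time [t]. They form a pi-system generating the
past, and mutual independence of the samples speaks of exactly such sets. *)
Definition past_events (t : nat) : set (set Omega) :=
  [set A | exists E : nat + nat -> set Omega,
     (forall k, sample_events xi zeta k (E k)) /\
     A = [set o | forall k, (sample_time k < t)%N -> E k o]].

Lemma sample_eventsT k : sample_events xi zeta k setT.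
Proof. by case: k => t; exists setT => //; rewrite setTI preimage_setT. Qed.

Lemma sample_eventsI k A B : sample_events xi zeta k A -> sample_events xi zeta k B ->
  sample_events xi zeta k (A `&` B).
Proof.
by case: k => t /= [A' mA <-] [B' mB <-]; exists (A' `&` B');
  rewrite ?preimage_setI ?setTI//; exact: measurableI.
Qed.

Lemma sample_events_measurable k A : sample_events xi zeta k A -> measurable A.
Proof.
by case: k => t /= [A' mA <-]; apply: measurable_funP.
Qed.

Definition times (t : nat) : seq (nat + nat) :=
  [seq inl i | i <- iota 0 t] ++ [seq inr i | i <- iota 0 t].

Lemma mem_times t k : (k \in times t) = (sample_time k < t)%N.
Proof.
rewrite mem_cat; case: k => i /=.
  rewrite (mem_map (inl_inj (B := nat))) mem_iota add0n.
  by rewrite (_ : inl i \in _ = false) ?orbF//; apply/mapP => -[].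
rewrite (mem_map (inr_inj (A := nat))) mem_iota add0n.
by rewrite (_ : inr i \in _ = false)//; apply/mapP => -[].
Qed.

Lemma uniq_times t : uniq (times t).
Proof.
rewrite cat_uniq !map_inj_uniq ?iota_uniq/= ?andbT; [|by move=> ? ? []..].
by apply/hasPn => k /mapP[i _ ->]; apply/mapP => -[].
Qed.

Lemma past_setE t (E : nat + nat -> set Omega) :
  [set o | forall k, (sample_time k < t)%N -> E k o] = \big[setI/setT]_(k <- times t) E k.
Proof.
rewrite -bigcap_seq; apply/seteqP; split=> o /= H k.
  by rewrite /= mem_times; exact: H.
by move=> kt; apply: H; rewrite /= mem_times.
Qed.

Lemma past_events_measurable t : past_events t `<=` measurable.
Proof.
move=> _ [E [sE ->]]; rewrite past_setE; apply: bigsetI_measurable => k _.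
exact: sample_events_measurable.
Qed.

Lemma past_events_setT t : past_events t setT.
Proof.
exists (fun=> setT); split=> [k|]; first exact: sample_eventsT.
by apply/seteqP; split.
Qed.

Lemma past_events_setI t : setI_closed (past_events t).
Proof.
move=> _ _ [E [sE ->]] [E' [sE' ->]]; exists (fun k => E k `&` E' k); split.
  by move=> k; exact: sample_eventsI.
apply/seteqP; split=> o /= H; first by case: H => H H' k kt; split; [exact: H|exact: H'].
by split=> k kt; have [] := H k kt.
Qed.

Lemma past_eventsS t : past_events t `<=` past_events t.+1.
Proof.
move=> _ [E [sE ->]]; exists (fun k => if (sample_time k < t)%N then E k else setT); split.
  by move=> k; case: ifP => // _; exact: sample_eventsT.
apply/seteqP; split=> o /= H k kt; first by case: ifP => // /H.
by have := H k (ltnW kt); rewrite kt; apply; exact: ltnW.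
Qed.

Lemma past_events_sample k t A : (sample_time k < t)%N -> sample_events xi zeta k A ->
  past_events t A.
Proof.
move=> kt sA; exists (fun l => if l == k then A else setT); split.
  by move=> l; case: eqP => [->//|_]; exact: sample_eventsT.
apply/seteqP; split=> o /=; first by move=> Ao l _; case: eqP.
by move=> /(_ k kt); rewrite eqxx.
Qed.

Hypothesis samples : fresh_samples PXi PZeta P xi zeta.

(** The new sample index is not among the earlier ones, so both sides are products over
lists without repetition. *)
Lemma past_events_indep t k A B : past_events t A -> sample_time k = t ->
  sample_events xi zeta k B -> P (A `&` B) = (P A * P B)%E.
Proof.
move=> [E [sE ->]] kt sB; rewrite past_setE.
have [_ _ indep] := samples.
have kNt : k \notin times t by rewrite mem_times kt ltnn.
pose E' l := if l == k then B else E l.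
have sE' l : sample_events xi zeta l (E' l) by rewrite /E'; case: eqP => [->|].
have EE' : \big[setI/setT]_(l <- times t) E' l = \big[setI/setT]_(l <- times t) E l.
  by apply: eq_big_seq => l lt; rewrite /E'; case: eqP => // lk; rewrite -lk lt in kNt.
have := indep (k :: times t) E'; rewrite /= kNt uniq_times => /(_ isT (fun i _ => sE' i)).
rewrite !big_cons {1 3}/E' eqxx EE' setIC => ->; rewrite muleC; congr (_ * _)%E.
rewrite (indep _ _ (uniq_times t) (fun i _ => sE i)).
by apply: eq_big_seq => l lt; rewrite /E'; case: eqP => // lk; rewrite -lk lt in kNt.
Qed.

Lemma xi_indep t A B : past_events t A -> measurable B ->
  P (A `&` xi t @^-1` B) = (P A * PXi B)%E.
Proof.
move=> tA mB; rewrite (past_events_indep (k := inl t) tA)//; last first.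
  by exists B => //; rewrite setTI.
by have [law _ _] := samples; rewrite -(law t).
Qed.

Lemma zeta_indep t A B : past_events t A -> measurable B ->
  P (A `&` zeta t @^-1` B) = (P A * PZeta B)%E.
Proof.
move=> tA mB; rewrite (past_events_indep (k := inr t) tA)//; last first.
  by exists B => //; rewrite setTI.
by have [_ law _] := samples; rewrite -(law t).
Qed.

Definition past t := g_sigma_algebraType (past_events t).

Lemma measurable_past_lift t : measurable_fun setT (idfun : past t.+1 -> past t).
Proof.
move=> _ A mA; rewrite setTI preimage_id.
exact: (sub_smallest2r (@smallest_sigma_algebra _ setT (past_events t.+1)) (@past_eventsS t)).
Qed.

Lemma mx_measurable_lift t m n (X : Omega -> 'M[R]_(m, n)) :
  @mx_measurable R _ (past t) m n X -> @mx_measurable R _ (past t.+1) m n X.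
Proof. by move=> mX i j; exact: (measurableT_comp (mX i j) (@measurable_past_lift t)). Qed.

Lemma measurable_xi t : measurable_fun setT (xi t : past t.+1 -> Xi).
Proof.
move=> _ B mB; apply: sub_gen_smallest; apply: (past_events_sample (k := inl t)) => //.
by exists B.
Qed.

Lemma measurable_zeta t : measurable_fun setT (zeta t : past t.+1 -> Zeta).
Proof.
move=> _ B mB; apply: sub_gen_smallest; apply: (past_events_sample (k := inr t)) => //.
by exists B.
Qed.

End Filtration.

(** * The step size and the rate *)

Section StepSize.
Context {R : realType}.
Variables (c c0 : R).
Hypotheses (c_gt0 : 0 < c) (c0_ge2 : 2 <= c0).

Let root (t : nat) : R := (c0 + t%:R) `^ (1 / 3).

Lemma c0t_gt0 t : 0 < c0 + t%:R.
Proof. by rewrite ltr_wpDr// (lt_le_trans _ c0_ge2). Qed.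

Lemma root_gt0 t : 0 < root t.
Proof. by rewrite powR_gt0// c0t_gt0. Qed.

Lemma cube_root (a : R) : 0 <= a -> (a `^ (1 / 3)) ^+ 3 = a.
Proof.
move=> a0; rewrite -powR_mulrn ?powR_ge0// -powRrM (_ : 1 / 3 * 3 = 1 :> R) ?powRr1//.
by field.
Qed.

Lemma root_cube t : root t ^+ 3 = c0 + t%:R.
Proof. by rewrite cube_root// ltW// c0t_gt0. Qed.

Definition step_size (t : nat) : R := c / root t.

Lemma step_size_gt0 t : 0 < step_size t.
Proof. by rewrite divr_gt0// root_gt0. Qed.

Lemma step_size_cube t : step_size t ^+ 3 = c ^+ 3 / (c0 + t%:R).
Proof. by rewrite expr_div_n root_cube. Qed.

Lemma step_size_le s t : (s <= t)%N -> step_size t <= step_size s.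
Proof.
move=> st; rewrite ler_pM2l// lef_pV2 ?posrE ?root_gt0//.
by apply: ge0_ler_powR; rewrite ?nnegrE ?divr_ge0 ?(ltW (c0t_gt0 _)) ?lerD2l ?ler_nat.
Qed.

Lemma step_size_small e : 0 < e -> exists t0, forall t, (t0 <= t)%N -> step_size t <= e.
Proof.
move=> e0; exists (Num.bound ((c / e) ^+ 3)) => t tb.
rewrite ler_pdivrMr ?root_gt0// mulrC -ler_pdivrMr//.
have ce : 0 <= c / e by rewrite divr_ge0// ltW.
rewrite -(@ler_pXn2r _ 3)// ?nnegrE ?(ltW (root_gt0 _))// root_cube.
have h1 : (c / e) ^+ 3 < (Num.bound ((c / e) ^+ 3))%:R by rewrite archi_boundP// exprn_ge0.
have h2 : (Num.bound ((c / e) ^+ 3))%:R <= t%:R :> R by rewrite ler_nat.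
by have := c0_ge2; lra.
Qed.

(** The cube root has increments of order [root t ^- 2], so [1 / step_size] grows by
much less than [kappa * step_size] once the step size is small. *)
Lemma step_size_inv_increment kappa t : 0 < kappa ->
  step_size t.+1 <= kappa * c ^+ 3 ->
  (step_size t.+1)^-1 <= (step_size t)^-1 + kappa * step_size t.+1.
Proof.
move=> k0 small; rewrite /step_size !invf_div -lerBlDl -mulrBl ler_pdivrMr//.
have s0 := root_gt0 t.+1; have s0' := root_gt0 t.
have E : (root t.+1 - root t) * (root t.+1 ^+ 2 + root t.+1 * root t + root t ^+ 2) = 1.
  transitivity (root t.+1 ^+ 3 - root t ^+ 3); first by ring.
  by rewrite !root_cube -natr1; ring.
have d0 : 0 <= root t.+1 - root t.
  rewrite -(@pmulr_lge0 _ (root t.+1 ^+ 2 + root t.+1 * root t + root t ^+ 2)).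
    by rewrite E ler01.
  by rewrite !addr_gt0// ?exprn_gt0// mulr_gt0.
have d1 : (root t.+1 - root t) * root t.+1 ^+ 2 <= 1.
  rewrite -[leRHS]E ler_wpM2l// -addrA lerDl addr_ge0// ?mulr_ge0// ?exprn_ge0// ltW//.
have : 1 <= kappa * c ^+ 2 * root t.+1.
  move: small; rewrite /step_size ler_pdivrMr// => small.
  rewrite -(ler_pM2l c_gt0) mulr1 (le_trans small)// le_eqVlt.
  by apply/orP; left; apply/eqP; ring.
move=> k1; rewrite -(@ler_pM2r _ (root t.+1 ^+ 2)) ?exprn_gt0//.
apply: (le_trans d1).
rewrite (le_trans k1)//; move: s0; move: (root t.+1) => s s0.
rewrite le_eqVlt; apply/orP; left; apply/eqP; field.
by rewrite gt_eqF.
Qed.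

End StepSize.

Section Rates.
Context {R : realType}.

(** The terms are below [ln (t + 1) - ln t], by [ln (1 + x) <= x]. Starting at [1 / 2]
keeps the bound true at [T = 1]. *)
Lemma harmonic_log (T : nat) : (0 < T)%N ->
  \sum_(t < T.+1) (t.+2%:R)^-1 <= 1 + ln T%:R :> R.
Proof.
case: T => // T _; elim: T => [|T IH].
  by rewrite !big_ord_recr big_ord0 ln1 /=; lra.
rewrite big_ord_recr/=; apply: (le_trans (lerD IH (lexx _))).
rewrite -addrA lerD2l -lerBrDl.
have T0 : 0 < T.+1%:R :> R by rewrite ltr0n.
have T1 : 0 < T.+2%:R :> R by rewrite ltr0n.
have : ln (1 + - (T.+2%:R)^-1 : R) <= - (T.+2%:R)^-1.
  by apply: le_ln1Dx; rewrite ltrN2 invf_lt1// ltr1n.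
have -> : 1 - T.+2%:R^-1 = T.+1%:R / T.+2%:R :> R.
  rewrite -[T.+2%:R]natr1; move: T.+1%:R T0 => n n0.
  by field; rewrite gt_eqF// addr_gt0.
rewrite ln_div ?posrE//.
have : (T.+4%:R)^-1 <= (T.+2%:R)^-1 :> R by rewrite lef_pV2 ?posrE ?ltr0n// ler_nat (leq_trans (leqnSn _) (leqnSn _)).
by move: (T.+4%:R^-1) (T.+2%:R^-1) (ln T.+1%:R) (ln T.+2%:R) => *; lra.
Qed.

(** Telescoping the potential [p] bounds the weighted sum of [e] by a harmonic sum;
the smallest weight is the last one. *)
Lemma rate_of_potential (c c0 a K : R) (p e : nat -> R) (t0 : nat) :
  0 < c -> 2 <= c0 -> 0 < a -> 0 <= K ->
  (forall t, 0 <= p t) -> (forall t, 0 <= e t) ->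
  (forall t, (t0 <= t)%N -> p t.+1 + a * step_size c c0 t * e t <= p t + K / (c0 + t%:R)) ->
  exists K', forall T, (0 < T)%N ->
    T.+1%:R^-1 * \sum_(t < T.+1) e t <= K' * (1 + ln T%:R) ^+ 1 * (1 / T%:R `^ (2 / 3)).
Proof.
move=> c_gt0 c0_ge2 a_gt0 K0 p0 e0 step.
pose M := \sum_(t < t0) e t.
have M0 : 0 <= M by apply: sumr_ge0.
have eta0 t := step_size_gt0 c_gt0 c0_ge2 t.
have tele n : p (t0 + n)%N + \sum_(i < n) a * step_size c c0 (t0 + i) * e (t0 + i)%N
    <= p t0 + \sum_(i < n) K / (c0 + (t0 + i)%:R).
  elim: n => [|n IH]; first by rewrite !big_ord0 addn0.
  rewrite !big_ord_recr/= addnS; have := step (t0 + n)%N (leq_addr _ _).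
  by move: IH; set A := \sum_(i < n) _; set B := \sum_(i < n) _; lra.
have harm T : (0 < T)%N -> (t0 <= T)%N ->
    \sum_(i < (T.+1 - t0)%N) K / (c0 + (t0 + i)%:R) <= K * (1 + ln T%:R).
  move=> T0 tT; rewrite -mulr_sumr ler_wpM2l//.
  apply: (le_trans _ (harmonic_log T0)).
  rewrite -(big_mkord xpredT (fun i => (c0 + (t0 + i)%:R)^-1)).
  rewrite -(big_mkord xpredT (fun i => (i.+2%:R)^-1)).
  rewrite [leRHS](@big_cat_nat _ _ _ t0)//=; last exact: leqW.
  rewrite -[leLHS]add0r lerD//; first by apply: sumr_ge0 => i _; rewrite invr_ge0.
  rewrite [leRHS](_ : _ = \sum_(0 <= i < T.+1 - t0) ((i + t0).+2%:R)^-1); last first.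
    by rewrite -{1}[t0]add0n big_addn.
  apply: ler_sum => i _; rewrite lef_pV2 ?posrE ?c0t_gt0 ?ltr0n//.
  by rewrite addnC -addn2 natrD addrC lerD2r.
pose K' := M + (a * c)^-1 * (c0 + 1) `^ (1 / 3) * (p t0 + K).
have K'0 : 0 <= (a * c)^-1 * (c0 + 1) `^ (1 / 3) * (p t0 + K).
  by rewrite mulr_ge0 ?addr_ge0// mulr_ge0 ?powR_ge0// invr_ge0 mulr_ge0 ?(ltW a_gt0) ?(ltW c_gt0).
exists K' => T T0.
have T0' : 0 < T%:R :> R by rewrite ltr0n.
have T1 : 1 <= T%:R :> R by rewrite ler1n.
have ln0 : 0 <= ln T%:R :> R by rewrite ln_ge0.
have rT1 : 1 <= T%:R `^ (1 / 3) :> R.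
  by rewrite -[leLHS](powRr0 T%:R) ler_powR// divr_ge0.
have main : \sum_(t < T.+1) e t <= K' * (1 + ln T%:R) * T%:R `^ (1 / 3).
  have lnT1 : 1 <= (1 + ln T%:R) * T%:R `^ (1 / 3) :> R.
    by rewrite -[leLHS]mulr1 ler_pM// lerDl.
  have [tT|Tt] := leqP t0 T; last first.
    apply: (@le_trans _ _ M).
      rewrite /M -!(big_mkord xpredT e) [leRHS](@big_cat_nat _ _ _ T.+1)//= lerDl.
      by apply: sumr_ge0.
    rewrite -mulrA -[leLHS]mulr1 ler_pM// lerDl//.
  rewrite -(big_mkord xpredT e) (@big_cat_nat _ _ _ t0)//=; last exact: leqW.
  rewrite big_mkord -/M /K' -mulrA mulrDl lerD//.
    by rewrite -[leLHS]mulr1 ler_wpM2l.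
  rewrite (_ : \sum_(t0 <= t < T.+1) e t = \sum_(i < (T.+1 - t0)%N) e (t0 + i)%N); last first.
    rewrite -{1}[t0]add0n big_addn big_mkord.
    by apply: eq_bigr => i _; rewrite addnC.
  have := tele (T.+1 - t0)%N; have := harm _ T0 tT.
  set B := \sum_(i < _) K / _; set E := \sum_(i < _) e _ => hB hA.
  have hE : a * step_size c c0 T * E <= \sum_(i < (T.+1 - t0)%N) a * step_size c c0 (t0 + i) * e (t0 + i)%N.
    rewrite mulr_sumr; apply: ler_sum => i _; rewrite ler_wpM2r// ler_pM2l//.
    apply: step_size_le => //; by have := ltn_ord i; rewrite ltn_subRL ltnS.
  have root_le : (c0 + T%:R) `^ (1 / 3) <= (c0 + 1) `^ (1 / 3) * T%:R `^ (1 / 3).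
    rewrite -powRM ?addr_ge0 ?(le_trans _ c0_ge2)//.
    apply: ge0_ler_powR; rewrite ?nnegrE ?divr_ge0 ?mulr_ge0 ?addr_ge0 ?(le_trans _ c0_ge2)//.
    by rewrite mulrDl mul1r lerD2r ler_peMr// (le_trans _ c0_ge2).
  have ac0 : 0 < a * c by rewrite mulr_gt0.
  have root0 : 0 < (c0 + T%:R) `^ (1 / 3) by rewrite powR_gt0// c0t_gt0.
  have E1 : E <= (a * c)^-1 * (c0 + T%:R) `^ (1 / 3) * (p t0 + B).
    have {hE hA} : a * step_size c c0 T * E <= p t0 + B by have := p0 (t0 + (T.+1 - t0))%N; lra.
    rewrite /step_size mulrA mulrAC ler_pdivrMr// -(ler_pM2l (ltac:(by rewrite invr_gt0) : 0 < (a * c)^-1)).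
    rewrite mulKf ?gt_eqF// => /le_trans; apply; rewrite le_eqVlt; apply/orP; left; apply/eqP.
    by ring.
  apply: (le_trans E1).
  rewrite -![(a * c)^-1 * _ * _]mulrA ler_wpM2l ?invr_ge0 ?(ltW ac0)//.
  apply: (le_trans (ler_wpM2r _ root_le)).
    by rewrite addr_ge0//; apply: sumr_ge0 => i _; rewrite divr_ge0// ltW// c0t_gt0.
  rewrite -!mulrA ler_wpM2l ?powR_ge0//.
  rewrite mulrCA mulrC [leRHS]mulrA ler_wpM2r ?powR_ge0//.
  have : 0 <= p t0 * ln T%:R by rewrite mulr_ge0.
  by move: hB; rewrite !mulrDl !mulrDr !mulr1; lra.
rewrite ler_pdivrMl ?ltr0n// expr1; apply: (le_trans main).
have TE : T%:R = T%:R `^ (1 / 3) * T%:R `^ (2 / 3) :> R.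
  rewrite -powRD; last by rewrite (gt_eqF T0') implybT.
  by rewrite (_ : 1 / 3 + 2 / 3 = 1 :> R) ?powRr1 ?(ltW T0')//; field.
have T23 : 0 < T%:R `^ (2 / 3) :> R by rewrite powR_gt0.
rewrite mulrCA ler_wpM2l//.
  by rewrite mulr_ge0 ?addr_ge0.
by rewrite mulrA mulr1 ler_pdivlMr// -TE ler_nat.
Qed.

End Rates.

(** * Algebra of the potential *)

Section PotentialStep.
Context {R : realType}.

(** One error term of the potential, divided by the step size [a]. With momentum
[b = (kappa + m) a^2], the share [kappa] pays for the growth of the weight from [wt]
to [1 / a], and the share [m] leaves the decrease [m * a * eps]. *)
Lemma storm_term (a b kappa m wt eps L2 dxy s2 : R) :
  0 < a -> b = (kappa + m) * a ^+ 2 -> 0 <= b <= 1 -> a^-1 <= wt + kappa * a ->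
  0 <= eps -> 0 <= L2 -> 0 <= dxy ->
  a^-1 * ((1 - b) ^+ 2 * eps + 2 * (1 - b) ^+ 2 * (L2 * dxy) + 2 * b ^+ 2 * s2) <=
  wt * eps - m * a * eps + a^-1 * (2 * L2 * dxy) + 2 * (kappa + m) ^+ 2 * s2 * a ^+ 3.
Proof.
move=> a0 bE /andP[b0 b1] wtE e0 L0 d0.
have b2 : (1 - b) ^+ 2 <= 1 - b by rewrite expr2 ler_piMr ?subr_ge0// lerBlDr lerDl.
have ia0 : 0 <= a^-1 by rewrite invr_ge0 ltW.
have t1 : a^-1 * ((1 - b) ^+ 2 * eps) <= wt * eps - m * a * eps.
  apply: (@le_trans _ _ (a^-1 * ((1 - b) * eps))); first by rewrite ler_wpM2l// ler_wpM2r.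
  have -> : a^-1 * ((1 - b) * eps) = a^-1 * eps - (kappa + m) * a * eps.
    by rewrite bE; field; rewrite gt_eqF.
  have : a^-1 * eps <= (wt + kappa * a) * eps by rewrite ler_wpM2r.
  lra.
have t2 : a^-1 * (2 * (1 - b) ^+ 2 * (L2 * dxy)) <= a^-1 * (2 * L2 * dxy).
  rewrite ler_wpM2l// -[2 * L2 * dxy]mulrA ler_wpM2r ?mulr_ge0//.
  by rewrite -[leRHS]mulr1 ler_wpM2l// (le_trans b2)// lerBlDr lerDl.
have t3 : a^-1 * (2 * b ^+ 2 * s2) = 2 * (kappa + m) ^+ 2 * s2 * a ^+ 3.
  by rewrite bE; field; rewrite gt_eqF.
rewrite !mulrDr t3; lra.
Qed.

Section Tracking.
Variables (n : nat) (a tau lambda Lg : R) (e G w : 'cV[R]_n).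
Hypotheses (a_gt0 : 0 < a) (a_le1 : a <= 1) (tau_gt0 : 0 < tau)
  (lambda_gt0 : 0 < lambda) (lambda_le : lambda <= Lg) (tau_le : tau <= 1 / (3 * Lg))
  (G_mono : lambda / 2 * fdot e e + fdot G G / (2 * Lg) <= fdot G e).

(** Strong monotonicity pays for the contraction with one half of its strength, and
cocoercivity for the term [- |w|^2]; the inexactness [w - G] enters by Young's
inequality. *)
Lemma inexact_gradient_step :
  fdot (e - (a * tau) *: w) (e - (a * tau) *: w) <=
  (1 - a * tau * lambda / 2) * fdot e e - a / 2 * tau ^+ 2 * fdot w w
  + 3 * (a * tau / lambda) * fdot (w - G) (w - G).
Proof.
have Lg_gt0 : 0 < Lg by exact: lt_le_trans lambda_le.
have h1 : lambda / 2 * fdot e e + 3 / 2 * tau * fdot G G <= fdot G e.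
  apply: le_trans G_mono; rewrite lerD2l [leRHS]mulrC ler_wpM2r ?fdotAA_ge0//.
  have -> : (2 * Lg)^-1 = 3 / 2 * (1 / (3 * Lg)) by field; rewrite gt_eqF.
  by rewrite ler_wpM2l.
have h2 : 0 <= lambda / 2 * fdot e e + 2 * fdot e (w - G) + 2 / lambda * fdot (w - G) (w - G).
  have := fdotAA_ge0 ((lambda / 2) *: e + (w - G)).
  rewrite -(pmulr_rge0 _ (ltac:(by rewrite divr_gt0) : 0 < 2 / lambda)).
  move: (w - G) => r; rewrite !(fdotDl, fdotDr, fdotZl, fdotZr) (fdotC r e) => h.
  apply: (le_trans h); rewrite le_eqVlt; apply/orP; left; apply/eqP; field.
  by rewrite gt_eqF.
have h3 : fdot w w <= 2 * fdot G G + 2 * fdot (w - G) (w - G).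
  have := fdotAA_ge0 (w - G - G).
  rewrite !(fdotBl, fdotBr) (fdotC G w); lra.
have t3 : 3 * tau <= lambda^-1.
  apply: (@le_trans _ _ Lg^-1); last by rewrite lef_pV2 ?posrE.
  apply: (le_trans (ler_wpM2l _ tau_le)) => //.
  by rewrite le_eqVlt; apply/orP; left; apply/eqP; field; rewrite gt_eqF.
have ww0 := fdotAA_ge0 w.
have at0 : 0 < a * tau by rewrite mulr_gt0.
have k1 : 0 <= (a * tau) * (2 * (fdot G e - (lambda / 2 * fdot e e + 3 / 2 * tau * fdot G G))).
  by rewrite mulr_ge0 ?(ltW at0)// mulr_ge0// subr_ge0.
have k2 := mulr_ge0 (ltW at0) h2.
have k3 : 0 <= (3 / 2 * (a * tau) * tau) * (2 * fdot G G + 2 * fdot (w - G) (w - G) - fdot w w).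
  by rewrite mulr_ge0 ?subr_ge0// !mulr_ge0 ?(ltW a_gt0) ?(ltW tau_gt0).
have k4 : 0 <= (a * tau) * ((lambda^-1 - 3 * tau) * fdot (w - G) (w - G)).
  by rewrite mulr_ge0 ?(ltW at0)// mulr_ge0 ?subr_ge0 ?fdotAA_ge0.
have k5 : 0 <= a * (1 - a) * (tau ^+ 2 * fdot w w).
  by rewrite (mulr_ge0 (mulr_ge0 (ltW a_gt0) _) (mulr_ge0 (sqr_ge0 _) ww0))// subr_ge0.
have Ee : fdot e (w - G) = fdot e w - fdot G e by rewrite fdotBr (fdotC G).
have -> : fdot (e - (a * tau) *: w) (e - (a * tau) *: w) =
    fdot e e - 2 * (a * tau) * fdot e w + (a * tau) ^+ 2 * fdot w w.
  by rewrite !(fdotBl, fdotBr, fdotZl, fdotZr) (fdotC w e); ring.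
rewrite Ee in k2.
move: (fdot (w - G) (w - G)) (fdot w w) (fdot G G) (fdot e e) (fdot G e) (fdot e w) k1 k2 k3 k4 k5 => rr ww GG ee Ge ew.
lra.
Qed.

(** Young's inequality with weight [a * tau * lambda / 4]: half of the contraction
absorbs the motion [D] of the target. *)
Lemma tracking_step (D : 'cV[R]_n) :
  fdot (e - (a * tau) *: w + D) (e - (a * tau) *: w + D) <=
  (1 - a * tau * lambda / 4) * fdot e e - a / 2 * tau ^+ 2 * fdot w w
  + 8 * (a * tau / lambda) * fdot (w - G) (w - G) + 8 / (a * tau * lambda) * fdot D D.
Proof.
have Lg_gt0 : 0 < Lg by exact: lt_le_trans lambda_le.
pose p := a * tau * lambda / 4.
have p0 : 0 < p by rewrite /p !mulr_gt0// invr_gt0.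
have p1 : p <= 1.
  have tl : tau * lambda <= 1.
    apply: (@le_trans _ _ (1 / (3 * Lg) * Lg)).
      by apply: ler_pM => //; exact: ltW.
    have -> : 1 / (3 * Lg) * Lg = 1 / 3 by field; rewrite gt_eqF.
    by lra.
  have : a * (tau * lambda) <= 1 * 1 by apply: ler_pM => //; rewrite ?mulr_ge0// ltW.
  by rewrite /p mulrA; lra.
apply: (le_trans (fdotAAD_le _ _ p0)).
have s1 := inexact_gradient_step.
have ee0 := fdotAA_ge0 e; have ww0 := fdotAA_ge0 w; have rr0 := fdotAA_ge0 (w - G).
have DD0 := fdotAA_ge0 D.
have {}s1 := ler_wpM2l (ltac:(by rewrite addr_ge0// ltW) : 0 <= 1 + p) s1.
have s2 : (1 + p^-1) * fdot D D <= 8 / (a * tau * lambda) * fdot D D.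
  rewrite ler_wpM2r//.
  have -> : 8 / (a * tau * lambda) = 2 * p^-1 by rewrite /p; field; rewrite !gt_eqF.
  have : 1 <= p^-1 by rewrite invf_ge1.
  by move: (p^-1) => q; lra.
have k1 : 0 <= p ^+ 2 * fdot e e by rewrite mulr_ge0 ?sqr_ge0.
have k2 : 0 <= p * (a / 2 * tau ^+ 2 * fdot w w).
  by rewrite mulr_ge0 ?(ltW p0)// mulr_ge0// mulr_ge0 ?sqr_ge0// divr_ge0// ltW.
have k3 : 0 <= (5 - 3 * p) * (a * tau / lambda * fdot (w - G) (w - G)).
  rewrite mulr_ge0//; first by lra.
  by rewrite !mulr_ge0 ?invr_ge0 ?(ltW a_gt0) ?(ltW tau_gt0) ?(ltW lambda_gt0).
have E2 : a * tau * lambda / 2 = 2 * p by rewrite /p; field.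
rewrite E2 in s1; rewrite -/p.
move: (a * tau / lambda) (a / 2 * tau ^+ 2) s1 k2 k3 => x1 x2 s1 k2 k3.
apply: (le_trans (lerD s1 s2)); rewrite lerD2r; clear s1 s2.
lra.
Qed.

End Tracking.

(** The constants balance as follows: [C0] against the contraction of [D], the bound
[4 calL <= C gamma] for the [y]-steps [W], and for the [x]-steps [Z] the budget
[1/4 + 1/8 + 1/8 = 1/2]. *)
Lemma potential_decrease (a gamma tau lambda LF Ly C calL C0 C1 C2 C3 C4 : R)
    (F F' g N Z W D D' eu ev eV eH ew : R) :
  0 < a -> 0 < gamma -> 0 < tau -> 0 < lambda -> 0 <= C -> 
  LF * a * gamma <= 1 / 2 -> 4 * C0 <= C * (tau * lambda) -> 4 * calL <= C * gamma ->
  16 * calL * gamma <= 1 -> 64 * C * gamma ^+ 2 * Ly ^+ 2 <= tau * lambda ->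
  0 <= Z -> 0 <= W -> 0 <= D ->
  F' <= F - a * gamma / 2 * g + a * gamma / 2 * N - (a * gamma / 2 - LF / 2 * (a * gamma) ^+ 2) * Z ->
  N <= 2 * (C0 * D + C1 * eu + C2 * eV + C3 * eH + C4 * ev) ->
  D' <= (1 - a * tau * lambda / 4) * D - a / 2 * tau ^+ 2 * W + 8 * (a * tau / lambda) * ew
        + 8 / (a * tau * lambda) * (Ly ^+ 2 * ((a * gamma) ^+ 2 * Z)) ->
  F' + C * gamma * D' + a * gamma / 2 * g
    - a * (C1 * gamma * eu + C4 * gamma * ev + C2 * gamma * eV + C3 * gamma * eH
           + 8 * C * gamma * tau / lambda * ew)
    + a^-1 * (2 * calL * ((a * gamma) ^+ 2 * Z + (a * tau) ^+ 2 * W))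
  <= F + C * gamma * D.
Proof.
move=> a0 g0 t0 l0 C_ge0 hLF hC0 hCL hL hLy Z0 W0 D0 hF hN hD.
have ag0 : 0 < a * gamma by rewrite mulr_gt0.
have Cg0 : 0 <= C * gamma by rewrite mulr_ge0// ltW.
have k1 := ler_wpM2l (ltW ag0) hN.
have k2 := ler_wpM2l Cg0 hD.
have q0 : 0 <= a * gamma * Z by rewrite mulr_ge0// ltW.
have k3 : 0 <= (1 / 2 - LF * a * gamma) * (a * gamma * Z) by rewrite mulr_ge0// subr_ge0.
have k4 : 0 <= (1 - 16 * calL * gamma) * (a * gamma * Z) by rewrite mulr_ge0// subr_ge0.
have k5 : C * gamma * (8 / (a * tau * lambda) * (Ly ^+ 2 * ((a * gamma) ^+ 2 * Z)))
    <= 1 / 8 * (a * gamma * Z).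
  have -> : C * gamma * (8 / (a * tau * lambda) * (Ly ^+ 2 * ((a * gamma) ^+ 2 * Z))) =
    (64 * C * gamma ^+ 2 * Ly ^+ 2) / (tau * lambda) / 8 * (a * gamma * Z).
    by field; rewrite !gt_eqF.
  rewrite ler_wpM2r// ler_pM2r ?invr_gt0// ler_pdivrMr ?mul1r// mulr_gt0//.
have k6 : 0 <= (C * gamma - 4 * calL) * (a * tau ^+ 2 * W).
  by rewrite mulr_ge0 ?subr_ge0// mulr_ge0// mulr_ge0 ?sqr_ge0// ltW.
have k7 : 0 <= (C * (tau * lambda) - 4 * C0) * (a * gamma * D).
  by rewrite mulr_ge0 ?subr_ge0// mulr_ge0// ltW.
have E1 : a^-1 * (2 * calL * ((a * gamma) ^+ 2 * Z + (a * tau) ^+ 2 * W)) =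
    2 * calL * gamma * (a * gamma * Z) + 2 * calL * (a * tau ^+ 2 * W).
  by field; rewrite gt_eqF.
rewrite E1; move: k2 k5.
have -> : 8 * C * gamma * tau / lambda * ew = C * gamma * (8 * (tau / lambda * ew)) by ring.
have -> : 8 * (a * tau / lambda) * ew = a * (8 * (tau / lambda * ew)) by ring.
move: (8 / _ * _) (8 * (tau / lambda * ew)) => x1 x2 k2 k5.
lra.
Qed.

End PotentialStep.

(** * Integrals of nonnegative functions *)

Section NonnegIntegrals.
Context {R : realType} {dO : measure_display} {Omega : measurableType dO}.
Variable P : probability Omega R.
Local Open Scope classical_set_scope.
Implicit Types p q h : Omega -> R.

Definition ge0_measurable h : Prop := measurable_fun setT h /\ forall o, 0 <= h o.

Lemma ge0_measurableD p q : ge0_measurable p -> ge0_measurable q ->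
  ge0_measurable (fun o => p o + q o).
Proof.
move=> [mp p0] [mq q0]; split; first exact: measurable_funD.
by move=> o; rewrite addr_ge0.
Qed.

Lemma ge0_measurableZ k p : 0 <= k -> ge0_measurable p -> ge0_measurable (fun o => k * p o).
Proof.
move=> k0 [mp p0]; split; first exact: measurable_funM (measurable_cst _) mp.
by move=> o; rewrite mulr_ge0.
Qed.

Lemma ge0_measurable_cst k : 0 <= k -> ge0_measurable (fun=> k).
Proof. by move=> k0; split => //; exact: measurable_cst. Qed.

Lemma integralDr p q : ge0_measurable p -> ge0_measurable q ->
  (\int[P]_o (p o + q o)%:E = \int[P]_o (p o)%:E + \int[P]_o (q o)%:E)%E.
Proof.
move=> [mp p0] [mq q0].
transitivity (\int[P]_o ((p o)%:E + (q o)%:E))%E; first exact: eq_integral.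
by apply: ge0_integralD => //;
  [move=> o _; rewrite lee_fin|exact/measurable_EFinP|move=> o _; rewrite lee_fin|exact/measurable_EFinP].
Qed.

Lemma integralZr k p : 0 <= k -> ge0_measurable p ->
  (\int[P]_o (k * p o)%:E = k%:E * \int[P]_o (p o)%:E)%E.
Proof.
move=> k0 [mp p0].
transitivity (\int[P]_o (k%:E * (p o)%:E))%E; first exact: eq_integral.
by apply: ge0_integralZl_EFin => //; [move=> o _; rewrite lee_fin|exact/measurable_EFinP].
Qed.

Lemma integral_cstr k : (\int[P]_o k%:E = k%:E)%E.
Proof.
transitivity (k%:E * P setT)%E; first exact: integral_cst.
by rewrite probability_setT mule1.
Qed.

Lemma integral_ger0 p : (forall o, 0 <= p o) -> (0 <= \int[P]_o (p o)%:E)%E.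
Proof. by move=> p0; apply: integral_ge0 => o _; rewrite lee_fin. Qed.

Lemma le_integralr p q : ge0_measurable p -> ge0_measurable q -> (forall o, p o <= q o) ->
  (\int[P]_o (p o)%:E <= \int[P]_o (q o)%:E)%E.
Proof.
move=> [mp p0] [mq q0] pq; apply: ge0_le_integral => //;
  [move=> o _; rewrite lee_fin//|exact/measurable_EFinP|exact/measurable_EFinP|].
by move=> o _; rewrite lee_fin.
Qed.

Lemma integral_leD p q p' q' : ge0_measurable p -> ge0_measurable q ->
  ge0_measurable p' -> ge0_measurable q' ->
  (\int[P]_o (p o)%:E <= \int[P]_o (q o)%:E)%E ->
  (\int[P]_o (p' o)%:E <= \int[P]_o (q' o)%:E)%E ->
  (\int[P]_o (p o + p' o)%:E <= \int[P]_o (q o + q' o)%:E)%E.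
Proof. by move=> mp mq mp' mq' h h'; rewrite !integralDr// leeD. Qed.

Lemma integral_leZ k p q : 0 <= k -> ge0_measurable p -> ge0_measurable q ->
  (\int[P]_o (p o)%:E <= \int[P]_o (q o)%:E)%E ->
  (\int[P]_o (k * p o)%:E <= \int[P]_o (k * q o)%:E)%E.
Proof. by move=> k0 mp mq h; rewrite !integralZr// lee_wpmul2l// lee_fin. Qed.

Lemma integral_sumr (I : Type) (s : seq I) (h : I -> Omega -> R) :
  (forall i, ge0_measurable (h i)) ->
  (\int[P]_o (\sum_(i <- s) h i o)%:E = \sum_(i <- s) \int[P]_o (h i o)%:E)%E.
Proof.
move=> hm; transitivity (\int[P]_o (\sum_(i <- s) (h i o)%:E))%E.
  by apply: eq_integral => o _; rewrite sumEFin.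
apply: ge0_integral_sum => // i; first by apply/measurable_EFinP; case: (hm i).
by move=> o _; rewrite lee_fin; case: (hm i).
Qed.

End NonnegIntegrals.

Lemma has_grad_continuous {R : realType} n (h : 'cV[R]_n -> R) :
  (forall x, has_grad h x (grad h x)) -> continuous_eps h.
Proof.
move=> hg p e e0; have [r [r0 hr]] := hg p 1 ltr01.
have G1 : 0 < frob (grad h p) + 1 by rewrite ltr_wpDl// frob_ge0.
exists (Num.min r (e / (frob (grad h p) + 1))); split; first by rewrite lt_min r0 divr_gt0.
move=> q; rewrite lt_min => /andP[qr]; rewrite ltr_pdivlMr// => h2.
have := hr _ qr; rewrite (_ : p + (q - p) = q); last by rewrite addrC subrK.
rewrite mul1r => h1.
rewrite -[h q - h p](subrK (fdot (grad h p) (q - p))) (le_trans (ler_normD _ _))//.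
apply: le_trans (ltW h2); rewrite mulrDr mulr1 addrC lerD// mulrC.
exact: normr_fdot_le.
Qed.

Lemma mx_measurable_lip {R : realType} {dT : measure_display} {T : measurableType dT} n m
    (h : 'cV[R]_n -> 'cV[R]_m) (X : T -> 'cV[R]_n) L :
  (forall p q, frob (h p - h q) <= L * frob (p - q)) ->
  mx_measurable X -> mx_measurable (fun t => h (X t)).
Proof.
move=> hL mX i j.
apply: (measurable_continuous_comp (h := fun p => h p i j) mX) => p e e0.
have L1 : 0 < `|L| + 1 by rewrite ltr_wpDl.
exists (e / (`|L| + 1)); split; first by rewrite divr_gt0.
move=> q; rewrite ltr_pdivlMr// => qp.
have := entry_le (h q - h p) i j; rewrite !mxE => /le_trans; apply.
apply: (le_trans (hL _ _)); apply: le_trans (ltW qp); rewrite mulrC ler_wpM2l ?frob_ge0//.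
by rewrite (le_trans (ler_norm _))// lerDl.
Qed.

(** * The run of the algorithm *)

Section ProjectionMeasurable.
Context {R : realType} {dT : measure_display} {T : measurableType dT}.
Local Open Scope classical_set_scope.

Lemma mx_measurable_proj m n (S : set 'M[R]_(m, n)) (X : T -> 'M[R]_(m, n)) :
  convex_mx S -> closed_mx S -> S !=set0 ->
  mx_measurable X -> mx_measurable (fun t => Defs.proj S (X t)).
Proof.
move=> Scvx Scl Sne mX i j.
apply: (measurable_continuous_comp (h := fun p => Defs.proj S p i j) mX) => p e e0.
exists e; split=> // q qp.
have := entry_le (Defs.proj S q - Defs.proj S p) i j; rewrite !mxE => /le_trans; apply.
by apply: (le_trans (frob_proj_proj Scvx Scl Sne _ _)); exact: ltW.
Qed.

Lemma ball_neq0 n (r : R) : 0 <= r -> [set u : 'cV[R]_n | frob u <= r] !=set0.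
Proof. by move=> r0; exists 0; rewrite /= frob0. Qed.

Lemma spec_neq0 m n (r : R) : 0 <= r -> [set X : 'M[R]_(m, n) | specnorm X <= r] !=set0.
Proof.
move=> r0; exists 0 => /=; apply: specnorm_le => // v.
by rewrite mul0mx frob0 mulr_ge0 ?frob_ge0.
Qed.

Lemma loewner_ge_neq0 n (a : R) : [set X : 'M[R]_n | loewner_le a%:M X] !=set0.
Proof.
exists a%:M => /=; apply: loewner_geP; first exact: tr_scalar_mx.
by move=> v; rewrite fdot_scalar_mx.
Qed.

Lemma proj_loewner_geP n (a : R) (X : 'M[R]_n) : loewner_le a%:M (proj_loewner_ge a X).
Proof.
by have [] := projP (@convex_loewner_ge R n a) (@closed_loewner_ge R n a) (loewner_ge_neq0 n a) X.
Qed.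

(** On matrices above [lambda I] inversion is Lipschitz. *)
Lemma mx_measurable_invmx_proj n (lambda : R) (X : T -> 'M[R]_n) : 0 < lambda ->
  mx_measurable X -> mx_measurable (fun t => invmx (proj_loewner_ge lambda (X t))).
Proof.
move=> l0 mX i j.
apply: (measurable_continuous_comp (h := fun p => invmx (proj_loewner_ge lambda p) i j) mX) => p e e0.
have l2 : 0 < lambda ^+ 2 by rewrite exprn_gt0.
exists (e * lambda ^+ 2); split; first by rewrite mulr_gt0.
move=> q qp.
have := entry_le ((invmx (proj_loewner_ge lambda q) - invmx (proj_loewner_ge lambda p)) *m (delta_mx j 0 : 'cV[R]_n)) i 0.
rewrite -colE !mxE => /le_trans; apply; rewrite colE.
apply: (le_trans (frob_invmxB_mul l0 _ (proj_loewner_geP _ _) (proj_loewner_geP _ _))).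
have -> : frob (delta_mx j 0 : 'cV[R]_n) = 1.
  apply/eqP; rewrite -(eqrXn2 (n := 2)) ?frob_ge0// sqr_frob fdot_delta mxE !eqxx expr1n//.
rewrite mulr1 exprVn mulrC ler_pdivrMr//; apply: le_trans (ltW qp).
exact: (frob_proj_proj (@convex_loewner_ge R n lambda) (@closed_loewner_ge R n lambda) (loewner_ge_neq0 n lambda)).
Qed.

End ProjectionMeasurable.

Section Run.
Context {R : realType} {d d' : nat} {dX dZ dO : measure_display} {Xi : measurableType dX}
  {Zeta : measurableType dZ} {Omega : measurableType dO}.
Variables (PXi : probability Xi R) (PZeta : probability Zeta R).
Variables (f g : 'cV[R]_d -> 'cV[R]_d' -> R)
  (fs : 'cV[R]_d -> 'cV[R]_d' -> Xi -> R) (gs : 'cV[R]_d -> 'cV[R]_d' -> Zeta -> R).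
Variables (Lfx Lfy Lgy Lgxy Lgyy sigma Cfy Cgxy Delta lambda gamma tau : R).
Variables (F : 'cV[R]_d -> R) (x0 xstar : 'cV[R]_d).
Hypotheses (hP : stochastic_problem PXi PZeta f g fs gs)
  (hB : assumption_B PXi PZeta f g fs gs Lfx Lfy Lgy Lgxy Lgyy sigma
          Cfy Cgxy Delta F x0 xstar) (lambda_gt0 : 0 < lambda).
Variables (xi : nat -> {mfun Omega >-> Xi}) (zeta : nat -> {mfun Omega >-> Zeta}).
Variables (eta taus bfx bfy bgxy bgyy bgy : nat -> R).
Variables (y0 : 'cV[R]_d') (u0 : 'cV[R]_d) (v0 : 'cV[R]_d')
  (V0 : 'M[R]_(d, d')) (H0 : 'M[R]_d') (w0 : 'cV[R]_d')
  (x : nat -> Omega -> 'cV[R]_d) (y : nat -> Omega -> 'cV[R]_d')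
  (u : nat -> Omega -> 'cV[R]_d) (v : nat -> Omega -> 'cV[R]_d')
  (V : nat -> Omega -> 'M[R]_(d, d')) (H : nat -> Omega -> 'M[R]_d')
  (w : nat -> Omega -> 'cV[R]_d') (z : nat -> Omega -> 'cV[R]_d).
Hypothesis hrun : svrb fs gs xi zeta Cfy Cgxy lambda gamma tau eta taus
  bfx bfy bgxy bgyy bgy x0 y0 u0 v0 V0 H0 w0 x y u v V H w z.

Definition adapted m n t (X : Omega -> 'M[R]_(m, n)) : Prop :=
  @mx_measurable R _ (past xi zeta t) m n X.

Record adapted_state (t : nat) : Prop := {
  adapted_x : adapted t (x t);
  adapted_y : adapted t (y t);
  adapted_xp : adapted t (x t.-1);
  adapted_yp : adapted t (y t.-1);
  adapted_u : adapted t (u t);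
  adapted_v : adapted t (v t);
  adapted_V : adapted t (V t);
  adapted_H : adapted t (H t);
  adapted_w : adapted t (w t)
}.

Lemma adapted_oracle m n dS (S : measurableType dS) (PS : probability S R)
    (Gm : 'cV[R]_d -> 'cV[R]_d' -> 'M[R]_(m, n))
    (Gs : S -> 'cV[R]_d -> 'cV[R]_d' -> 'M[R]_(m, n)) L (X : Omega -> S)
    t (x1 : Omega -> 'cV[R]_d) (y1 : Omega -> 'cV[R]_d') :
  unbiased PS Gm Gs -> (forall s, lipschitz_xy (Gs s) L) ->
  measurable_fun setT (X : past xi zeta t -> S) ->
  adapted t x1 -> adapted t y1 -> adapted t (fun o => Gs (X o) (x1 o) (y1 o)).
Proof.
move=> Gmean Glip mX mx my i j.
have mp : measurable_fun setT (fun o : past xi zeta t => (o, X o)).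
  exact: measurable_fun_pair.
exact: (measurableT_comp (mx_measurable_oracle Gmean Glip mx my i j) mp).
Qed.

(** The new state is a continuous function of the old one and of the sample
derivatives, and the latter are jointly measurable. *)
Lemma adapted_stateP t : adapted_state t.
Proof.
elim: t => [|t [mx my mxp myp mu mv mV mH mw]].
  have cstE m n (X : Omega -> 'M[R]_(m, n)) A : (forall o, X o = A) -> adapted 0%N X.
    by move=> XA; rewrite (_ : X = fun=> A); [exact: mx_measurable_cst | exact/funext].
  case: hrun => *; split; exact: cstE.
have {}mx := mx_measurable_lift mx; have {}my := mx_measurable_lift my.
have {}mxp := mx_measurable_lift mxp; have {}myp := mx_measurable_lift myp.
have {}mu := mx_measurable_lift mu; have {}mv := mx_measurable_lift mv.
have {}mV := mx_measurable_lift mV; have {}mH := mx_measurable_lift mH.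
have {}mw := mx_measurable_lift mw.
have mxi := @measurable_xi _ _ _ _ _ _ xi zeta t.
have mzeta := @measurable_zeta _ _ _ _ _ _ xi zeta t.
have step m n (X Gp G : Omega -> 'M[R]_(m, n)) b : adapted t.+1 X -> adapted t.+1 Gp ->
    adapted t.+1 G -> adapted t.+1 (fun o => (1 - b) *: (X o - Gp o) + G o).
  move=> mX mGp mG; apply: mx_measurableD => //; apply: mx_measurableZ.
  exact: mx_measurableB.
have ofx x1 y1 := @adapted_oracle _ _ _ _ _ _ _ _ _ t.+1 x1 y1 (sp_unbiased_fx hP) (aB_lip_fx hB) mxi.
have ofy x1 y1 := @adapted_oracle _ _ _ _ _ _ _ _ _ t.+1 x1 y1 (sp_unbiased_fy hP) (aB_lip_fy hB) mxi.
have ogy x1 y1 := @adapted_oracle _ _ _ _ _ _ _ _ _ t.+1 x1 y1 (sp_unbiased_gy hP) (aB_lip_gy hB) mzeta.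
have ogxy x1 y1 := @adapted_oracle _ _ _ _ _ _ _ _ _ t.+1 x1 y1 (sp_unbiased_gxy hP) (aB_lip_gxy hB) mzeta.
have ogyy x1 y1 := @adapted_oracle _ _ _ _ _ _ _ _ _ t.+1 x1 y1 (sp_unbiased_gyy hP) (aB_lip_gyy hB) mzeta.
have Cf := aB_Cfy_ge0 hB; have Cg := aB_Cgxy_ge0 hB.
have mu1 : adapted t.+1 (u t.+1).
  rewrite (funext (svrb_u hrun t)); apply: step => //; exact: ofx.
have mv1 : adapted t.+1 (v t.+1).
  rewrite (funext (svrb_v hrun t)); apply: mx_measurable_proj;
    [exact: convex_frob_ball|exact: closed_frob_ball|exact: ball_neq0|].
  by apply: step => //; exact: ofy.
have mV1 : adapted t.+1 (V t.+1).
  rewrite (funext (svrb_V hrun t)); apply: mx_measurable_proj;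
    [exact: convex_spec|exact: closed_spec|exact: spec_neq0|].
  by apply: step => //; exact: ogxy.
have mH1 : adapted t.+1 (H t.+1).
  rewrite (funext (svrb_H hrun t)); apply: mx_measurable_proj;
    [exact: convex_loewner_ge|exact: closed_loewner_ge|exact: loewner_ge_neq0|].
  by apply: step => //; exact: ogyy.
have mHi : adapted t.+1 (fun o => invmx (H t.+1 o)).
  under eq_fun do rewrite (svrb_H hrun t).
  by apply: mx_measurable_invmx_proj => //; apply: step => //; exact: ogyy.
have mw1 : adapted t.+1 (w t.+1).
  rewrite (funext (svrb_w hrun t)); apply: step => //; exact: ogy.
have mz1 : adapted t.+1 (z t.+1).
  rewrite (funext (svrb_z hrun t)); apply: mx_measurableB => //.
  by apply: mx_measurableM => //; exact: mx_measurableM.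
split=> //.
  by rewrite (funext (svrb_x hrun t)); apply: mx_measurableB => //; exact: mx_measurableZ.
by rewrite (funext (svrb_y hrun t)); apply: mx_measurableB => //; exact: mx_measurableZ.
Qed.

Lemma v_bounded t o : frob (v t.+1 o) <= Cfy.
Proof.
rewrite (svrb_v hrun); have Cf := aB_Cfy_ge0 hB.
by have [] := projP (@convex_frob_ball R d' Cfy) (@closed_frob_ball R d' Cfy) (ball_neq0 d' Cf)
  ((1 - bfy t) *: (v t o - grady (at_sample fs (xi t o)) (x t.-1 o) (y t.-1 o))
       + grady (at_sample fs (xi t o)) (x t o) (y t o)).
Qed.

Lemma H_ge t o : loewner_le lambda%:M (H t.+1 o).
Proof. by rewrite (svrb_H hrun); exact: proj_loewner_geP. Qed.

Definition err_u t o := frob (u t o - gradx f (x t.-1 o) (y t.-1 o)) ^+ 2.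
Definition err_v t o := frob (v t o - grady f (x t.-1 o) (y t.-1 o)) ^+ 2.
Definition err_V t o := frob (V t o - hessxy g (x t.-1 o) (y t.-1 o)) ^+ 2.
Definition err_H t o := frob (H t o - hessyy g (x t.-1 o) (y t.-1 o)) ^+ 2.
Definition err_w t o := frob (w t o - grady g (x t.-1 o) (y t.-1 o)) ^+ 2.
Definition motion t o := frob (x t o - x t.-1 o) ^+ 2 + frob (y t o - y t.-1 o) ^+ 2.

(** The bound on the mean of the next error given the past. *)
Definition storm_bound (b L eps dxy : R) : R :=
  (1 - b) ^+ 2 * eps + 2 * (1 - b) ^+ 2 * (L ^+ 2 * dxy) + 2 * b ^+ 2 * sigma ^+ 2.

Lemma motion_ge0 t o : 0 <= motion t o.
Proof. by rewrite addr_ge0// sqr_ge0. Qed.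

Variable P : probability Omega R.
Hypothesis hsamples : fresh_samples PXi PZeta P xi zeta.

Lemma adapted_measurable m n t (X : Omega -> 'M[R]_(m, n)) :
  adapted t X -> mx_measurable X.
Proof.
move=> mX i j.
exact: (measurable_fun_past (@past_events_measurable _ _ _ _ _ _ xi zeta t) (mX i j)).
Qed.

Lemma measurable_error m n dS (S : measurableType dS) (PS : probability S R)
    (Gm : 'cV[R]_d -> 'cV[R]_d' -> 'M[R]_(m, n))
    (Gs : S -> 'cV[R]_d -> 'cV[R]_d' -> 'M[R]_(m, n)) L t s (U : Omega -> 'M[R]_(m, n))
    (x1 : Omega -> 'cV[R]_d) (y1 : Omega -> 'cV[R]_d') :
  unbiased PS Gm Gs -> (forall s, lipschitz_xy (Gs s) L) ->
  adapted s U -> adapted t x1 -> adapted t y1 ->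
  measurable_fun setT (fun o => frob (U o - Gm (x1 o) (y1 o)) ^+ 2).
Proof.
move=> Gmean Glip mU mx my; apply/measurable_sqr_frob/mx_measurableB.
  exact: adapted_measurable mU.
apply: (mx_measurable_lipschitz (mean_lipschitz_xy Gmean Glip)).
  exact: adapted_measurable mx.
exact: adapted_measurable my.
Qed.

(** One recursion for the five estimates. [UU] covers both the plain updates, where it is
an equality, and the projected ones, where it is nonexpansiveness. *)
Lemma error_step m n dS (S : measurableType dS) (PS : probability S R)
    (Gm : 'cV[R]_d -> 'cV[R]_d' -> 'M[R]_(m, n))
    (Gs : S -> 'cV[R]_d -> 'cV[R]_d' -> 'M[R]_(m, n)) L (X : {mfun Omega >-> S})
    t b (U : nat -> Omega -> 'M[R]_(m, n)) :
  unbiased PS Gm Gs -> (forall s, lipschitz_xy (Gs s) L) -> variance_bounded PS Gs sigma ->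
  (forall A B, past_events xi zeta t A -> measurable B ->
     P (A `&` X @^-1` B)%classic = (P A * PS B)%E) ->
  measurable_fun setT (X : past xi zeta t.+1 -> S) ->
  adapted t (U t) -> adapted t.+1 (U t.+1) ->
  (forall o, frob (U t.+1 o - Gm (x t o) (y t o)) <=
     frob ((1 - b) *: (U t o - Gs (X o) (x t.-1 o) (y t.-1 o)) + Gs (X o) (x t o) (y t o)
           - Gm (x t o) (y t o))) ->
  (\int[P]_o (frob (U t.+1 o - Gm (x t o) (y t o)) ^+ 2)%:E <=
   \int[P]_o (storm_bound b L (frob (U t o - Gm (x t.-1 o) (y t.-1 o)) ^+ 2) (motion t o))%:E)%E.
Proof.
move=> Gmean Glip Gvar Xindep mX mU mU1 UU.
have [mx my mxp myp _ _ _ _ _] := adapted_stateP t.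
have := storm_expectation (@past_events_measurable _ _ _ _ _ _ xi zeta t)
  (@past_events_setI _ _ _ _ _ _ xi zeta t) (@past_events_setT _ _ _ _ _ _ xi zeta t)
  Xindep Gmean Glip Gvar b mx my mxp myp mU.
apply: le_trans; apply: ge0_le_integral => //.
- by move=> o _; rewrite lee_fin sqr_ge0.
- by apply/measurable_EFinP; exact: (measurable_error Gmean Glip mU1 mx my).
- apply/measurable_EFinP; apply/measurable_sqr_frob/mx_measurableB; last first.
    by apply: (mx_measurable_lipschitz (mean_lipschitz_xy Gmean Glip));
      [exact: adapted_measurable mx | exact: adapted_measurable my].
  have mG := adapted_oracle Gmean Glip mX.
  have mGx := mG _ _ (mx_measurable_lift mx) (mx_measurable_lift my).
  have mGxp := mG _ _ (mx_measurable_lift mxp) (mx_measurable_lift myp).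
  apply: mx_measurableD; last exact: adapted_measurable mGx.
  apply: mx_measurableZ; apply: mx_measurableB; first exact: adapted_measurable mU.
  exact: adapted_measurable mGxp.
- by move=> o _; rewrite lee_fin ler_sqr ?nnegrE ?frob_ge0.
Qed.

Lemma err_u_step t : (\int[P]_o (err_u t.+1 o)%:E <=
  \int[P]_o (storm_bound (bfx t) Lfx (err_u t o) (motion t o))%:E)%E.
Proof.
apply: (error_step (sp_unbiased_fx hP) (aB_lip_fx hB) (aB_var_fx hB)
  (@xi_indep _ _ _ _ _ _ _ _ _ _ _ _ hsamples t) (@measurable_xi _ _ _ _ _ _ xi zeta t)).
- by have [] := adapted_stateP t.
- by have [] := adapted_stateP t.+1.
- by move=> o; rewrite (svrb_u hrun).
Qed.

Lemma err_w_step t : (\int[P]_o (err_w t.+1 o)%:E <=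
  \int[P]_o (storm_bound (bgy t) Lgy (err_w t o) (motion t o))%:E)%E.
Proof.
apply: (error_step (sp_unbiased_gy hP) (aB_lip_gy hB) (aB_var_gy hB)
  (@zeta_indep _ _ _ _ _ _ _ _ _ _ _ _ hsamples t) (@measurable_zeta _ _ _ _ _ _ xi zeta t)).
- by have [] := adapted_stateP t.
- by have [] := adapted_stateP t.+1.
- by move=> o; rewrite (svrb_w hrun).
Qed.

Lemma err_v_step t : (\int[P]_o (err_v t.+1 o)%:E <=
  \int[P]_o (storm_bound (bfy t) Lfy (err_v t o) (motion t o))%:E)%E.
Proof.
apply: (error_step (sp_unbiased_fy hP) (aB_lip_fy hB) (aB_var_fy hB)
  (@xi_indep _ _ _ _ _ _ _ _ _ _ _ _ hsamples t) (@measurable_xi _ _ _ _ _ _ xi zeta t)).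
- by have [] := adapted_stateP t.
- by have [] := adapted_stateP t.+1.
move=> o; rewrite (svrb_v hrun); apply: frob_proj_le;
  [exact: convex_frob_ball|exact: closed_frob_ball|exact: (ball_neq0 _ (aB_Cfy_ge0 hB))|].
have := aB_bound_fy hB (x t o) (y t o).
by rewrite ler_sqr ?nnegrE ?frob_ge0 ?(aB_Cfy_ge0 hB).
Qed.

Lemma err_V_step t : (\int[P]_o (err_V t.+1 o)%:E <=
  \int[P]_o (storm_bound (bgxy t) Lgxy (err_V t o) (motion t o))%:E)%E.
Proof.
apply: (error_step (sp_unbiased_gxy hP) (aB_lip_gxy hB) (aB_var_gxy hB)
  (@zeta_indep _ _ _ _ _ _ _ _ _ _ _ _ hsamples t) (@measurable_zeta _ _ _ _ _ _ xi zeta t)).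
- by have [] := adapted_stateP t.
- by have [] := adapted_stateP t.+1.
have Cg := aB_Cgxy_ge0 hB.
move=> o; rewrite (svrb_V hrun); apply: frob_proj_le;
  [exact: convex_spec|exact: closed_spec|exact: spec_neq0|].
have := aB_bound_gxy hB (x t o) (y t o).
by rewrite ler_sqr ?nnegrE ?specnorm_ge0.
Qed.

Hypothesis g_convex : forall x y, loewner_le lambda%:M (hessyy g x y).

Lemma err_H_step t : (\int[P]_o (err_H t.+1 o)%:E <=
  \int[P]_o (storm_bound (bgyy t) Lgyy (err_H t o) (motion t o))%:E)%E.
Proof.
apply: (error_step (sp_unbiased_gyy hP) (aB_lip_gyy hB) (aB_var_gyy hB)
  (@zeta_indep _ _ _ _ _ _ _ _ _ _ _ _ hsamples t) (@measurable_zeta _ _ _ _ _ _ xi zeta t)).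
- by have [] := adapted_stateP t.
- by have [] := adapted_stateP t.+1.
move=> o; rewrite (svrb_H hrun); apply: frob_proj_le;
  [exact: convex_loewner_ge|exact: closed_loewner_ge|exact: loewner_ge_neq0|].
exact: g_convex.
Qed.

(** * One step of the algorithm for a fixed outcome *)

Variables (ystar : 'cV[R]_d -> 'cV[R]_d') (Lg LF Ly : R).
Hypotheses (ystar_argmin : forall x, is_argmin (g x) (ystar x))
  (F_def : forall x, F x = f x (ystar x))
  (g_smooth : forall x y, loewner_le (hessyy g x y) Lg%:M)
  (lambda_le : lambda <= Lg)
  (LF_gt0 : 0 < LF) (Ly_gt0 : 0 < Ly) (F_smooth : lipschitz_grad F LF)
  (ystar_lip : forall x x', frob (ystar x - ystar x') <= Ly * frob (x - x')).
Variables (calL C0 C1 C2 C3 C4 : R).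
Hypotheses
  (calLE : calL = Lgy ^+ 2 + Lfx ^+ 2 + Lfy ^+ 2 + Lgxy ^+ 2 + Lgyy ^+ 2)
  (C0E : C0 = 2 * Lfx ^+ 2
              + 6 * Cfy ^+ 2 * Lgxy ^+ 2 / lambda ^+ 2
              + 6 * Cfy ^+ 2 * Cgxy ^+ 2 * Lgyy ^+ 2 / lambda ^+ 4
              + 6 * Lfy ^+ 2 * Cgxy ^+ 2 / lambda ^+ 2)
  (C1E : C1 = 2)
  (C2E : C2 = 6 * Cfy ^+ 2 / lambda ^+ 2)
  (C3E : C3 = 6 * Cfy ^+ 2 * Cgxy ^+ 2 / lambda ^+ 4)
  (C4E : C4 = 6 * Cgxy ^+ 2 / lambda ^+ 2).

(** Insert [q] and [B] as intermediate points. *)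
Lemma sqr_frob_split n (p q r E B A : 'cV[R]_n) :
  frob (p - E - (r - A)) ^+ 2 <=
  4 * (frob (p - q) ^+ 2 + frob (E - B) ^+ 2 + frob (r - q) ^+ 2 + frob (A - B) ^+ 2).
Proof.
have -> : p - E - (r - A) = ((p - q) - (E - B)) + (- (r - q) + (A - B)).
  by apply/matrixP => i j; rewrite !mxE; ring.
have d0 := sqr_frobD_le (p - q - (E - B)) (- (r - q) + (A - B)).
have d1 := sqr_frobD_le (p - q) (- (E - B)); have d2 := sqr_frobD_le (- (r - q)) (A - B).
by rewrite !frobN in d1 d2; lra.
Qed.

Definition tracking_err t o := frob (y t o - ystar (x t o)) ^+ 2.
Definition sqr_grad t o := frob (grad F (x t o)) ^+ 2.

Lemma F_hypergradient x1 : has_grad F x1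
  (gradx f x1 (ystar x1) - hessxy g x1 (ystar x1) *m invmx (hessyy g x1 (ystar x1))
                         *m grady f x1 (ystar x1)).
Proof.
rewrite (funext F_def).
exact: (hypergradient lambda_gt0 Ly_gt0 (sp_f_diff hP) (sp_g_diff hP) ystar_argmin
  ystar_lip g_convex).
Qed.

Lemma F_has_grad x1 : has_grad F x1 (grad F x1).
Proof. by rewrite (has_grad_grad (F_hypergradient x1)); exact: F_hypergradient. Qed.

Lemma specnorm_hessxy_le x1 y1 : specnorm (hessxy g x1 y1) <= Cgxy.
Proof.
have := aB_bound_gxy hB x1 y1.
by rewrite ler_sqr ?nnegrE ?specnorm_ge0 ?(aB_Cgxy_ge0 hB).
Qed.

Lemma grady_le x1 y1 : frob (grady f x1 y1) <= Cfy.
Proof.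
have := aB_bound_fy hB x1 y1.
by rewrite ler_sqr ?nnegrE ?frob_ge0 ?(aB_Cfy_ge0 hB).
Qed.

Lemma mean_sqr_lipschitz_y m n dS (S : measurableType dS) (PS : probability S R)
    (Gm : 'cV[R]_d -> 'cV[R]_d' -> 'M[R]_(m, n)) Gs L x1 y1 y2 :
  unbiased PS Gm Gs -> (forall s, lipschitz_xy (Gs s) L) ->
  frob (Gm x1 y2 - Gm x1 y1) ^+ 2 <= L ^+ 2 * frob (y1 - y2) ^+ 2.
Proof.
move=> Gmean Glip; have := mean_sqr_lipschitz Gmean Glip x1 y2 x1 y1.
by rewrite subrr frob0 expr0n add0r (frobBC y2).
Qed.

(** The estimate [z] errs by replacing [ystar x] by [y] (the term in [C0]) and by
replacing the five derivatives by their running estimates. *)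
Lemma hypergradient_error t o :
  frob (grad F (x t o) - z t.+1 o) ^+ 2 <=
  2 * (C0 * tracking_err t o + C1 * err_u t.+1 o + C2 * err_V t.+1 o
       + C3 * err_H t.+1 o + C4 * err_v t.+1 o).
Proof.
rewrite (has_grad_grad (F_hypergradient (x t o))) (svrb_z hrun).
rewrite /tracking_err /err_u /err_V /err_H /err_v /=.
move: (x t o) (y t o) => X Y; set Ys := ystar X.
have Hl := H_ge t o; have vC := v_bounded t o.
move: (u t.+1 o) (v t.+1 o) (V t.+1 o) (H t.+1 o) Hl vC => un vn Vn Hn Hl vC.
have Cg := aB_Cgxy_ge0 hB.
have s1 := hypergradient_stable lambda_gt0 Vn (grady f X Y) Hl (g_convex X Y) vC Cg
  (specnorm_hessxy_le X Y).
have s2 := hypergradient_stable lambda_gt0 (hessxy g X Ys) (grady f X Y) (g_convex X Ys)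
  (g_convex X Y) (grady_le X Ys) Cg (specnorm_hessxy_le X Y).
have l1 := mean_sqr_lipschitz_y X Y Ys (sp_unbiased_fx hP) (aB_lip_fx hB).
have l2 := mean_sqr_lipschitz_y X Y Ys (sp_unbiased_fy hP) (aB_lip_fy hB).
have l3 := mean_sqr_lipschitz_y X Y Ys (sp_unbiased_gxy hP) (aB_lip_gxy hB).
have l4 := mean_sqr_lipschitz_y X Y Ys (sp_unbiased_gyy hP) (aB_lip_gyy hB).
have split := sqr_frob_split (gradx f X Ys) (gradx f X Y) un
  (hessxy g X Ys *m invmx (hessyy g X Ys) *m grady f X Ys)
  (hessxy g X Y *m invmx (hessyy g X Y) *m grady f X Y) (Vn *m invmx Hn *m vn).
apply: (le_trans split); clear split.
have k2 : 0 <= Cgxy ^+ 2 / lambda ^+ 2 by rewrite divr_ge0 ?sqr_ge0.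
have k3 : 0 <= Cfy ^+ 2 / lambda ^+ 2 by rewrite divr_ge0 ?sqr_ge0.
have k4 : 0 <= Cfy ^+ 2 * Cgxy ^+ 2 / lambda ^+ 4.
  by rewrite divr_ge0 ?exprn_ge0 ?(ltW lambda_gt0)// mulr_ge0 ?sqr_ge0.
have {}l2 := ler_wpM2l k2 l2; have {}l3 := ler_wpM2l k3 l3; have {}l4 := ler_wpM2l k4 l4.
rewrite C0E C1E C2E C3E C4E.
lra.
Qed.

Lemma F_descent t o : F (x t.+1 o) <= F (x t o)
  - eta t * gamma / 2 * sqr_grad t o
  + eta t * gamma / 2 * frob (grad F (x t o) - z t.+1 o) ^+ 2
  - (eta t * gamma / 2 - LF / 2 * (eta t * gamma) ^+ 2) * frob (z t.+1 o) ^+ 2.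
Proof.
have := smooth_descent F_has_grad F_smooth (x t o) (- ((eta t * gamma) *: z t.+1 o)).
rewrite -(svrb_x hrun) /sqr_grad !sqr_frob.
move: (F (x t.+1 o)) (F (x t o)) (grad F (x t o)) (z t.+1 o) => F1 F0 G Z.
rewrite !(fdotNl, fdotNr, fdotZl, fdotZr) !(fdotBl, fdotBr) (fdotC Z G).
move: (fdot G G) (fdot G Z) (fdot Z Z) => GG GZ ZZ; lra.
Qed.

Lemma motionE t o : taus t = eta t -> motion t.+1 o =
  (eta t * gamma) ^+ 2 * frob (z t.+1 o) ^+ 2 + (eta t * tau) ^+ 2 * frob (w t.+1 o) ^+ 2.
Proof.
move=> te; rewrite /motion /= (svrb_x hrun) (svrb_y hrun) te.
have E n (a b : 'cV[R]_n) r : frob (a - r *: b - a) ^+ 2 = r ^+ 2 * frob b ^+ 2.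
  rewrite !sqr_frob (_ : a - r *: b - a = - (r *: b)).
    by rewrite !(fdotNl, fdotNr, fdotZl, fdotZr); ring.
  by apply/matrixP => i j; rewrite !mxE; ring.
by rewrite !E.
Qed.

Lemma grady_monotone x1 y1 :
  lambda / 2 * fdot (y1 - ystar x1) (y1 - ystar x1)
  + fdot (grady g x1 y1) (grady g x1 y1) / (2 * Lg) <= fdot (grady g x1 y1) (y1 - ystar x1).
Proof.
have [gd ggd] := sp_g_diff hP.
apply: (strongly_convex_grad_ineq (Hs := hessyy g x1)) => //.
- by move=> y2; exact: differentiable_xy_has_grad.
- by move=> y2 p; exact: differentiable_grady_has_grad.
- exact: lt_le_trans lambda_le.
Qed.

Hypotheses (tau_gt0 : 0 < tau) (gamma_gt0 : 0 < gamma) (tau_le : tau <= 1 / (3 * Lg)).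
Hypotheses (taus_eta : forall t, taus t = eta t) (eta_gt0 : forall t, 0 < eta t).

Lemma tracking_descent t o : eta t <= 1 ->
  tracking_err t.+1 o <= (1 - eta t * tau * lambda / 4) * tracking_err t o
    - eta t / 2 * tau ^+ 2 * frob (w t.+1 o) ^+ 2
    + 8 * (eta t * tau / lambda) * err_w t.+1 o
    + 8 / (eta t * tau * lambda)
        * (Ly ^+ 2 * ((eta t * gamma) ^+ 2 * frob (z t.+1 o) ^+ 2)).
Proof.
move=> a1; have a0 := eta_gt0 t.
have := tracking_step (w t.+1 o) a0 a1 tau_gt0 lambda_gt0 lambda_le tau_le
  (grady_monotone (x t o) (y t o)) (ystar (x t o) - ystar (x t.+1 o)).
have -> : y t o - ystar (x t o) - (eta t * tau) *: w t.+1 o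
    + (ystar (x t o) - ystar (x t.+1 o)) = y t.+1 o - ystar (x t.+1 o).
  rewrite (svrb_y hrun) taus_eta; move: (ystar _) (ystar _) => p q.
  by apply/matrixP => i j; rewrite !mxE; ring.
rewrite /tracking_err /err_w -!sqr_frob => /le_trans; apply; rewrite lerD2l.
rewrite ler_wpM2l ?divr_ge0 ?mulr_ge0 ?(ltW a0) ?(ltW tau_gt0) ?(ltW lambda_gt0)//.
have h := ystar_lip (x t o) (x t.+1 o).
rewrite -ler_sqr ?nnegrE ?frob_ge0 ?mulr_ge0 ?frob_ge0 ?(ltW Ly_gt0)// in h.
apply: (le_trans h); rewrite exprMn ler_wpM2l ?sqr_ge0//.
rewrite (svrb_x hrun) opprB addrC subrK frobZ exprMn real_normK ?num_real//.
Qed.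

(** * The potential *)

Variables (xstar_min : is_argmin F xstar) (C : R).

Definition total_err t o :=
  err_u t o + err_v t o + err_V t o + err_H t o + err_w t o.

(** The errors are weighted by the inverse of the previous step size: a recursion with
momentum of order [eta ^ 2] then decreases the weighted error by order [eta], the
order at which the errors enter [F_descent]. At [t = 0] the weight is the one of
[t = 1]. *)
Definition potential t o :=
  F (x t o) - F xstar + C * gamma * tracking_err t o + (eta t.-1)^-1 * total_err t.+1 o.

Definition total_bound t o :=
  storm_bound (bfx t) Lfx (err_u t o) (motion t o)
  + storm_bound (bfy t) Lfy (err_v t o) (motion t o)
  + storm_bound (bgxy t) Lgxy (err_V t o) (motion t o)
  + storm_bound (bgyy t) Lgyy (err_H t o) (motion t o)
  + storm_bound (bgy t) Lgy (err_w t o) (motion t o).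

(** The mean of the next potential given the past is at most this quantity. *)
Definition next_potential t o :=
  F (x t.+1 o) - F xstar + C * gamma * tracking_err t.+1 o + (eta t)^-1 * total_bound t.+1 o.

Variables (c c0 : R).
Hypotheses (c_gt0 : 0 < c) (c0_ge2 : 2 <= c0) (eta_step : forall t, eta t = step_size c c0 t).
Hypotheses (C_gt0 : 0 < C) (C_C0 : 4 * C0 <= C * (tau * lambda)) (C_calL : 4 * calL <= C * gamma)
  (gamma_calL : 16 * calL * gamma <= 1)
  (gamma_Ly : 64 * C * gamma ^+ 2 * Ly ^+ 2 <= tau * lambda).
Let kappa := 1 / (7 * LF * c ^+ 3).
Hypotheses (bgyE : forall t, bgy t.+1 =
     (kappa + 8 * C * gamma * taus t * tau / (lambda * eta t)) * eta t ^+ 2)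
  (bfxE : forall t, bfx t.+1 = (kappa + C1 * gamma) * eta t ^+ 2)
  (bfyE : forall t, bfy t.+1 = (kappa + C4 * gamma) * eta t ^+ 2)
  (bgxyE : forall t, bgxy t.+1 = (kappa + C2 * gamma) * eta t ^+ 2)
  (bgyyE : forall t, bgyy t.+1 = (kappa + C3 * gamma) * eta t ^+ 2).

Lemma kappa_gt0 : 0 < kappa.
Proof. by rewrite divr_gt0// !mulr_gt0// exprn_gt0. Qed.

Lemma C_ge0 : [/\ 0 <= C1, 0 <= C2, 0 <= C3 & 0 <= C4].
Proof.
rewrite C1E C2E C3E C4E; have l := ltW lambda_gt0.
have s (r : R) : 0 <= 6 * r ^+ 2 by rewrite mulr_ge0 ?sqr_ge0.
split=> //.
- exact: divr_ge0 (s _) (sqr_ge0 _).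
- exact: divr_ge0 (mulr_ge0 (s _) (sqr_ge0 _)) (exprn_ge0 _ l).
- exact: divr_ge0 (s _) (sqr_ge0 _).
Qed.

Let mw := 8 * C * gamma * tau / lambda.

Lemma mw_ge0 : 0 <= mw.
Proof. by rewrite divr_ge0 ?(ltW lambda_gt0)// !mulr_ge0// ltW. Qed.

Lemma bgyE' t : bgy t.+1 = (kappa + mw) * eta t ^+ 2.
Proof.
rewrite bgyE taus_eta /mw; have := eta_gt0 t; move: (eta t) => a a0; congr (_ * _).
by congr (_ + _); field; rewrite !gt_eqF.
Qed.

(** The momenta are multiples of [eta ^ 2], so each noise term is of order [eta ^ 4];
weighted by [1 / eta] in the potential, the five together cost [noise * eta ^ 3]. *)
Let noise := 2 * ((kappa + C1 * gamma) ^+ 2 + (kappa + C4 * gamma) ^+ 2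
  + (kappa + C2 * gamma) ^+ 2 + (kappa + C3 * gamma) ^+ 2 + (kappa + mw) ^+ 2) * sigma ^+ 2.

Lemma err_ge0 t o : [/\ 0 <= err_u t o, 0 <= err_v t o, 0 <= err_V t o, 0 <= err_H t o
  & 0 <= err_w t o].
Proof. by split; exact: sqr_ge0. Qed.

(** The step size tends to zero, so from some time on all its smallness conditions
hold; this is the only range of times that matters for the rate. *)
Lemma eta_eventually e : 0 < e -> exists t0, forall t, (t0 <= t)%N -> eta t <= e.
Proof.
move=> e0; have [t0 h] := step_size_small c_gt0 c0_ge2 e0; exists t0 => t /h.
by rewrite eta_step.
Qed.

Lemma potential_descent t o : (0 < t)%N ->
  eta t <= 1 -> LF * eta t * gamma <= 1 / 2 -> eta t <= kappa * c ^+ 3 ->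
  (kappa + C1 * gamma + C2 * gamma + C3 * gamma + C4 * gamma + mw) * eta t ^+ 2 <= 1 ->
  next_potential t o + gamma / 2 * eta t * sqr_grad t o <=
    potential t o + noise * eta t ^+ 3.
Proof.
move=> t0 a1 aLF ak ab; have a0 := eta_gt0 t.
have [eu0 ev0 eV0 eH0 ew0] := err_ge0 t.+1 o.
have [C10 C20 C30 C40] := C_ge0; have mw0 := mw_ge0; have k0 := kappa_gt0.
have g0 := ltW gamma_gt0.
have wt : (eta t)^-1 <= (eta t.-1)^-1 + kappa * eta t.
  rewrite -[in X in X <= _](prednK t0) -[in X in _ <= _ + X](prednK t0) !eta_step.
  apply: step_size_inv_increment => //.
  by rewrite prednK// -eta_step.
have b01 m b : 0 <= m -> m <= C1 * gamma + C2 * gamma + C3 * gamma + C4 * gamma + mw ->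
    b = (kappa + m) * eta t ^+ 2 -> 0 <= b <= 1.
  move=> m0 mle ->; rewrite mulr_ge0 ?sqr_ge0 ?addr_ge0 ?(ltW k0)//=.
  apply: le_trans ab; rewrite ler_wpM2r ?sqr_ge0// -!addrA lerD2l.
  by rewrite -!addrA in mle.
have G1 := mulr_ge0 C10 g0; have G2 := mulr_ge0 C20 g0; have G3 := mulr_ge0 C30 g0.
have G4 := mulr_ge0 C40 g0.
pose M := C1 * gamma + C2 * gamma + C3 * gamma + C4 * gamma + mw.
have M1 : C1 * gamma <= M by rewrite /M -!addrA lerDl !addr_ge0.
have M2 : C2 * gamma <= M by rewrite /M; move: mw mw0 => ? ?; lra.
have M3 : C3 * gamma <= M by rewrite /M; move: mw mw0 => ? ?; lra.
have M4 : C4 * gamma <= M by rewrite /M; move: mw mw0 => ? ?; lra.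
have M5 : mw <= M by rewrite /M; move: mw mw0 => ? ?; lra.
have dxy0 := motion_ge0 t.+1 o.
have sL (r : R) : 0 <= r ^+ 2 by exact: sqr_ge0.
have t1 := storm_term (sigma ^+ 2) a0 (bfxE t)
  (b01 _ _ G1 M1 (bfxE t)) wt eu0 (sL Lfx) dxy0.
have t2 := storm_term (sigma ^+ 2) a0 (bfyE t)
  (b01 _ _ G4 M4 (bfyE t)) wt ev0 (sL Lfy) dxy0.
have t3 := storm_term (sigma ^+ 2) a0 (bgxyE t)
  (b01 _ _ G2 M2 (bgxyE t)) wt eV0 (sL Lgxy) dxy0.
have t4 := storm_term (sigma ^+ 2) a0 (bgyyE t)
  (b01 _ _ G3 M3 (bgyyE t)) wt eH0 (sL Lgyy) dxy0.
have t5 := storm_term (sigma ^+ 2) a0 (bgyE' t)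
  (b01 _ _ mw0 M5 (bgyE' t)) wt ew0 (sL Lgy) dxy0.
have dec := potential_decrease a0 gamma_gt0 tau_gt0 lambda_gt0 (ltW C_gt0) aLF C_C0 C_calL
  gamma_calL gamma_Ly (sqr_ge0 (frob (z t.+1 o))) (sqr_ge0 (frob (w t.+1 o))) 
  (sqr_ge0 (frob (y t o - ystar (x t o)))) (F_descent t o) (hypergradient_error t o)
  (tracking_descent o a1).
rewrite -(motionE o (taus_eta t)) in dec.
rewrite /next_potential /potential /total_err /total_bound /storm_bound.
rewrite -/(tracking_err t o) in dec.
have E : (eta t)^-1 * (2 * calL * motion t.+1 o) =
    (eta t)^-1 * (2 * Lfx ^+ 2 * motion t.+1 o) + (eta t)^-1 * (2 * Lfy ^+ 2 * motion t.+1 o)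
    + (eta t)^-1 * (2 * Lgxy ^+ 2 * motion t.+1 o) + (eta t)^-1 * (2 * Lgyy ^+ 2 * motion t.+1 o)
    + (eta t)^-1 * (2 * Lgy ^+ 2 * motion t.+1 o) by rewrite calLE; ring.
rewrite E in dec; clear E wt.
rewrite -/mw in dec; rewrite /noise 4!(mulrDr (eta t)^-1).
move: t1 t2 t3 t4 t5 dec.
move: (_ * (_ + 2 * bfx t.+1 ^+ 2 * _)) (_ * (_ + 2 * bfy t.+1 ^+ 2 * _)) => T1 T2.
move: (_ * (_ + 2 * bgxy t.+1 ^+ 2 * _)) (_ * (_ + 2 * bgyy t.+1 ^+ 2 * _)) => T3 T4.
move: (_ * (_ + 2 * bgy t.+1 ^+ 2 * _)) => T5.
move: (_ * (2 * Lfx ^+ 2 * _)) (_ * (2 * Lfy ^+ 2 * _)) (_ * (2 * Lgxy ^+ 2 * _)) => D1 D2 D3.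
move: (_ * (2 * Lgyy ^+ 2 * _)) (_ * (2 * Lgy ^+ 2 * _)) ((eta t.-1)^-1) => D4 D5 wt.
move: (err_u _ _) (err_v _ _) (err_V _ _) (err_H _ _) (err_w _ _) => eu ev eV eH ew.
move: (tracking_err _ _) (tracking_err _ _) (F _) (F _) (F _) => tr1 tr0 F1 F2 F0.
move: (sqr_grad t o) (eta t) kappa mw => gg a k m; lra.
Qed.

Lemma noise_ge0 : 0 <= noise.
Proof.
by rewrite mulr_ge0 ?sqr_ge0// mulr_ge0// !addr_ge0 ?sqr_ge0.
Qed.

Lemma potential_descent_eventually : exists t0 K, 0 <= K /\
  forall t o, (t0 <= t)%N ->
    next_potential t o + gamma / 2 * eta t * sqr_grad t o <=
    potential t o + K / (c0 + t%:R).
Proof.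
have k0 := kappa_gt0; have [C10 C20 C30 C40] := C_ge0; have mw0 := mw_ge0.
pose M := kappa + C1 * gamma + C2 * gamma + C3 * gamma + C4 * gamma + mw.
have g0 := ltW gamma_gt0.
have M0 : 0 < M by rewrite /M -!addrA ltr_wpDr// !addr_ge0// mulr_ge0.
have [t1 h1] := eta_eventually ltr01.
have [t2 h2] := eta_eventually (ltac:(by rewrite divr_gt0// !mulr_gt0) : 0 < 1 / (2 * LF * gamma)).
have [t3 h3] := eta_eventually (ltac:(by rewrite mulr_gt0// exprn_gt0) : 0 < kappa * c ^+ 3).
have [t4 h4] := eta_eventually (ltac:(by rewrite invr_gt0) : 0 < M^-1).
exists (maxn 1 (maxn (maxn t1 t2) (maxn t3 t4))), (noise * c ^+ 3); split.
  by rewrite mulr_ge0 ?noise_ge0// exprn_ge0// ltW.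
move=> t o; rewrite !geq_max => /andP[tp /andP[/andP[l1 l2] /andP[l3 l4]]].
rewrite (_ : noise * c ^+ 3 / (c0 + t%:R) = noise * eta t ^+ 3); last first.
  by rewrite eta_step step_size_cube// [RHS]mulrA.
apply: potential_descent => //; [exact: h1| |exact: h3|].
  have := h2 _ l2; rewrite ler_pdivlMr ?mulr_gt0// => h.
  by move: h; move: (eta t) => a h; lra.
rewrite -/M; apply: (@le_trans _ _ (M * eta t)).
  by rewrite ler_wpM2l ?(ltW M0)// expr2 ler_piMr ?(ltW (eta_gt0 t))// h1.
by have := h4 _ l4; rewrite -(ler_pM2l M0) mulfV ?gt_eqF.
Qed.

(** For the finitely many earlier times a crude bound is enough: in one step every
quantity grows by at most a constant factor and a constant. *)
Definition dominated (h k : Omega -> R) : Prop :=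
  exists2 K, 0 <= K & forall o, h o <= K * (k o + 1).

Lemma dominated_le h1 h2 k : (forall o, h1 o <= h2 o) -> dominated h2 k -> dominated h1 k.
Proof. by move=> h12 [K K0 hK]; exists K => // o; exact: le_trans (h12 o) (hK o). Qed.

Lemma dominatedD h1 h2 k : dominated h1 k -> dominated h2 k ->
  dominated (fun o => h1 o + h2 o) k.
Proof.
move=> [K K0 hK] [K' K'0 hK']; exists (K + K'); first exact: addr_ge0.
by move=> o; rewrite mulrDl lerD.
Qed.

Lemma dominatedZ h a k : 0 <= a -> dominated h k -> dominated (fun o => a * h o) k.
Proof.
move=> a0 [K K0 hK]; exists (a * K); first exact: mulr_ge0.
by move=> o; rewrite -mulrA ler_wpM2l.
Qed.

Lemma dominated_cst a k : (forall o, 0 <= k o) -> dominated (fun=> a) k.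
Proof.
move=> k0; exists `|a| => // o; apply: (le_trans (ler_norm a)).
by rewrite ler_peMr// lerDr.
Qed.

Lemma tracking_err_ge0 t o : 0 <= tracking_err t o.
Proof. exact: sqr_ge0. Qed.

Lemma gap_ge0 t o : 0 <= F (x t o) - F xstar.
Proof. by rewrite subr_ge0. Qed.

Lemma total_err_ge0 t o : 0 <= total_err t o.
Proof.
have [h1 h2 h3 h4 h5] := err_ge0 t o.
exact: addr_ge0 (addr_ge0 (addr_ge0 (addr_ge0 h1 h2) h3) h4) h5.
Qed.

Lemma potential_ge0 t o : 0 <= potential t o.
Proof.
have Cg0 : 0 <= C * gamma by rewrite mulr_ge0// ltW.
apply: addr_ge0; first exact: addr_ge0 (gap_ge0 t o) (mulr_ge0 Cg0 (tracking_err_ge0 t o)).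
by apply: mulr_ge0; [rewrite invr_ge0 ltW | exact: total_err_ge0].
Qed.

Lemma potential_parts t : [/\ dominated (fun o => F (x t o) - F xstar) (potential t),
  dominated (tracking_err t) (potential t) & dominated (total_err t.+1) (potential t)].
Proof.
have Cg0 : 0 < C * gamma by rewrite mulr_gt0.
have e0 := eta_gt0 t.-1.
have parts o : [/\ 0 <= F (x t o) - F xstar, 0 <= C * gamma * tracking_err t o
    & 0 <= (eta t.-1)^-1 * total_err t.+1 o].
  split; first exact: gap_ge0.
    exact: mulr_ge0 (ltW Cg0) (tracking_err_ge0 t o).
  by apply: mulr_ge0; [rewrite invr_ge0 ltW | exact: total_err_ge0].
split.
- exists 1 => // o; have [p1 p2 p3] := parts o; rewrite /potential mul1r; lra.
- exists (C * gamma)^-1; first by rewrite invr_ge0 ltW.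
  move=> o; have [p1 p2 p3] := parts o.
  by rewrite -(ler_pM2l Cg0) mulVKf ?gt_eqF// /potential; lra.
- exists (eta t.-1); first exact: ltW.
  move=> o; have [p1 p2 p3] := parts o.
  rewrite -(ler_pM2l (ltac:(by rewrite invr_gt0) : 0 < (eta t.-1)^-1)) mulKf ?gt_eqF//.
  by rewrite /potential; lra.
Qed.

Lemma sqr_grad_le_gap t o : sqr_grad t o <= 2 * LF * (F (x t o) - F xstar).
Proof. exact: (sqr_grad_le F_has_grad LF_gt0 F_smooth xstar_min). Qed.

(** Cauchy-Schwarz in [grady_monotone], with the strong convexity term dropped. *)
Lemma frob_grady_le x1 y1 : fdot (grady g x1 y1) (grady g x1 y1) <=
  (2 * Lg) ^+ 2 * fdot (y1 - ystar x1) (y1 - ystar x1).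
Proof.
have Lg0 : 0 < Lg by exact: lt_le_trans lambda_le.
have := grady_monotone x1 y1; have := CauchySchwarz (grady g x1 y1) (y1 - ystar x1).
move: (grady g x1 y1) (y1 - ystar x1) => G e cs mono.
have h : fdot G G / (2 * Lg) <= frob G * frob e.
  apply: le_trans cs; apply: le_trans mono; rewrite lerDr.
  by rewrite mulr_ge0 ?fdotAA_ge0// divr_ge0 ?(ltW lambda_gt0).
rewrite ler_pdivrMr ?mulr_gt0// -sqr_frob in h.
have [G0|Gn0] := eqVneq (frob G) 0.
  by rewrite -sqr_frob G0 expr0n mulr_ge0 ?sqr_ge0 ?fdotAA_ge0.
have Gp : 0 < frob G by rewrite lt0r Gn0 frob_ge0.
rewrite expr2 -mulrA ler_pM2l// in h.
rewrite -!sqr_frob -exprMn ler_sqr ?nnegrE ?mulr_ge0 ?frob_ge0 ?(ltW Lg0)//.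
by rewrite mulrC.
Qed.

Lemma next_potential_dominated t : dominated (next_potential t) (potential t).
Proof.
have [dF dD dE] := potential_parts t; have a0 := eta_gt0 t.
have err1 h : (forall o, h o <= total_err t.+1 o) -> dominated h (potential t).
  by move=> hh; exact: dominated_le dE.
have part o := err_ge0 t.+1 o.
have deu : dominated (err_u t.+1) (potential t).
  by apply: err1 => o; have [? ? ? ? ?] := part o; rewrite /total_err; lra.
have dev : dominated (err_v t.+1) (potential t).
  by apply: err1 => o; have [? ? ? ? ?] := part o; rewrite /total_err; lra.
have deV : dominated (err_V t.+1) (potential t).
  by apply: err1 => o; have [? ? ? ? ?] := part o; rewrite /total_err; lra.
have deH : dominated (err_H t.+1) (potential t).
  by apply: err1 => o; have [? ? ? ? ?] := part o; rewrite /total_err; lra.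
have dew : dominated (err_w t.+1) (potential t).
  by apply: err1 => o; have [? ? ? ? ?] := part o; rewrite /total_err; lra.
have [C10 C20 C30 C40] := C_ge0.
have C00 : 0 <= C0.
  have l := ltW lambda_gt0.
  have s (r : R) : 0 <= 6 * r ^+ 2 by exact: (mulr_ge0 (ler0n _ 6) (sqr_ge0 _)).
  rewrite C0E !addr_ge0//.
  - exact: (mulr_ge0 (ler0n _ 2) (sqr_ge0 _)).
  - exact: (divr_ge0 (mulr_ge0 (s _) (sqr_ge0 _)) (sqr_ge0 _)).
  - exact: (divr_ge0 (mulr_ge0 (mulr_ge0 (s _) (sqr_ge0 _)) (sqr_ge0 _)) (exprn_ge0 _ l)).
  - exact: (divr_ge0 (mulr_ge0 (s _) (sqr_ge0 _)) (sqr_ge0 _)).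
pose N o := frob (grad F (x t o) - z t.+1 o) ^+ 2.
have dN : dominated N (potential t).
  apply: dominated_le (fun o => hypergradient_error t o) _.
  apply: dominatedZ => //; do 4 (apply: dominatedD; last exact: dominatedZ).
  exact: dominatedZ.
have dg : dominated (sqr_grad t) (potential t).
  apply: dominated_le (fun o => sqr_grad_le_gap t o) _.
  by apply: dominatedZ => //; rewrite mulr_ge0// ltW.
have dZ' : dominated (fun o => frob (z t.+1 o) ^+ 2) (potential t).
  apply: (@dominated_le _ (fun o => 2 * sqr_grad t o + 2 * N o)).
    move=> o; have := sqr_frobD_le (grad F (x t o)) (- (grad F (x t o) - z t.+1 o)).
    by rewrite frobN opprB addrC subrK.
  by apply: dominatedD; exact: dominatedZ.
have dW : dominated (fun o => frob (w t.+1 o) ^+ 2) (potential t).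
  apply: (@dominated_le _ (fun o => 2 * ((2 * Lg) ^+ 2 * tracking_err t o) + 2 * err_w t.+1 o)).
    move=> o; have := sqr_frobD_le (grady g (x t o) (y t o)) (w t.+1 o - grady g (x t o) (y t o)).
    rewrite addrC subrK => /le_trans; apply; rewrite lerD2r ler_wpM2l//.
    by rewrite /tracking_err !sqr_frob frob_grady_le.
  by apply: dominatedD; apply: dominatedZ => //; apply: dominatedZ => //; exact: sqr_ge0.
have dM : dominated (motion t.+1) (potential t).
  apply: (@dominated_le _ (fun o => (eta t * gamma) ^+ 2 * frob (z t.+1 o) ^+ 2
    + (eta t * tau) ^+ 2 * frob (w t.+1 o) ^+ 2)).
    by move=> o; rewrite motionE.
  by apply: dominatedD; apply: dominatedZ => //; exact: sqr_ge0.
have dF1 : dominated (fun o => F (x t.+1 o) - F xstar) (potential t).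
  apply: (@dominated_le _ (fun o => (F (x t o) - F xstar) + (eta t * gamma / 2 * N o
    + LF / 2 * (eta t * gamma) ^+ 2 * frob (z t.+1 o) ^+ 2))).
    move=> o; have := F_descent t o.
    have ag0 : 0 <= eta t * gamma / 2 by rewrite divr_ge0// mulr_ge0// ltW.
    have := mulr_ge0 ag0 (sqr_ge0 (frob (grad F (x t o)))).
    have := mulr_ge0 ag0 (sqr_ge0 (frob (z t.+1 o))).
    rewrite /N -/(sqr_grad t o); lra.
  apply: dominatedD => //; apply: dominatedD; apply: dominatedZ => //.
    by rewrite divr_ge0// mulr_ge0// ltW.
  by rewrite mulr_ge0 ?sqr_ge0// divr_ge0// ltW.
have dD1 : dominated (tracking_err t.+1) (potential t).
  apply: (@dominated_le _ (fun o => 3 * tracking_err t o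
     + (3 * (eta t * tau) ^+ 2 * frob (w t.+1 o) ^+ 2
     + 3 * (Ly ^+ 2 * (eta t * gamma) ^+ 2) * frob (z t.+1 o) ^+ 2))).
    move=> o; rewrite /tracking_err (svrb_y hrun) taus_eta.
    have := sqr_frobD3_le (y t o - ystar (x t o)) (- ((eta t * tau) *: w t.+1 o))
       (ystar (x t o) - ystar (x t.+1 o)).
    rewrite (_ : _ + _ + _ = y t o - (eta t * tau) *: w t.+1 o - ystar (x t.+1 o)); last first.
      move: (ystar _) (ystar _) => p q; by apply/matrixP => i j; rewrite !mxE; ring.
    rewrite frobN frobZ exprMn real_normK ?num_real// => /le_trans; apply.
    have h := ystar_lip (x t o) (x t.+1 o).
    rewrite -ler_sqr ?nnegrE ?frob_ge0 ?mulr_ge0 ?frob_ge0 ?(ltW Ly_gt0)// in h.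
    have Ex : x t o - x t.+1 o = (eta t * gamma) *: z t.+1 o.
      by rewrite (svrb_x hrun) opprB addrC subrK.
    rewrite Ex frobZ !exprMn real_normK ?num_real// in h.
    move: h; move: (frob (ystar _ - _) ^+ 2) => q; lra.
  apply: dominatedD; first exact: dominatedZ.
  apply: dominatedD; apply: dominatedZ => //; rewrite mulr_ge0 ?sqr_ge0// mulr_ge0 ?sqr_ge0//.
have dS b L h : dominated h (potential t) ->
    dominated (fun o => storm_bound b L (h o) (motion t.+1 o)) (potential t).
  move=> dh; apply: dominatedD; last exact: (dominated_cst _ (potential_ge0 t)).
  apply: dominatedD; first exact: (dominatedZ (sqr_ge0 _)).
  apply: dominatedZ; first by rewrite mulr_ge0 ?sqr_ge0.
  exact: (dominatedZ (sqr_ge0 _)).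
apply: dominatedD.
  by apply: dominatedD => //; apply: dominatedZ => //; rewrite mulr_ge0// ltW.
apply: dominatedZ; first by rewrite invr_ge0 ltW.
rewrite /total_bound; by do 4 (apply: dominatedD; last exact: dS); exact: dS.
Qed.

(** * The potential in expectation *)

Lemma ge0_measurable_err t : [/\ ge0_measurable (err_u t), ge0_measurable (err_v t),
  ge0_measurable (err_V t), ge0_measurable (err_H t) & ge0_measurable (err_w t)].
Proof.
have [_ _ mx my mu mv mV mH mW] := adapted_stateP t.
split; split=> [|o]; try exact: sqr_ge0.
- exact: (measurable_error (sp_unbiased_fx hP) (aB_lip_fx hB) mu mx my).
- exact: (measurable_error (sp_unbiased_fy hP) (aB_lip_fy hB) mv mx my).
- exact: (measurable_error (sp_unbiased_gxy hP) (aB_lip_gxy hB) mV mx my).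
- exact: (measurable_error (sp_unbiased_gyy hP) (aB_lip_gyy hB) mH mx my).
- exact: (measurable_error (sp_unbiased_gy hP) (aB_lip_gy hB) mW mx my).
Qed.

Lemma ge0_measurable_motion t : ge0_measurable (motion t).
Proof.
have [mx my mxp myp _ _ _ _ _] := adapted_stateP t.
by apply: ge0_measurableD; split=> [|o]; try exact: sqr_ge0;
  apply/measurable_sqr_frob/mx_measurableB; exact: (adapted_measurable (t := t)).
Qed.

Lemma ge0_measurable_storm_bound b L h t : ge0_measurable h ->
  ge0_measurable (fun o => storm_bound b L (h o) (motion t o)).
Proof.
move=> mh; have two0 := ler0n R 2; have mm := ge0_measurable_motion t.
apply: ge0_measurableD; last by apply: ge0_measurable_cst; exact: (mulr_ge0 (mulr_ge0 two0 (sqr_ge0 _)) (sqr_ge0 _)).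
apply: ge0_measurableD; first exact: (ge0_measurableZ (sqr_ge0 _) mh).
apply: ge0_measurableZ; first exact: (mulr_ge0 two0 (sqr_ge0 _)).
exact: (ge0_measurableZ (sqr_ge0 _) mm).
Qed.

Lemma ge0_measurable_gap t : ge0_measurable (fun o => F (x t o) - F xstar).
Proof.
split; last exact: gap_ge0.
apply: measurable_funB; last exact: measurable_cst.
apply: measurable_continuous_comp; last exact: has_grad_continuous F_has_grad.
exact: adapted_measurable (adapted_x (adapted_stateP t)).
Qed.

Lemma ge0_measurable_tracking t : ge0_measurable (tracking_err t).
Proof.
split; last exact: tracking_err_ge0.
have mx := adapted_measurable (adapted_x (adapted_stateP t)).
have my := adapted_measurable (adapted_y (adapted_stateP t)).
by apply/measurable_sqr_frob/mx_measurableB => //; exact: mx_measurable_lip ystar_lip mx.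
Qed.

Lemma ge0_measurable_sqr_grad t : ge0_measurable (sqr_grad t).
Proof.
split=> [|o]; last exact: sqr_ge0.
have mx := adapted_measurable (adapted_x (adapted_stateP t)).
by apply: measurable_sqr_frob; exact: mx_measurable_lip F_smooth mx.
Qed.

Lemma ge0_measurable_base t :
  ge0_measurable (fun o => F (x t o) - F xstar + C * gamma * tracking_err t o).
Proof.
apply: ge0_measurableD; first exact: ge0_measurable_gap.
apply: ge0_measurableZ; last exact: ge0_measurable_tracking.
by rewrite mulr_ge0// ltW.
Qed.

Lemma ge0_measurable_total_err t : ge0_measurable (total_err t).
Proof. by have [? ? ? ? ?] := ge0_measurable_err t; do 4 apply: ge0_measurableD => //. Qed.

Lemma ge0_measurable_potential t : ge0_measurable (potential t).
Proof.
apply: ge0_measurableD; first exact: ge0_measurable_base.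
apply: ge0_measurableZ; last exact: ge0_measurable_total_err.
by rewrite invr_ge0 ltW.
Qed.

Lemma ge0_measurable_total_bound t : ge0_measurable (total_bound t).
Proof.
have [? ? ? ? ?] := ge0_measurable_err t.
by do 4 (apply: ge0_measurableD; last exact: ge0_measurable_storm_bound);
  exact: ge0_measurable_storm_bound.
Qed.

Lemma total_err_step t :
  (\int[P]_o (total_err t.+1 o)%:E <= \int[P]_o (total_bound t o)%:E)%E.
Proof.
have [mu1 mv1 mV1 mH1 mw1] := ge0_measurable_err t.+1.
have [mu mv mV mH mW] := ge0_measurable_err t.
have mS b L h (mh : ge0_measurable h) := ge0_measurable_storm_bound b L t mh.
have mD := @ge0_measurableD R _ Omega.
apply: (integral_leD (mD _ _ (mD _ _ (mD _ _ mu1 mv1) mV1) mH1)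
  (mD _ _ (mD _ _ (mD _ _ (mS _ _ _ mu) (mS _ _ _ mv)) (mS _ _ _ mV)) (mS _ _ _ mH))
  mw1 (mS _ _ _ mW)); last exact: err_w_step.
apply: (integral_leD (mD _ _ (mD _ _ mu1 mv1) mV1)
  (mD _ _ (mD _ _ (mS _ _ _ mu) (mS _ _ _ mv)) (mS _ _ _ mV)) mH1 (mS _ _ _ mH)); last exact: err_H_step.
apply: (integral_leD (mD _ _ mu1 mv1) (mD _ _ (mS _ _ _ mu) (mS _ _ _ mv)) mV1 (mS _ _ _ mV));
  last exact: err_V_step.
by apply: (integral_leD mu1 (mS _ _ _ mu) mv1 (mS _ _ _ mv)); [exact: err_u_step|exact: err_v_step].
Qed.

(** [F] and the tracking error are determined by the past; only the errors involve the
fresh samples. *)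
Lemma potential_le_bound t : (\int[P]_o (potential t o)%:E <=
  \int[P]_o (F (x t o) - F xstar + C * gamma * tracking_err t o
             + (eta t.-1)^-1 * total_bound t o)%:E)%E.
Proof.
have e0 : 0 <= (eta t.-1)^-1 by rewrite invr_ge0 ltW.
have me := ge0_measurable_total_err t.+1; have mb := ge0_measurable_total_bound t.
apply: (integral_leD (ge0_measurable_base t) (ge0_measurable_base t)
  (ge0_measurableZ e0 me) (ge0_measurableZ e0 mb)) => //.
exact: (integral_leZ e0 me mb (total_err_step t)).
Qed.

Lemma potential_le_next t :
  (\int[P]_o (potential t.+1 o)%:E <= \int[P]_o (next_potential t o)%:E)%E.
Proof. exact: (potential_le_bound t.+1). Qed.

Lemma ge0_measurable_next t : ge0_measurable (next_potential t).
Proof.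
apply: ge0_measurableD; first exact: ge0_measurable_base.
apply: ge0_measurableZ; last exact: (ge0_measurable_total_bound t.+1).
by rewrite invr_ge0 ltW.
Qed.

Lemma dominated_fin h k : ge0_measurable h -> ge0_measurable k -> dominated h k ->
  (\int[P]_o (k o)%:E < +oo)%E -> (\int[P]_o (h o)%:E < +oo)%E.
Proof.
move=> mh mk [K K0 hK] kfin.
have mk1 := ge0_measurableD mk (ge0_measurable_cst ler01).
apply: (le_lt_trans (le_integralr P mh (ge0_measurableZ K0 mk1) hK)).
rewrite integralZr// integralDr// (integral_cstr P 1).
rewrite lte_mul_pinfty ?lee_fin//.
by rewrite lte_add_pinfty// ltry.
Qed.

Lemma potential_fin t : (\int[P]_o (potential t o)%:E < +oo)%E.
Proof.
elim: t => [|t IH].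
  apply: (le_lt_trans (potential_le_bound 0)).
  (* The initial state does not depend on the outcome, so [h] is constant. *)
  pose h o := F (x 0%N o) - F xstar + C * gamma * tracking_err 0%N o
             + (eta 0%N)^-1 * total_bound 0%N o.
  have hE o : h o = h point.
    rewrite /h /total_bound /tracking_err /err_u /err_v /err_V /err_H /err_w /motion /=.
    by rewrite !(svrb_x0 hrun) !(svrb_y0 hrun) !(svrb_u0 hrun) !(svrb_v0 hrun) !(svrb_V0 hrun)
       !(svrb_H0 hrun) !(svrb_w0 hrun).
  rewrite (_ : (fun o => _) = (fun o => (h point)%:E)).
    by rewrite integral_cstr ltry.
  by apply/funext => o; exact: (congr1 EFin (hE o)).
apply: (le_lt_trans (potential_le_next t)).
apply: (dominated_fin (ge0_measurable_next t) (ge0_measurable_potential t)) => //.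
exact: next_potential_dominated.
Qed.

Lemma sqr_grad_fin t : (\int[P]_o (sqr_grad t o)%:E < +oo)%E.
Proof.
apply: (dominated_fin (ge0_measurable_sqr_grad t) (ge0_measurable_potential t)); last exact: potential_fin.
apply: dominated_le (fun o => sqr_grad_le_gap t o) _.
by apply: dominatedZ; [rewrite mulr_ge0// ltW | case: (potential_parts t)].
Qed.

Lemma expectation_rate : softO_le
    (fun T => 'E_P[fun o => (T.+1%:R^-1 * \sum_(t < T.+1) frob (grad F (x t o)) ^+ 2)%R])%E
    (fun T => 1 / T%:R `^ (2 / 3)).
Proof.
pose p t := fine (\int[P]_o (potential t o)%:E)%E.
pose e t := fine (\int[P]_o (sqr_grad t o)%:E)%E.
have pE t : ((p t)%:E = \int[P]_o (potential t o)%:E)%E.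
  rewrite fineK// ge0_fin_numE ?potential_fin//; apply: integral_ger0; exact: potential_ge0.
have eE t : ((e t)%:E = \int[P]_o (sqr_grad t o)%:E)%E.
  rewrite fineK// ge0_fin_numE ?sqr_grad_fin//; apply: integral_ger0 => o; exact: sqr_ge0.
have p0 t : 0 <= p t by rewrite -lee_fin pE; apply: integral_ger0; exact: potential_ge0.
have e0 t : 0 <= e t by rewrite -lee_fin eE; apply: integral_ger0 => o; exact: sqr_ge0.
have [t0 [K [K0 hK]]] := potential_descent_eventually.
have step t : (t0 <= t)%N -> p t.+1 + gamma / 2 * step_size c c0 t * e t <= p t + K / (c0 + t%:R).
  move=> tt; rewrite -eta_step.
  have a0 : 0 <= gamma / 2 * eta t by rewrite mulr_ge0 ?divr_ge0// ltW.
  have k0 : 0 <= K / (c0 + t%:R) by rewrite divr_ge0// ltW// c0t_gt0.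
  have mg := ge0_measurable_sqr_grad t; have mn := ge0_measurable_next t.
  have mp := ge0_measurable_potential t.
  have mK := ge0_measurable_cst k0 (Omega := Omega).
  have hR : ((p t + K / (c0 + t%:R))%:E = \int[P]_o (potential t o + K / (c0 + t%:R))%:E)%E.
    by rewrite EFinD pE (integralDr P mp mK) integral_cstr.
  have hL : ((p t.+1 + gamma / 2 * eta t * e t)%:E =
      \int[P]_o (potential t.+1 o)%:E + \int[P]_o (gamma / 2 * eta t * sqr_grad t o)%:E)%E.
    by rewrite EFinD pE (integralZr P a0 mg) -eE.
  rewrite -lee_fin hR hL.
  apply: (@le_trans _ _ (\int[P]_o (next_potential t o)%:E
      + \int[P]_o (gamma / 2 * eta t * sqr_grad t o)%:E)%E).
    by rewrite leeD2r// potential_le_next.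
  rewrite -integralDr//; last exact: ge0_measurableZ.
  apply: le_integralr.
  - by apply: ge0_measurableD => //; exact: ge0_measurableZ.
  - by apply: ge0_measurableD => //; exact: ge0_measurable_cst.
  - by move=> o; exact: hK.
have [K' hK'] := rate_of_potential c_gt0 c0_ge2 (ltac:(by rewrite divr_gt0) : 0 < gamma / 2)
  K0 p0 e0 step.
exists K', 1%N => T T0; rewrite unlock.
have Ti : 0 <= T.+1%:R^-1 :> R by rewrite invr_ge0.
have -> : (\int[P]_o (T.+1%:R^-1 * \sum_(t < T.+1) frob (grad F (x t o)) ^+ 2)%:E
    = (T.+1%:R^-1 * \sum_(t < T.+1) e t)%:E)%E.
  rewrite integralZr//; last first.
    split=> [|o]; last by apply: sumr_ge0 => i _; exact: sqr_ge0.
    by apply: measurable_sum => i; case: (ge0_measurable_sqr_grad i).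
  rewrite integral_sumr; last by move=> i; exact: ge0_measurable_sqr_grad.
  by rewrite EFinM -sumEFin; congr (_ * _)%E; apply: eq_bigr => i _; rewrite eE.
by rewrite lee_fin; exact: hK'.
Qed.

End Run.

Theorem theorem1 (R : realType) (d d' : nat) (hd : (0 < d)%N) (hd' : (0 < d')%N)
  (* the problem *)
  (dX dZ : measure_display) (Xi : measurableType dX) (Zeta : measurableType dZ)
  (PXi : probability Xi R) (PZeta : probability Zeta R)
  (f g : 'cV[R]_d -> 'cV[R]_d' -> R)
  (fs : 'cV[R]_d -> 'cV[R]_d' -> Xi -> R)
  (gs : 'cV[R]_d -> 'cV[R]_d' -> Zeta -> R)
  (ystar : 'cV[R]_d -> 'cV[R]_d') (F : 'cV[R]_d -> R)
  (hP : stochastic_problem PXi PZeta f g fs gs)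
  (hystar : forall x, is_argmin (g x) (ystar x))
  (hF : forall x, F x = f x (ystar x))
  (* Assumptions A and B *)
  (Lg lambda Lfx Lfy Lgy Lgxy Lgyy sigma Cfy Cgxy Delta : R)
  (x0 xstar : 'cV[R]_d)
  (hA : assumption_A g Lg lambda)
  (hB : assumption_B PXi PZeta f g fs gs Lfx Lfy Lgy Lgxy Lgyy sigma
          Cfy Cgxy Delta F x0 xstar)
  (* L_F and L_y *)
  (LF Ly : R) (hLF0 : 0 < LF) (hLy0 : 0 < Ly)
  (hLF : lipschitz_grad F LF)
  (hLy : forall x x', frob (ystar x - ystar x') <= Ly * frob (x - x'))
  (* constants *)
  (calL C0 C1 C2 C3 C4 : R)
  (hcalL : calL = Lgy ^+ 2 + Lfx ^+ 2 + Lfy ^+ 2 + Lgxy ^+ 2 + Lgyy ^+ 2)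
  (hC0 : C0 = 2 * Lfx ^+ 2
              + 6 * Cfy ^+ 2 * Lgxy ^+ 2 / lambda ^+ 2
              + 6 * Cfy ^+ 2 * Cgxy ^+ 2 * Lgyy ^+ 2 / lambda ^+ 4
              + 6 * Lfy ^+ 2 * Cgxy ^+ 2 / lambda ^+ 2)
  (hC1 : C1 = 2)
  (hC2 : C2 = 6 * Cfy ^+ 2 / lambda ^+ 2)
  (hC3 : C3 = 6 * Cfy ^+ 2 * Cgxy ^+ 2 / lambda ^+ 4)
  (hC4 : C4 = 6 * Cgxy ^+ 2 / lambda ^+ 2)
  (* parameters *)
  (c c0 gamma tau C : R) (eta taus bfx bfy bgxy bgyy bgy : nat -> R)
  (hc : 0 < c) (hgamma0 : 0 < gamma) (htau0 : 0 < tau)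
  (htau : tau <= 1 / (3 * Lg))
  (hgamma : gamma <= Num.min
     (Num.sqrt (tau * lambda) / (8 * Num.sqrt C * Ly)) (1 / (16 * calL)))
  (hC : C = Num.max (4 * C0 / (tau * lambda)) (4 * calL / gamma))
  (heta : forall t, eta t = c / (c0 + t%:R) `^ (1 / 3))
  (htaus : forall t, taus t = c / (c0 + t%:R) `^ (1 / 3))
  (hc0 : \big[Num.max/2]_(a <-
     [:: (4 * LF * c) ^+ 3;
         (c ^+ 2 * lambda / (16 * C * gamma * tau)) `^ (3 / 2);
         (2 / (7 * LF * c)) `^ (3 / 2);
         (2 * (C1 + C2 + C3 + C4) * gamma * c ^+ 2) `^ (3 / 2)]) a <= c0)
  (hbfx0 : 0 < bfx 0%N <= 1) (hbfy0 : 0 < bfy 0%N <= 1)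
  (hbgxy0 : 0 < bgxy 0%N <= 1) (hbgyy0 : 0 < bgyy 0%N <= 1)
  (hbgy0 : 0 < bgy 0%N <= 1)
  (hbgy : forall t, bgy t.+1 =
     (1 / (7 * LF * c ^+ 3) + 8 * C * gamma * taus t * tau / (lambda * eta t))
     * eta t ^+ 2)
  (hbfx : forall t, bfx t.+1 =
     (1 / (7 * LF * c ^+ 3) + C1 * gamma) * eta t ^+ 2)
  (hbfy : forall t, bfy t.+1 =
     (1 / (7 * LF * c ^+ 3) + C4 * gamma) * eta t ^+ 2)
  (hbgxy : forall t, bgxy t.+1 =
     (1 / (7 * LF * c ^+ 3) + C2 * gamma) * eta t ^+ 2)
  (hbgyy : forall t, bgyy t.+1 =
     (1 / (7 * LF * c ^+ 3) + C3 * gamma) * eta t ^+ 2)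
  (* the run of the algorithm *)
  (dO : measure_display) (Omega : measurableType dO) (P : probability Omega R)
  (xi : nat -> {mfun Omega >-> Xi}) (zeta : nat -> {mfun Omega >-> Zeta})
  (hsamples : fresh_samples PXi PZeta P xi zeta)
  (y0 : 'cV[R]_d') (u0 : 'cV[R]_d) (v0 : 'cV[R]_d')
  (V0 : 'M[R]_(d, d')) (H0 : 'M[R]_d') (w0 : 'cV[R]_d')
  (x : nat -> Omega -> 'cV[R]_d) (y : nat -> Omega -> 'cV[R]_d')
  (u : nat -> Omega -> 'cV[R]_d) (v : nat -> Omega -> 'cV[R]_d')
  (V : nat -> Omega -> 'M[R]_(d, d')) (H : nat -> Omega -> 'M[R]_d')
  (w : nat -> Omega -> 'cV[R]_d') (z : nat -> Omega -> 'cV[R]_d)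
  (hrun : svrb fs gs xi zeta Cfy Cgxy lambda gamma tau eta taus
            bfx bfy bgxy bgyy bgy x0 y0 u0 v0 V0 H0 w0 x y u v V H w z) :
  softO_le
    (fun T => 'E_P[fun o => (T.+1%:R^-1 *
                \sum_(t < T.+1) frob (grad F (x t o)) ^+ 2)%R])%E
    (fun T => 1 / T%:R `^ (2 / 3)).
Proof.
have [lambda_gt0 hH] := hA.
have g_smooth x1 y1 : loewner_le (hessyy g x1 y1) Lg%:M by have [] := hH x1 y1.
have g_convex x1 y1 : loewner_le lambda%:M (hessyy g x1 y1) by have [] := hH x1 y1.
have lambda_le : lambda <= Lg.
  pose v1 : 'cV[R]_d' := delta_mx (Ordinal hd') 0.
  have v1E : fdot v1 v1 = 1 by rewrite fdot_delta mxE !eqxx.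
  have := loewner_ge_quad v1 (g_convex x0 0); have := loewner_le_quad v1 (g_smooth x0 0).
  by rewrite v1E !mulr1 => h1 /le_trans; apply.
move: hgamma; rewrite le_min => /andP[gamma_Ly gamma_calL].
have calL0 : 0 <= calL by rewrite hcalL !addr_ge0// sqr_ge0.
(* a zero denominator would force gamma <= 0 *)
have calL_gt0 : 0 < calL.
  rewrite lt_neqAle calL0 andbT; apply/eqP => calLE.
  by move: gamma_calL; rewrite -calLE mulr0 invr0 mulr0 leNgt hgamma0.
have C_ge1 : 4 * C0 / (tau * lambda) <= C by rewrite hC le_max lexx.
have C_ge2 : 4 * calL / gamma <= C by rewrite hC le_max lexx orbT.
have C_gt0 : 0 < C by apply: lt_le_trans C_ge2; rewrite divr_gt0// mulr_gt0.
have tl0 : 0 < tau * lambda by rewrite mulr_gt0.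
have c0_ge2 : 2 <= c0.
  by move: hc0; rewrite !big_cons big_nil !ge_max => /andP[_ /andP[_ /andP[_ /andP[_ ->]]]].
have eta_step t : eta t = step_size c c0 t by exact: heta.
have taus_eta t : taus t = eta t by rewrite htaus heta.
have eta_gt0 t : 0 < eta t by rewrite eta_step; exact: step_size_gt0.
have sq : 64 * C * gamma ^+ 2 * Ly ^+ 2 <= tau * lambda.
  have sC : 0 < Num.sqrt C by rewrite sqrtr_gt0.
  move: gamma_Ly; rewrite ler_pdivlMr ?mulr_gt0// => h.
  have h0 : 0 <= gamma * (8 * Num.sqrt C * Ly) by rewrite !mulr_ge0// ltW.
  rewrite -[leRHS](sqr_sqrtr (ltW tl0)).
  apply: (@le_trans _ _ ((gamma * (8 * Num.sqrt C * Ly)) ^+ 2)).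
    by rewrite !exprMn (sqr_sqrtr (ltW C_gt0)) le_eqVlt; apply/orP; left; apply/eqP; ring.
  by rewrite ler_sqr ?nnegrE// sqrtr_ge0.
apply: (expectation_rate hP hB lambda_gt0 hrun hsamples g_convex hystar hF g_smooth
  lambda_le hLF0 hLy0 hLF hLy hcalL hC0 hC1 hC2 hC3 hC4 htau0 hgamma0 htau taus_eta eta_gt0
  (aB_argmin hB) hc c0_ge2 eta_step C_gt0 _ _ _ sq hbgy hbfx hbfy hbgxy hbgyy).
- by rewrite -ler_pdivrMr.
- by rewrite -ler_pdivrMr.
- by move: gamma_calL; rewrite ler_pdivlMr ?mulr_gt0// mulrC.
Qed.
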